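(* Let $x_0>1$ and $K=[1,x_0]\subset\mathbb{R}\subset\mathbb{C}$. Then $\alpha_K=\frac{1}{\sqrt{x_0}-1}$.
   Context: For a bounded domain $G\subset\mathbb{C}\setminus(-\infty,0]$ and $\alpha>0$, $z^{\alpha}$ is defined with the principal branch of the logarithm, and $(G,z^{\alpha})$ is called a pair of approximation if for every function $f$ holomorphic in $G$ there is a sequence of polynomials $(P_n)_n$ with $\deg(P_n)\le n$ such that $z^{\alpha n}P_n\to f$ locally uniformly on $G$. For a compact set $K\subset\mathbb{C}\setminus(-\infty,0]$ with connected complement, $\alpha_K\in(0,\infty]$ is the number such that, for $0<\alpha<\alpha_K$, there is a simply connected bounded domain $G\subset\mathbb{C}\setminus(-\infty,0]$ containing $K$ for which $(G,z^\alpha)$ is a pair of approximation, and for $\alpha\ge\alpha_K$ there is no such $G$. *)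

(* Defs.v *)
From HB Require Import structures.
From mathcomp Require Import all_boot all_order all_algebra.
From mathcomp Require Import all_classical all_reals all_analysis.
From mathcomp Require Export complex.

Set Implicit Arguments.
Unset Strict Implicit.
Unset Printing Implicit Defensive.

Import Order.TTheory GRing.Theory Num.Theory.
Import numFieldNormedType.Exports.

Local Open Scope classical_set_scope.
Local Open Scope ring_scope.
Local Open Scope complex_scope.

(* The topology and the normed structure over [R[i]] are found on the regular
   module [R[i]^o]; differentiability on it is complex differentiability. *)
Notation Cplx R := (R[i]^o).

Definition slit_plane (R : realType) : set (Cplx R) :=
  ~` [set t%:C | t in `]-oo, (0 : R)]].

(* Principal argument, in ]-pi, pi] for z != 0. *)
Definition carg (R : realType) (z : Cplx R) : R :=
  let theta := acos (complex.Re z / complex.Re `|z|) in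
  if 0 <= complex.Im z then theta else - theta.

Definition clog (R : realType) (z : Cplx R) : Cplx R :=
  ln (complex.Re `|z|) +i* carg z.

Definition cexp (R : realType) (z : Cplx R) : Cplx R :=
  (expR (complex.Re z))%:C * (cos (complex.Im z) +i* sin (complex.Im z)).

(* Only meant for z in the slit plane. *)
Definition cpow (R : realType) (z : Cplx R) (a : R) : Cplx R :=
  cexp (a%:C * clog z).

Definition domain (R : realType) (G : set (Cplx R)) : Prop :=
  [/\ G !=set0, open G & connected G].

(* Connectedness is not included: it is part of [domain]. *)
Definition simply_connected (R : realType) (G : set (Cplx R)) : Prop :=
  forall gamma : R -> Cplx R,
    {within `[0, 1], continuous gamma} ->
    (forall t, t \in `[0, 1] -> G (gamma t)) ->
    gamma 0 = gamma 1 ->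
  exists H : R * R -> Cplx R,
    [/\ {within `[0, 1] `*` `[0, 1], continuous H},
        (forall t s, t \in `[0, 1] -> s \in `[0, 1] -> G (H (t, s))),
        (forall t, t \in `[0, 1] -> H (t, 0) = gamma t),
        (forall t, t \in `[0, 1] -> H (t, 1) = gamma 0) &
        (forall s, s \in `[0, 1] -> H (0, s) = gamma 0 /\ H (1, s) = gamma 0)].

(* Functions on G are represented by total functions whose values outside G
   are irrelevant. *)
Definition holomorphic (R : realType) (G : set (Cplx R))
    (f : Cplx R -> Cplx R) : Prop :=
  forall z, G z -> derivable f z 1.

Definition cvg_locally_uniformly (R : realType) (G : set (Cplx R))
    (F : nat -> Cplx R -> Cplx R) (f : Cplx R -> Cplx R) : Prop :=
  forall z, G z -> exists2 U : set (Cplx R),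
    nbhs z U & {uniform U `&` G, F @ \oo --> f}.

Definition approximation_pair (R : realType) (G : set (Cplx R)) (alpha : R) :
    Prop :=
  [/\ domain G, bounded_set G, G `<=` @slit_plane R, 0 < alpha &
      forall f : Cplx R -> Cplx R, holomorphic G f ->
      exists P : nat -> {poly R[i]},
        (forall n, (size (P n) <= n.+1)%N) /\
        cvg_locally_uniformly G
          (fun n z => cpow z (alpha * n%:R) * (P n).[z]) f].

Definition has_approximation_pair (R : realType) (K : set (Cplx R))
    (alpha : R) : Prop :=
  exists G : set (Cplx R),
    [/\ K `<=` G, simply_connected G & approximation_pair G alpha].

(* [is_alphaK K a] : a is the number alpha_K.  Only meant for K compact, with
   connected complement, and contained in the slit plane. *)
Definition is_alphaK (R : realType) (K : set (Cplx R)) (a : \bar R) : Prop :=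
  [/\ (0 < a)%E,
      (forall alpha : R, 0 < alpha -> (alpha%:E < a)%E ->
         has_approximation_pair K alpha) &
      (forall alpha : R, (a <= alpha%:E)%E -> ~ has_approximation_pair K alpha)].

Lemma is_alphaK_unique (R : realType) (K : set (Cplx R)) (a b : \bar R) :
  is_alphaK K a -> is_alphaK K b -> a = b.
Proof.
have lt_absurd (c d : \bar R) :
    is_alphaK K c -> is_alphaK K d -> (c < d)%E -> False.
  move=> [c0 _ noc] [_ exd _]; case: c c0 noc => [r| |] //.
    rewrite lte_fin => r0 noc rd.
    by apply: (noc r (lexx _)); exact: exd.
  by move=> _ _; rewrite ltNge leey.
move=> ha hb; case: (ltgtP a b) => // h; exfalso.
  exact: lt_absurd ha hb h.
exact: lt_absurd hb ha h.
Qed.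

(* Main.v *)
Require Import Defs.
From mathcomp Require Import all_boot all_order all_algebra.
From mathcomp Require Import all_classical all_reals all_analysis.
From mathcomp Require Import complex.
From mathcomp Require Import cyclic separable cyclotomic.
From mathcomp Require Import ring lra zify.
Import Order.TTheory GRing.Theory Num.Theory.
Import numFieldNormedType.Exports.
Set Implicit Arguments.
Unset Strict Implicit.
Unset Printing Implicit Defensive.
Local Open Scope classical_set_scope.
Local Open Scope ring_scope.
Local Open Scope complex_scope.

(** Put r = sqrt x0, rho = (r - 1) / (r + 1) and c = ((r + 1) / 2)^2.  The map
   J(w) = c (1 + rho w) (1 + rho / w) sends the unit circle onto [1, x0] and the
   circle |w| = t onto the boundary of an ellipse with foci 1 and x0.  The
   condition alpha < 1 / (r - 1) reads rho (1 + 2 alpha) < 1.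

   If rho (1 + 2 alpha) < 1, choose t > 1 with rho t (1 + 2 alpha) < 1 and let G
   be the open ellipse bounded by J(|w| = t).  For some d > 0 there are
   polynomials q_n of degree at most (1 - d) n such that
   (1 + rho w)^m q_n(w) -> 1 uniformly on |w| <= t, where m = floor(alpha n):
   multiply (1 + rho w)^m by powers of linear factors with zeros spread on a
   circle, with Poisson kernel weights, so that the power sums of the reciprocal
   zeros of the product nearly cancel; q_n is this factor times a truncation of
   the inverse power series of the product.  Since J(w) = J(1/w),
   q_n(w) q_n(1/w) is a polynomial in J(w), and this gives polynomials Q_n of
   degree at most (1 - d) n with z^m Q_n(z) -> 1 on G.  The d n degrees left
   are used to approximate f(z) z^(m - alpha n) on a smaller ellipse; the
   exponent stays in [-1, 0], so finitely many polynomials do for each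
   precision.  Here f(J(exp zeta)) is even and 2 pi-periodic, and its convolution
   with the kernel (2 + 2 cos)^N, the line of integration being moved by
   Goursat's theorem, is a Laurent polynomial in exp zeta that is symmetrized
   into a polynomial in J(exp zeta).

   If rho (1 + 2 alpha) >= 1, suppose z^(alpha n) P_n(z) -> 1 and put
   m = floor(2 alpha n).  The polynomial w^n P_n(J(w)) (1 + rho w)^m is bounded
   on |w| = 1 up to a factor c^(- alpha n), because |J(w)| = c |1 + rho w|^2
   there.  Hence so are its coefficients, and evaluating it at w = -s with s < 1
   close to 1 bounds |z^(alpha n) P_n(z)| at z = J(-s) by C kappa^n with
   kappa < 1, although z lies in G. *)

(** The number 1 + 2 alpha is a mass count. The factor (1 + rho w)^(alpha n) carries mass alpha at
    -1/rho, and swept onto a circle this mass has density alpha times a Poisson kernel. To make the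
    total potential constant inside the circle, this density must be completed to a uniform one by
    adding a nonnegative density. The least uniform density is alpha (1 + rho) / (1 - rho), the
    maximum of the kernel, so the added mass is alpha (1 + rho) / (1 - rho) - alpha = 2 alpha rho /
    (1 - rho). It is below 1 exactly when rho (1 + 2 alpha) < 1; the strict inequality pays for the
    enlarged radii, the truncation, and f itself.

    Conversely, ln kappa has first-order term (1 - 2 alpha rho / (1 - rho)) (1 - s) at s = 1. It
    vanishes at the critical alpha, which must be excluded as well, so the logarithm inequalities
    used there are exact to second order at 1.

    J vanishes at w = -1/rho, so rho t < 1 keeps 0 outside the ellipse; the ellipse then even lies
    in the right half-plane, the only place where the logarithm has to be differentiated. *)

Notation nc := ComplexField.Normc.normc.

(** * Real-valued modulus, the topology it induces, and growth estimates *)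

Section modulus.
Variable R : realType.
Implicit Types (z w : R[i]) (x y : R).

Lemma norm_nc z : `|z| = (nc z)%:C.
Proof. by []. Qed.

Lemma ncE z : nc z = Num.sqrt (complex.Re z ^+ 2 + complex.Im z ^+ 2).
Proof. by case: z. Qed.

Lemma nc_ge0 z : 0 <= nc z.
Proof. by rewrite ncE sqrtr_ge0. Qed.

Lemma sqr_nc z : nc z ^+ 2 = complex.Re z ^+ 2 + complex.Im z ^+ 2.
Proof. by rewrite ncE sqr_sqrtr// addr_ge0// sqr_ge0. Qed.

Lemma ncM z w : nc (z * w) = nc z * nc w.
Proof. exact: ComplexField.Normc.normcM. Qed.

Lemma ncV z : nc z^-1 = (nc z)^-1.
Proof. exact: ComplexField.Normc.normcV. Qed.

Lemma nc0 : nc (0 : R[i]) = 0.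
Proof. exact: ComplexField.Normc.normc0. Qed.

Lemma nc1 : nc (1 : R[i]) = 1.
Proof. exact: ComplexField.Normc.normc1. Qed.

Lemma nc_eq0 z : (nc z == 0) = (z == 0).
Proof.
by apply/eqP/eqP => [/ComplexField.Normc.eq0_normc//|->]; exact: nc0.
Qed.

Lemma nc_gt0 z : (0 < nc z) = (z != 0).
Proof. by rewrite lt_def nc_ge0 nc_eq0 andbT. Qed.

Lemma ncX z n : nc (z ^+ n) = nc z ^+ n.
Proof. by elim: n => [|n IH]; rewrite ?expr0 ?nc1// !exprS ncM IH. Qed.

Lemma ncN z : nc (- z) = nc z.
Proof. by rewrite !ncE; case: z => a b /=; rewrite !sqrrN. Qed.

Lemma ncD z w : nc (z + w) <= nc z + nc w.
Proof. by have := ler_normD z w; rewrite !norm_nc -rmorphD lecR. Qed.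

Lemma ncB z w : nc (z - w) <= nc z + nc w.
Proof. by rewrite -(ncN w) ncD. Qed.

Lemma ncBC z w : nc (z - w) = nc (w - z).
Proof. by rewrite -ncN opprB. Qed.

Lemma nc_real x : nc x%:C = `|x|.
Proof. by rewrite ncE /= expr0n addr0 sqrtr_sqr. Qed.

Lemma nc_natr n : nc (n%:R : R[i]) = n%:R.
Proof. by rewrite -(rmorph_nat (real_complex R)) nc_real ger0_norm. Qed.

Lemma Re_le_nc z : `|complex.Re z| <= nc z.
Proof.
by rewrite ncE -sqrtr_sqr ler_wsqrtr// lerDl sqr_ge0.
Qed.

Lemma Im_le_nc z : `|complex.Im z| <= nc z.
Proof.
by rewrite ncE -sqrtr_sqr ler_wsqrtr// lerDr sqr_ge0.
Qed.

Lemma nc_le_ReIm z : nc z <= `|complex.Re z| + `|complex.Im z|.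
Proof.
rewrite {1}(complexE z); apply: (le_trans (ncD _ _)); rewrite ncM !nc_real.
have -> : nc ('i%C : R[i]) = 1 by rewrite ncE /= expr0n add0r expr1n sqrtr1.
by rewrite mul1r.
Qed.

Lemma nc_sum (I : Type) (r : seq I) (P : pred I) (F : I -> R[i]) :
  nc (\sum_(i <- r | P i) F i) <= \sum_(i <- r | P i) nc (F i).
Proof.
elim/big_rec2: _ => [|i x z _ h]; first by rewrite nc0.
by apply: (le_trans (ncD _ _)); rewrite lerD2l.
Qed.

Lemma nc_dist_triangle z w u : nc (z - w) <= nc (z - u) + nc (u - w).
Proof. by have := ncD (z - u) (u - w); rewrite addrA subrK. Qed.

Lemma lerB_nc z w : nc z - nc w <= nc (z - w).
Proof. by rewrite lerBlDr; have := ncD (z - w) w; rewrite subrK. Qed.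

End modulus.

Section topology_on_complex.
Variable R : realType.

Lemma nbhs_ncP (z : Cplx R) (U : set (Cplx R)) :
  nbhs z U <-> exists2 e : R, 0 < e & forall y : R[i], nc (y - z) < e -> U y.
Proof.
split.
  move=> /nbhs_ballP [e /= e0 he].
  have er : e = (complex.Re e)%:C.
    by move: e0; rewrite ltcE /= => /andP[/eqP h _]; case: (e) h => a b /= ->.
  exists (complex.Re e).
    by move: e0; rewrite ltcE /= => /andP[].
  move=> y hy; apply: he; rewrite -ball_normE /ball_ /= distrC norm_nc er ltcR.
  exact: hy.
move=> [e e0 he]; apply/nbhs_ballP; exists e%:C; first by rewrite /= ltcR.
move=> y; rewrite -ball_normE /ball_ /= distrC norm_nc ltcR; exact: he.
Qed.

Lemma cvg_ncP (T : Type) (F : set_system T) (FF : Filter F) (f : T -> Cplx R)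
    (l : Cplx R) :
  f @ F --> l <-> forall e : R, 0 < e -> \forall t \near F, nc (f t - l) < e.
Proof.
split=> [h e e0|h].
  by apply: (h [set y | nc (y - l) < e]); apply/nbhs_ncP; exists e.
move=> U /nbhs_ncP [e e0 he]; move: (h e e0); rewrite nbhs_filterE => h'.
by apply: filterS h' => t /he.
Qed.

End topology_on_complex.

Section growth.
Variable R : realType.

Lemma exprn_div_fact_le_expR (x : R) n : 0 <= x -> x ^+ n / n`!%:R <= expR x.
Proof.
move=> x0.
have h : nondecreasing_seq (series (exp_coeff x)).
  apply/nondecreasing_seqP => k; rewrite /series /= big_nat_recr//= lerDl.
  exact: exp_coeff_ge0.
have := nondecreasing_cvgn_le h (is_cvg_series_exp_coeff x) n.+1.
apply: le_trans; rewrite /series /= big_nat_recr//= lerDr.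
by apply: sumr_ge0 => i _; exact: exp_coeff_ge0.
Qed.

(** Majorant principle for the exponential of a power series: the recurrence is that of a series
    whose logarithmic derivative has coefficients [b]. Each [a j] is dominated by the largest term
    B^i / i! with i <= j, hence by exp B. *)
Lemma exp_recurrence_bound (a b : nat -> R) (B : R) :
  0 <= B -> (forall i, 0 <= a i) -> (forall i, 0 <= b i) -> a 0%N <= 1 ->
  (forall j, j.+1%:R * a j.+1 <= \sum_(i < j.+1) b (j - i)%N * a i) ->
  (forall j, \sum_(i < j) b i <= B) ->
  forall j, a j <= expR B.
Proof.
move=> B0 a0 b0 a01 rec sB.
(* The witness k is where B^i / i! is largest among i <= j: it follows j as long as j <= B and is
   frozen afterwards, so one bound serves all earlier indices. *)
suff H j : exists k, [/\ (k <= j)%N, (k < j)%N -> B < k.+1%:R &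
    forall i, (i <= j)%N -> a i <= B ^+ k / k`!%:R].
  move=> j; have [k [_ _ /(_ j (leqnn _)) h]] := H j.
  by apply: (le_trans h); exact: exprn_div_fact_le_expR.
elim: j => [|j [k [kj kB IH]]].
  by exists 0%N; split => // i; rewrite leqn0 => /eqP ->; rewrite expr0 fact0 divr1.
pose u := B ^+ k / k`!%:R.
have u0 : 0 <= u by rewrite divr_ge0// exprn_ge0.
have aS : j.+1%:R * a j.+1 <= B * u.
  apply: (le_trans (rec j)); apply: (@le_trans _ _ (\sum_(i < j.+1) b (j - i)%N * u)).
    by apply: ler_sum => i _; rewrite ler_wpM2l// IH// -ltnS.
  rewrite -mulr_suml ler_wpM2r//.
  have := sB j.+1; rewrite (reindex_inj rev_ord_inj) /=.
  by under eq_bigr do rewrite subSS.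
have [Bj|Bj] := ltP B j.+1%:R; last first.
  have ejk : k = j.
    apply/eqP; rewrite eqn_leq kj leqNgt; apply/negP => /[dup] kj' /kB Bk.
    have : j.+1%:R < k.+1%:R :> R by apply: le_lt_trans Bk.
    by rewrite ltr_nat ltnS ltnNge kj.
  exists j.+1; split => //; first by rewrite ltnn.
  have uE : B ^+ j.+1 / (j.+1)`!%:R = B / j.+1%:R * u.
    rewrite /u ejk factS natrM exprS; field.
    by rewrite nat1r !pnatr_eq0 -!lt0n fact_gt0.
  move=> i; rewrite leq_eqVlt => /predU1P[->|ij].
    by rewrite uE mulrAC ler_pdivlMr ?ltr0n// mulrC.
  apply: (le_trans (IH i ij)); rewrite uE -/u ler_peMl//.
  by rewrite ler_pdivlMr ?ltr0n// mul1r.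
exists k; split; first exact: leqW.
  rewrite ltnS leq_eqVlt => /predU1P[->//|]; exact: kB.
move=> i; rewrite leq_eqVlt => /predU1P[->|ij]; last exact: IH.
rewrite -/u; suff : j.+1%:R * a j.+1 <= j.+1%:R * u by rewrite ler_pM2l ?ltr0n.
by apply: (le_trans aS); rewrite ler_wpM2r// ltW.
Qed.

(** With r = sqrt q, write q^n = r^n r^n: by Bernoulli's inequality for 1/r one factor r^n absorbs n
    + 1 up to a constant, and the other tends to 0. *)
Lemma natS_mul_expr_small (q e : R) : 0 <= q < 1 -> 0 < e ->
  exists N, forall n, (N <= n)%N -> n.+1%:R * q ^+ n < e.
Proof.
move=> /andP[q0 q1] e0.
have [->|qn0] := eqVneq q 0.
  by exists 1%N => -[//|n] _; rewrite expr0n mulr0.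
have qp : 0 < q by rewrite lt_def qn0.
pose r := Num.sqrt q.
have r0 : 0 < r by rewrite sqrtr_gt0.
have r1 : r < 1 by rewrite -sqrtr1 ltr_sqrt.
pose h := r^-1 - 1.
have h0 : 0 < h by rewrite subr_gt0 invf_gt1.
have bern n : 1 + n%:R * h <= r^-1 ^+ n.
  have -> : r^-1 = 1 + h by rewrite /h addrC subrK.
  elim: n => [|n IH]; first by rewrite mul0r addr0 expr0.
  rewrite exprS; apply: (@le_trans _ _ ((1 + h) * (1 + n%:R * h))).
    rewrite -natr1; have : 0 <= n%:R * h * h by rewrite !mulr_ge0// ltW.
    by lra.
  by rewrite ler_wpM2l// addr_ge0// ltW.
pose C := 1 + h^-1.
have hC n : n.+1%:R * r ^+ n <= C.
  rewrite -ler_pdivlMr ?exprn_gt0// -exprVn.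
  apply: (@le_trans _ _ (C * (1 + n%:R * h))).
    rewrite /C -natr1 mulrDl mul1r.
    have -> : h^-1 * (1 + n%:R * h) = h^-1 + n%:R by field; rewrite gt_eqF.
    have : 0 <= n%:R * h by rewrite mulr_ge0// ltW.
    have : 0 < h^-1 by rewrite invr_gt0.
    by lra.
  by rewrite ler_wpM2l// addr_ge0// ltW// invr_gt0.
have C0 : 0 < C by rewrite addr_gt0// invr_gt0.
have : (fun n => r ^+ n) @ \oo --> 0.
  by apply: cvg_expr; rewrite gtr0_norm.
move=> /cvgrPdist_lt /(_ (e / C)) []; first by rewrite divr_gt0.
move=> N _ hN; exists N => n Nn; have := hN n Nn.
rewrite sub0r normrN ger0_norm ?exprn_ge0 ?(ltW r0)// => rn.
have -> : q ^+ n = r ^+ n * r ^+ n by rewrite -exprMn -expr2 sqr_sqrtr.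
rewrite mulrA; apply: (@le_lt_trans _ _ (C * r ^+ n)).
  by rewrite ler_wpM2r// exprn_ge0// ltW.
by rewrite mulrC -ltr_pdivlMr.
Qed.

End growth.

(** * Polynomial approximation of powers on a disc *)

Section power_sums.
Variable R : realType.
Implicit Types (s : seq R[i]) (v : R[i]).

(** The entries are the reciprocals of the zeros: this makes the constant term 1 and the power sums
    of the entries the coefficients of the logarithmic derivative, up to sign. *)
Definition rootprod s : {poly R[i]} := \prod_(v <- s) (1 - v *: 'X).

Definition psum s (i : nat) : R[i] := \sum_(v <- s) v ^+ i.

(* The coefficients of the formal inverse of [rootprod s]. *)
Fixpoint invcoef s : nat -> R[i] :=
  if s is v :: s' then
    fix r j := if j is j'.+1 then v * r j' + invcoef s' j'.+1
               else invcoef s' 0%N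
  else fun j => (j == 0%N)%:R.

Lemma invcoef_consS v s j :
  invcoef (v :: s) j.+1 = v * invcoef (v :: s) j + invcoef s j.+1.
Proof. by []. Qed.

Lemma invcoef0 s : invcoef s 0%N = 1.
Proof. by elim: s. Qed.

(* [has_logder a p] says that the formal power series A of the coefficients [a]
   satisfies  X A' = A * (sum_(k >= 1) p_(k-1) X^k). *)
Definition has_logder (a p : nat -> R[i]) :=
  forall j, j.+1%:R * a j.+1 = \sum_(i < j.+1) p (j - i)%N * a i.

(** The factor 1 - vX contributes - sum v^k X^k to X A' / A. The forward direction builds up a
    product, the backward one its formal inverse. *)
Lemma has_logder_factor (a b p : nat -> R[i]) v :
  b 0%N = a 0%N -> (forall j, b j.+1 = a j.+1 - v * a j) ->
  has_logder a p <-> has_logder b (fun k => p k - v ^+ k.+1).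
Proof.
move=> b0 bS.
pose e (j : nat) := j.+1%:R * a j.+1 - \sum_(i < j.+1) p (j - i)%N * a i.
pose g (j : nat) := \sum_(i < j.+1) v ^+ (j - i).+1 * a i.
have gS j : g j.+1 = v * g j + v * a j.+1.
  rewrite /g big_ord_recr /= subnn expr1; congr (_ + _).
  rewrite mulr_sumr; apply: eq_bigr => i _.
  have ij : (i <= j)%N by rewrite -ltnS.
  by rewrite subSn// exprS mulrA.
pose f (j : nat) := j.+1%:R * b j.+1 -
   \sum_(i < j.+1) (p (j - i)%N - v ^+ (j - i).+1) * b i.
(* The defects [e] and [f] of the two recurrences are related by the same factor 1 - vX, which is
   invertible as a power series, so both vanish together. *)
have fE j : f j = if j is j'.+1 then e j - v * e j' else e 0%N.
  case: j => [|j].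
    rewrite /f /e !big_ord1 subnn bS b0 /= expr1; ring.
  have h1 : \sum_(i < j.+2) p (j.+1 - i)%N * b i =
      \sum_(i < j.+2) p (j.+1 - i)%N * a i - v * \sum_(i < j.+1) p (j - i)%N * a i.
    rewrite big_ord_recl /= [in RHS]big_ord_recl /= b0 -addrA; congr (_ + _).
    rewrite mulr_sumr -sumrB; apply: eq_bigr => i _.
    by rewrite /bump /= add1n bS subSS; ring.
  have h2 : \sum_(i < j.+2) v ^+ (j.+1 - i).+1 * b i = v * a j.+1.
    transitivity (g j.+1 - v * g j); last by rewrite gS; ring.
    rewrite /g big_ord_recl /= [in RHS]big_ord_recl /= b0 -addrA; congr (_ + _).
    rewrite mulr_sumr -sumrB; apply: eq_bigr => i _.
    by rewrite /bump /= add1n bS subSS; ring.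
  have -> : f j.+1 = j.+2%:R * b j.+2 - (\sum_(i < j.+2) p (j.+1 - i)%N * b i -
     \sum_(i < j.+2) v ^+ (j.+1 - i).+1 * b i).
    rewrite /f -sumrB; congr (_ - _); apply: eq_bigr => i _; ring.
  rewrite h1 h2 /e bS -[j.+2%:R]natr1; ring.
split=> h j.
  apply/eqP; rewrite -subr_eq0 -/(f j) fE; case: j => [|j].
    by rewrite /e h subrr.
  by rewrite /e !h !subrr mulr0 subr0.
have f0 k : f k = 0 by rewrite /f h subrr.
suff : e j = 0 by move/eqP; rewrite /e subr_eq0 => /eqP.
elim: j => [|j IH]; first by have := fE 0%N; rewrite f0.
by have := fE j.+1; rewrite f0 IH mulr0 subr0.
Qed.

Lemma has_logder_eq (a b p q : nat -> R[i]) :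
  a =1 b -> p =1 q -> has_logder a p -> has_logder b q.
Proof.
move=> ab pq h j; rewrite -ab h; apply: eq_bigr => i _.
by rewrite ab pq.
Qed.

Lemma psum_cons v s i : psum (v :: s) i = psum s i + v ^+ i.
Proof. by rewrite /psum big_cons addrC. Qed.

Lemma rootprod_cons v s : rootprod (v :: s) = rootprod s - v *: (rootprod s * 'X).
Proof.
by rewrite /rootprod big_cons mulrBl mul1r -scalerAl mulrC.
Qed.

Lemma rootprod_coef0 s : (rootprod s)`_0 = 1.
Proof.
elim: s => [|v s IH]; first by rewrite /rootprod big_nil coef1.
by rewrite rootprod_cons coefB coefZ coefMX IH mulr0 subr0.
Qed.

Lemma size_rootprod s : (size (rootprod s) <= (size s).+1)%N.
Proof.
elim: s => [|v s IH]; first by rewrite /rootprod big_nil size_poly1.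
rewrite rootprod_cons (leq_trans (size_polyD _ _))// geq_max.
rewrite (leq_trans IH) ?leqnSn//= size_polyN (leq_trans (size_scale_leq _ _))//.
by rewrite (leq_trans (size_polyMleq _ _))// size_polyX addn2.
Qed.

(** Newton's identities, obtained one factor at a time. *)
Lemma logder_rootprod s :
  has_logder (fun j => (rootprod s)`_j) (fun k => - psum s k.+1).
Proof.
elim: s => [j|v s IH].
  rewrite /rootprod big_nil coef1 mulr0 big1// => i _.
  by rewrite /psum big_nil oppr0 mul0r.
have : has_logder (fun j => (rootprod (v :: s))`_j) (fun k => - psum s k.+1 - v ^+ k.+1).
  apply/(@has_logder_factor (fun j => (rootprod s)`_j)) => //.
    by rewrite !rootprod_coef0.
  by move=> j; rewrite rootprod_cons coefB coefZ coefMX.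
by apply: has_logder_eq => // k; rewrite psum_cons opprD.
Qed.

(** The counterpart of Newton's identities for the complete homogeneous symmetric functions, which
    are the values of [invcoef]. *)
Lemma logder_invcoef s : has_logder (invcoef s) (fun k => psum s k.+1).
Proof.
elim: s => [j|v s IH].
  rewrite /= mulr0 big1// => i _.
  by rewrite /psum big_nil mul0r.
apply/(@has_logder_factor _ (invcoef s) _ v) => //.
  by move=> j; rewrite invcoef_consS addrAC subrr add0r.
by apply: has_logder_eq IH => // k; rewrite psum_cons addrK.
Qed.

Definition invtrunc s D : {poly R[i]} := \poly_(j < D.+1) invcoef s j.

Lemma rootprod_invtrunc s D :
  exists E, rootprod s * invtrunc s D = 1 + 'X^(D.+1) * E.
Proof.
elim: s => [|v s [E hE]].
  exists 0; rewrite /rootprod big_nil mul1r mulr0 addr0.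
  apply/polyP => j; rewrite coef_poly coef1 /=.
  by case: ltnP => // /(leq_ltn_trans (leq0n _)); case: j.
exists (E - v *: (invcoef (v :: s) D *: rootprod s)).
(* Multiplying the truncated inverse by the new factor removes that factor; only the term pushed
   past degree D remains. *)
have h : (1 - v *: 'X) * invtrunc (v :: s) D =
    invtrunc s D - (v * invcoef (v :: s) D) *: 'X^(D.+1).
  apply/polyP => j; rewrite mulrBl mul1r -scalerAl mulrC !coefB !coefZ coefMX.
  rewrite /invtrunc !coef_poly coefXn.
  case: j => [|j]; first by rewrite mulr0 subr0 /= mulr0 subr0.
  rewrite -[j.+1 == 0%N]/false -[j.+1.-1]/j eqSS ltnS; case: (ltngtP j D) => jD.
  - by rewrite ltnS (ltnW jD) invcoef_consS mulr0 subr0 addrAC subrr add0r.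
  - by rewrite ltnS leqNgt jD !mulr0.
  - by rewrite jD ltnS leqnn mulr1.
rewrite /rootprod big_cons -/(rootprod s) mulrAC h mulrBl mulrC hE.
rewrite -!mul_polyC !rmorphM /=; ring.
Qed.

(** The hypothesis bounds the logarithmic derivative on the circle of radius y, so the coefficients
    of the product and of its inverse are at most exp(B) y^(-j). The remainder starts at degree D +
    1; each of its coefficients is a convolution of at most D + 1 terms, and summing the geometric
    tail at |w| <= 1 gives 1 / (y - 1). *)
Lemma rootprod_invtrunc_bound s D (y B : R) :
  1 < y ->
  (forall J, \sum_(i < J) nc (psum s i.+1) * y ^+ i.+1 <= B) ->
  forall w, nc w <= 1 ->
  nc ((rootprod s).[w] * (invtrunc s D).[w] - 1) <=
    D.+1%:R * expR (2 * B) * (y^-1 ^+ D / (y - 1)).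
Proof.
move=> y1 hB w w1.
have y0 : 0 < y by apply: lt_trans y1.
have yn0 : y != 0 by rewrite gt_eqF.
have B0 : 0 <= B by have := hB 0%N; rewrite big_ord0.
(* Scaling the j-th coefficient by y^j turns the identity into the recurrence of
   [exp_recurrence_bound], for products and inverses alike since only |p| matters. *)
have bound (a p : nat -> R[i]) : has_logder a p -> a 0%N = 1 ->
    (forall k, nc (p k) = nc (psum s k.+1)) ->
    forall j, nc (a j) <= expR B * y^-1 ^+ j.
  move=> ha a0 hp j.
  have -> : y^-1 ^+ j = (y ^+ j)^-1 by rewrite exprVn.
  rewrite ler_pdivlMr ?exprn_gt0//.
  apply: (@exp_recurrence_bound R (fun j => nc (a j) * y ^+ j)
           (fun i => nc (psum s i.+1) * y ^+ i.+1)) => //.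
  - by move=> i; rewrite mulr_ge0 ?nc_ge0 ?exprn_ge0// ltW.
  - by move=> i; rewrite mulr_ge0 ?nc_ge0 ?exprn_ge0// ltW.
  - by rewrite a0 nc1 expr0 mul1r.
  move=> k; rewrite mulrA -(nc_natr R) -ncM ha.
  rewrite -ler_pdivlMr ?exprn_gt0//; apply: (le_trans (nc_sum _ _ _)).
  rewrite ler_pdivlMr ?exprn_gt0// mulr_suml; apply: ler_sum => i _.
  rewrite ncM hp.
  have -> : y ^+ k.+1 = y ^+ (k - i).+1 * y ^+ i.
    by rewrite -exprD addSn subnK// -ltnS.
  by rewrite mulrACA.
have bV := bound _ _ (logder_rootprod s) (rootprod_coef0 s) (fun k => ncN _).
have bI := bound _ _ (logder_invcoef s) (invcoef0 s) (fun k => erefl).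
have [E hE] := rootprod_invtrunc s D.
rewrite -hornerM hE hornerD hornerC addrAC subrr add0r.
have cE i : nc (E`_i) <= D.+1%:R * expR (2 * B) * y^-1 ^+ (D.+1 + i).
  have -> : E`_i = (rootprod s * invtrunc s D)`_(D.+1 + i).
    by rewrite hE coefD coef1 /= add0r coefXnM ltnNge leq_addr /= addKn.
  rewrite coefMr; apply: (le_trans (nc_sum _ _ _)).
  rewrite (bigID (fun j : 'I_(D.+1 + i).+1 => (j < D.+1)%N)) /=.
  rewrite [X in _ + X]big1 ?addr0; last first.
    by move=> j /negbTE jD; rewrite /invtrunc coef_poly jD mulr0 nc0.
  apply: (@le_trans _ _ (\sum_(j < (D.+1 + i).+1 | (j < D.+1)%N)
                        expR (2 * B) * y^-1 ^+ (D.+1 + i))).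
    apply: ler_sum => j jD; rewrite /invtrunc coef_poly jD ncM.
    apply: (le_trans (ler_pM (nc_ge0 _) (nc_ge0 _) (bV _) (bI _))).
    have jle : (j <= D.+1 + i)%N by rewrite -ltnS.
    have -> : 2 * B = B + B by ring.
    by rewrite expRD mulrACA -exprD subnK.
  have hle : (D.+1 <= (D.+1 + i).+1)%N by lia.
  rewrite -(@big_ord_widen _ _ _ D.+1 (D.+1 + i).+1
      (fun=> expR (2 * B) * y^-1 ^+ (D.+1 + i))) //.
  by rewrite sumr_const card_ord -[X in X <= _]mulr_natl mulrA.
have iy : 0 <= y^-1 < 1 by rewrite invr_ge0 ltW//= invf_lt1.
rewrite hornerM hornerXn ncM ncX.
apply: (@le_trans _ _ (nc (E.[w]))).
  by rewrite ler_piMl ?nc_ge0// exprn_ile1// nc_ge0.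
rewrite horner_coef; apply: (le_trans (nc_sum _ _ _)).
apply: (@le_trans _ _ (\sum_(i < size E) D.+1%:R * expR (2 * B) * y^-1 ^+ (D.+1 + i))).
  apply: ler_sum => i _; rewrite ncM ncX.
  apply: (@le_trans _ _ (nc E`_i)); last exact: cE.
  by rewrite ler_piMr ?nc_ge0// exprn_ile1// nc_ge0.
rewrite -mulr_sumr ler_wpM2l ?mulr_ge0 ?expR_ge0//.
under eq_bigr do rewrite exprD.
rewrite -mulr_sumr exprS [y^-1 * _]mulrC -mulrA ler_wpM2l//.
  by rewrite exprn_ge0// invr_ge0 ltW.
have := subrX1 y^-1 (size E); move/(congr1 (fun z => z / (y^-1 - 1))).
rewrite mulrAC divff ?mul1r; last by rewrite subr_eq0 lt_eqF; case/andP: iy.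
move=> <-.
have -> : y^-1 * ((y^-1 ^+ size E - 1) / (y^-1 - 1)) = (1 - y^-1 ^+ size E) / (y - 1).
  set q := y^-1 ^+ size E; field.
  have : y - 1 != 0 by rewrite subr_eq0 gt_eqF.
  move=> h; apply/and3P; split=> //.
  by rewrite mulN1r -oppr_eq0 opprB h.
rewrite ler_pdivrMr ?subr_gt0// mulVf ?subr_eq0 ?gt_eqF//.
by rewrite gerBl exprn_ge0// invr_ge0 ltW.
Qed.

End power_sums.

(** * Roots of unity and Cauchy's coefficient estimate *)

Section roots_of_unity.
Variable R : realType.

Lemma primitive_root_exists n : (0 < n)%N -> exists w : R[i], n.-primitive_root w.
Proof.
move=> n_gt0; pose p : {poly R[i]} := 'X^n - 1.
have [r Dp] := closed_field_poly_normal p.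
move: Dp; rewrite (monicP _) ?monicXnsubC // scale1r => Dp.
have rn1 : all n.-unity_root r by apply/allP => z; rewrite -root_prod_XsubC -Dp.
have sz_r : (n < (size r).+1)%N.
  by rewrite -(size_prod_XsubC r id) -Dp size_XnsubC.
have [|z] := hasP (has_prim_root n_gt0 rn1 _ sz_r); last by exists z.
rewrite -separable_prod_XsubC -Dp separable_Xn_sub_1 //.
by rewrite pnatr_eq0 -lt0n.
Qed.

Lemma nc_unity_root n (w : R[i]) : (0 < n)%N -> w ^+ n = 1 -> nc w = 1.
Proof.
move=> n0 wn; apply/eqP; rewrite -(@pexpr_eq1 _ _ n) ?nc_ge0//.
by rewrite -ncX wn nc1.
Qed.

Lemma sum_unity_root n (w : R[i]) k : n.-primitive_root w ->
  \sum_(j < n) w ^+ (j * k) = if (n %| k)%N then n%:R else 0.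
Proof.
move=> pw; under eq_bigr do rewrite mulnC exprM.
case: ifPn => nk.
  rewrite (eq_bigr (fun=> 1)); first by rewrite sumr_const card_ord.
  by move=> j _; move: nk; rewrite (prim_order_dvd pw) => /eqP ->; rewrite expr1n.
have h : w ^+ k - 1 != 0 by rewrite subr_eq0 -(prim_order_dvd pw).
apply: (mulfI h); rewrite -subrX1 mulr0 -exprM mulnC exprM.
by rewrite (prim_expr_order pw) expr1n subrr.
Qed.

Lemma shift_dvd_eq (n k i q : nat) :
  (i < n)%N -> (k < n)%N -> (i + (n - k))%N = (q * n)%N -> i = k.
Proof.
move=> hi hk; case: q => [|[|q]].
- by rewrite mul0n; lia.
- by rewrite mul1n; lia.
by rewrite !mulSn; move: (q * n)%N => t; lia.
Qed.

(** Cauchy's estimate by discrete Fourier inversion: as many roots of unity as coefficients suffice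
    to isolate one of them, so no integral occurs. The exponent n - k stands for -k modulo n. *)
Lemma nc_coef_le (p : {poly R[i]}) (M : R) k :
  (forall w, nc w = 1 -> nc p.[w] <= M) -> nc p`_k <= M.
Proof.
move=> hM.
have M0 : 0 <= M by apply: le_trans (hM 1 (nc1 _)); exact: nc_ge0.
have [kp|kp] := ltnP k (size p); last by rewrite nth_default// nc0.
pose n := size p.
have n0 : (0 < n)%N by apply: leq_ltn_trans kp.
have [w pw] := primitive_root_exists n0.
have w1 : nc w = 1 := nc_unity_root n0 (prim_expr_order pw).
have key : n%:R * p`_k = \sum_(j < n) p.[w ^+ j] * w ^+ (j * (n - k)).
  under eq_bigr do rewrite horner_coef mulr_suml.
  rewrite exchange_big /= (bigD1 (Ordinal kp)) //= [X in _ + X]big1 ?addr0.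
    rewrite mulrC -[n%:R](_ : \sum_(j < n) w ^+ (j * n) = _); last first.
      by rewrite sum_unity_root// dvdnn.
    rewrite mulr_sumr; apply: eq_bigr => j _.
    by rewrite -exprM -mulrA -exprD -mulnDr subnKC// ltnW.
  move=> i ik; rewrite (eq_bigr (fun j : 'I_n => p`_i * w ^+ (j * (i + (n - k))))).
    rewrite -mulr_sumr sum_unity_root//.
    case: ifPn; last by rewrite mulr0.
    move=> /dvdnP[q hq]; exfalso; move: ik; rewrite -val_eqE /= => /eqP; apply.
    exact: (shift_dvd_eq _ _ hq).
  by move=> j _; rewrite -exprM -mulrA -exprD -mulnDr.
suff : n%:R * nc p`_k <= n%:R * M by rewrite ler_pM2l// ltr0n.
rewrite -{1}(nc_natr R) -ncM key; apply: (le_trans (nc_sum _ _ _)).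
apply: (@le_trans _ _ (\sum_(j < n) M)).
  apply: ler_sum => j _; rewrite ncM !ncX w1 expr1n mulr1; apply: hM.
  by rewrite ncX w1 expr1n.
by rewrite sumr_const card_ord mulr_natl.
Qed.

End roots_of_unity.

(** * Discrete Fourier coefficients of the Poisson kernel *)

Section poisson_weights.
Variable R : realType.

(** On M-th roots of unity 1 / (1 - x u) is a finite geometric sum divided by 1 - x^M, and
    orthogonality keeps only the power k = M - i; this is why i = 0 is excluded and i = M
    allowed. *)
Lemma dft_geometric M (w x : R[i]) i : (0 < M)%N -> M.-primitive_root w ->
  x ^+ M != 1 -> (0 < i <= M)%N ->
  \sum_(j < M) w ^+ (j * i) / (1 - x * w ^+ j) = M%:R * x ^+ (M - i) / (1 - x ^+ M).
Proof.
move=> M0 pw xM /andP[i0 iM].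
have xMn0 : 1 - x ^+ M != 0 by rewrite subr_eq0 eq_sym.
have geo (j : 'I_M) : (1 - x * w ^+ j)^-1 =
    \sum_(k < M) x ^+ k * w ^+ (j * k) / (1 - x ^+ M).
  have e : (1 - x * w ^+ j) * \sum_(k < M) x ^+ k * w ^+ (j * k) = 1 - x ^+ M.
    have -> : x ^+ M = (x * w ^+ j) ^+ M.
      by rewrite exprMn -exprM mulnC exprM (prim_expr_order pw) expr1n mulr1.
    rewrite -[RHS]opprB subrX1 -[RHS]mulNr opprB; congr (_ * _).
    by apply: eq_bigr => k _; rewrite exprMn -exprM.
  have n0 : 1 - x * w ^+ j != 0.
    by apply: contraNneq xMn0 => h; rewrite -e h mul0r.
  by rewrite -mulr_suml -e invfM mulrCA mulfV ?mulr1// (contraNneq _ xMn0) // => h; rewrite -e h mulr0.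
under eq_bigr do rewrite geo mulr_sumr.
rewrite exchange_big /=.
rewrite (eq_bigr (fun k : 'I_M => x ^+ k / (1 - x ^+ M) * \sum_(j < M) w ^+ (j * (i + k)))); last first.
  by move=> k _; rewrite mulr_sumr; apply: eq_bigr => j _; rewrite mulnDr exprD; ring.
have kp : (M - i < M)%N by lia.
rewrite (bigD1 (Ordinal kp))//= [X in _ + X]big1 ?addr0; last first.
  move=> k; rewrite -val_eqE /= => /eqP ki; rewrite (sum_unity_root _ pw).
  case: ifPn; last by rewrite mulr0.
  move=> /dvdnP[q hq]; exfalso; apply: ki.
  apply: (@shift_dvd_eq M (M - i) k q) => //.
  by rewrite subKn// addnC.
by rewrite (sum_unity_root _ pw) subnKC// dvdnn mulrC mulrA.
Qed.

Lemma mulc_conjc (z : R[i]) : z * (z^*)%C = (nc z ^+ 2)%:C.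
Proof.
rewrite sqr_nc; case: z => a b; apply/eqP; rewrite eq_complex /=.
by apply/andP; split; apply/eqP; ring.
Qed.

Lemma conjcM (z v : R[i]) : (z * v)^*%C = z^*%C * v^*%C.
Proof. exact: (rmorphM (@conjc R)). Qed.

Lemma conjc_sum (I : Type) (r : seq I) (F : I -> R[i]) :
  (\sum_(i <- r) F i)^*%C = \sum_(i <- r) (F i)^*%C.
Proof. exact: (raddf_sum (@conjc R)). Qed.

Definition poisson (u : R[i]) : R := (1 - nc u ^+ 2) / nc (1 - u) ^+ 2.

(** The kernel is 2 Re (1 / (1 - u)) - 1, a form in which its Fourier coefficients can be read
    off. *)
Lemma poissonE u : u != 1 ->
  (poisson u)%:C = (1 - u)^-1 + ((1 - u)^-1)^*%C - 1.
Proof.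
move=> u1; have v0 : 1 - u != 0 by rewrite subr_eq0 eq_sym.
have v0' : (1 - u)^*%C != 0 by rewrite conjc_eq0.
rewrite /poisson fmorph_div /= -mulc_conjc rmorphB /= rmorph1 -mulc_conjc conjc_inv.
have -> : (1 - u)^*%C = 1 - u^*%C by rewrite rmorphB rmorph1.
have v0'' : 1 - u^*%C != 0 by rewrite -[X in X - _](rmorph1 (@conjc R)) -rmorphB.
by field; rewrite v0 v0''.
Qed.

Lemma poisson_le (u : R[i]) : nc u < 1 -> poisson u <= (1 + nc u) / (1 - nc u).
Proof.
move=> u1; have h : 0 < 1 - nc u by rewrite subr_gt0.
have k : 1 - nc u <= nc (1 - u) by have := lerB_nc 1 u; rewrite nc1.
rewrite /poisson ler_pdivrMr; last by rewrite exprn_gt0// (lt_le_trans h).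
have -> : 1 - nc u ^+ 2 = (1 + nc u) / (1 - nc u) * (1 - nc u) ^+ 2.
  by field; rewrite gt_eqF.
apply: ler_wpM2l.
  by apply: divr_ge0; [exact: addr_ge0 ler01 (nc_ge0 u)|exact: ltW].
by rewrite lerXn2r// nnegrE ltW// (lt_le_trans h).
Qed.

(** The Poisson kernel has Fourier coefficients x^|k|; sampling at M points adds up all k congruent
    to i or -i modulo M, which gives the two powers of x and the denominator 1 - x^M. *)
Lemma poisson_dft M (w : R[i]) (x : R) i : (0 < M)%N -> M.-primitive_root w ->
  `|x| < 1 -> (i < M)%N ->
  \sum_(j < M) w ^+ (j * i) * (poisson (x%:C * w ^+ j))%:C =
  M%:R * (((x ^+ i + (if i == 0%N then 1 else x ^+ (M - i))) / (1 - x ^+ M))%:C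
          - (i == 0%N)%:R).
Proof.
move=> M0 pw x1 iM.
have w1 : nc w = 1 := nc_unity_root M0 (prim_expr_order pw).
have xM : x%:C ^+ M != 1 :> R[i].
  rewrite -rmorphXn /= -(rmorph1 (real_complex R)) (inj_eq (@complexI R)).
  apply/eqP => h; have : `|x| ^+ M < 1 by rewrite exprn_ilt1// -lt0n.
  by rewrite -normrX h normr1 ltxx.
have u1 (j : nat) : x%:C * w ^+ j != 1.
  apply/eqP => h; have := congr1 (@nc R) h.
  by rewrite ncM ncX w1 expr1n mulr1 nc_real nc1 => e; rewrite e ltxx in x1.
under eq_bigr do rewrite poissonE// !(mulrBr, mulrDr) mulr1.
rewrite sumrB big_split /= (sum_unity_root _ pw).
have -> : \sum_(j < M) w ^+ (j * i) * (1 - x%:C * w ^+ j)^-1 =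
    M%:R * (((if i == 0%N then 1 else x ^+ (M - i)) / (1 - x ^+ M))%:C).
  case: (posnP i) => [->|i0].
    rewrite (eq_bigr (fun j : 'I_M => w ^+ (j * M) / (1 - x%:C * w ^+ j))); last first.
      by move=> j _; rewrite muln0 expr0 mulnC exprM (prim_expr_order pw) expr1n.
    rewrite dft_geometric// ?M0 ?leqnn// subnn expr0 fmorph_div /= rmorphB rmorphXn /= rmorph1.
    by rewrite mulrA.
  rewrite dft_geometric// ?i0 ?(ltnW iM)// fmorph_div /= rmorphB !rmorphXn /= rmorph1.
  by rewrite mulrA.
(* On the unit circle conjugation inverts w^(j i), so this sum is the conjugate of the previous kind
   with i replaced by M - i. *)
have -> : \sum_(j < M) w ^+ (j * i) * ((1 - x%:C * w ^+ j)^-1)^*%C =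
    M%:R * ((x ^+ i / (1 - x ^+ M))%:C).
  have -> : \sum_(j < M) w ^+ (j * i) * ((1 - x%:C * w ^+ j)^-1)^*%C =
      (\sum_(j < M) w ^+ (j * (M - i)) / (1 - x%:C * w ^+ j))^*%C.
    rewrite conjc_sum; apply: eq_bigr => j _; rewrite conjcM; congr (_ * _).
    have wj : nc (w ^+ (j * (M - i))) = 1 by rewrite ncX w1 expr1n.
    have wn0 : w ^+ (j * (M - i)) != 0 by rewrite -nc_eq0 wj oner_eq0.
    apply: (mulfI wn0); rewrite mulc_conjc wj expr1n -exprD -mulnDr subnK ?(ltnW iM)//.
    by rewrite mulnC exprM (prim_expr_order pw) expr1n.
  rewrite dft_geometric//; last by rewrite subn_gt0 iM leq_subr.
  rewrite subKn ?(ltnW iM)//.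
  have -> : M%:R * x%:C ^+ i / (1 - x%:C ^+ M) = (M%:R * (x ^+ i / (1 - x ^+ M)))%:C.
    by rewrite rmorphM fmorph_div rmorphB !rmorphXn rmorph1 rmorph_nat mulrA.
  by rewrite conjc_real rmorphM rmorph_nat.
have -> : (if (M %| i)%N then M%:R else 0) = M%:R * (i == 0%N)%:R :> R[i].
  case: (posnP i) => [->|i0]; first by rewrite dvdn0 mulr1.
  by rewrite gtnNdvd// mulr0.
by rewrite -mulrDr -mulrBr -rmorphD /= -mulrDl [_ + x ^+ i]addrC.
Qed.

End poisson_weights.

(** * Balancing the zeros of a power by zeros on a circle *)

Section disc_approximation.
Variable R : realType.

Lemma psum_cat (s1 s2 : seq R[i]) i : psum (s1 ++ s2) i = psum s1 i + psum s2 i.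
Proof. by rewrite /psum big_cat. Qed.

Lemma psum_nseq n (v : R[i]) i : psum (nseq n v) i = n%:R * v ^+ i.
Proof.
elim: n => [|n IH]; first by rewrite /psum big_nil mul0r.
by rewrite /= psum_cons IH -natr1 mulrDl mul1r.
Qed.

Lemma psum_flatten (I : finType) (m : I -> nat) (v : I -> R[i]) i :
  psum (flatten [seq nseq (m j) (v j) | j <- enum I]) i = \sum_j (m j)%:R * v j ^+ i.
Proof.
rewrite /psum big_flatten big_map big_enum; apply: eq_bigr => j _.
exact: psum_nseq.
Qed.

Lemma rootprod_nseq n (v : R[i]) : rootprod (nseq n v) = (1 - v *: 'X) ^+ n.
Proof.
elim: n => [|n IH]; first by rewrite /rootprod big_nil expr0.
by rewrite exprS -IH /rootprod big_cons.
Qed.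

Lemma expr_lt_exists (q e : R) : 0 <= q < 1 -> 0 < e ->
  exists N, forall n, (N <= n)%N -> q ^+ n < e.
Proof.
move=> q01 e0; have [N hN] := natS_mul_expr_small q01 e0; exists N => n Nn.
apply: le_lt_trans (hN n Nn); rewrite ler_peMl ?ler1n//.
by rewrite exprn_ge0//; case/andP: q01.
Qed.

Lemma geometric_sum_le (q : R) n : 0 <= q < 1 -> \sum_(i < n) q ^+ i.+1 <= (1 - q)^-1.
Proof.
move=> /andP[q0 q1]; rewrite -[leRHS]mul1r ler_pdivlMr ?subr_gt0//.
under eq_bigr do rewrite exprS.
rewrite -mulr_sumr -mulrA [X in q * X](_ : _ = 1 - q ^+ n).
  rewrite -[leRHS]mulr1 ler_pM// ?(ltW q1)//; first by rewrite subr_ge0 exprn_ile1// ltW.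
  by rewrite gerBl exprn_ge0.
by rewrite mulrC -[LHS]opprK -mulNr opprB -subrX1 opprB.
Qed.

(** The slack is cut into three factors z: one makes the weighted power sums summable, one pays for
    the growth of exp(2B) with n, and one is left as decay of the error. *)
Lemma cube_root_above_one (k : R) : 0 < k < 1 -> exists2 z : R, 1 < z & k * z ^+ 3 < 1.
Proof.
move=> /andP[k0 k1].
pose h := (1 - k) / 8.
have h0 : 0 < h by rewrite divr_gt0 ?subr_gt0.
exists (1 + h); first by rewrite ltrDl.
have h1 : h < 1 by rewrite /h; lra.
have e : (1 + h) ^+ 3 <= 1 + 7 * h.
  have -> : (1 + h) ^+ 3 = 1 + 3 * h + 3 * (h * h) + h * (h * h) by ring.
  have hh : h * h <= h by rewrite ler_piMl// ltW.
  have hhh : h * (h * h) <= h.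
    by apply: le_trans hh; rewrite ler_piMl ?(ltW h1)// mulr_ge0 ?(ltW h0).
  by lra.
apply: (@le_lt_trans _ _ (k * (1 + 7 * h))); first by rewrite ler_wpM2l// ltW.
have kh : k * h <= h by rewrite ler_piMl// ltW.
by move: kh; rewrite /h; lra.
Qed.

Lemma pred_addn_le (p q l k : nat) :
  (p <= l.+1)%N -> (q <= k.+1)%N -> ((p + q).-1 <= l.+1 + k)%N.
Proof. lia. Qed.

(** Zeros of modulus z^3 are added with density a times (maximum of the Poisson kernel minus the
    kernel), sampled at M points. The power sums of all zeros then cancel up to aliasing of order
    f^M and a rounding error independent of n, so the inverse series of the product can be truncated
    at degree about d n. *)
Lemma disc_approx (a t : R) : 0 < a -> 0 < t -> t * (1 + 2 * a) < 1 ->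
  exists (d : R) (q : nat -> {poly R[i]}), [/\ 0 < d,
    (forall n, (size (q n))%:R <= (1 - d) * n%:R + 1) &
    forall e : R, 0 < e -> exists N, forall n, (N <= n)%N ->
      forall w, nc w <= 1 ->
      nc ((1 + t%:C * w) ^+ Num.trunc (a * n%:R) * (q n).[w] - 1) < e].
Proof.
move=> a0 t0 ta.
have k01 : 0 < t * (1 + 2 * a) < 1 by rewrite ta mulr_gt0//; lra.
have [z z1 kz] := cube_root_above_one k01.
have z0 : 0 < z by apply: lt_trans z1.
(* The reciprocals of the added zeros lie on |v| = s; relative to that circle the given reciprocal
   zero -t sits at -xi. *)
pose s := z^-1 ^+ 3; pose xi := t * z ^+ 3.
have s0 : 0 < s by rewrite exprn_gt0// invr_gt0.
have iz0 : 0 <= z^-1 by rewrite invr_ge0 ltW.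
have iz1 : z^-1 < 1 by rewrite invf_lt1.
have s1 : s <= 1 by rewrite exprn_ile1// ltW.
have xi0 : 0 < xi by rewrite mulr_gt0// exprn_gt0.
have xia : xi * (1 + 2 * a) < 1 by rewrite /xi mulrAC.
have xi1 : xi < 1.
  by apply: le_lt_trans xia; rewrite ler_peMr ?ltW//; lra.
have sxi : s * xi = t.
  by rewrite /s /xi exprVn mulrCA mulVf ?mulr1// expf_eq0 gt_eqF.
(* Since f^2 dominates both 1/z and xi, decay at rate f^2 can be shared: f^M for smallness and f^i
   for summability. *)
pose f := Num.sqrt (Num.max z^-1 xi).
have f01 : 0 < f < 1.
  by rewrite sqrtr_gt0 lt_max xi0 orbT /= -sqrtr1 ltr_sqrt// gt_max xi1 andbT.
have f0 : 0 <= f by case/andP: f01 => /ltW.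
have f1 : f < 1 by case/andP: f01.
have f2z : z^-1 <= f ^+ 2 by rewrite sqr_sqrtr ?le_max ?lexx ?iz0.
have f2x : xi <= f ^+ 2 by rewrite sqr_sqrtr ?le_max ?lexx ?iz0 ?orbT.
have fle (i j : nat) : (i <= j)%N -> f ^+ j <= f ^+ i.
  by move=> ij; rewrite ler_wiXn2l ?f0 ?(ltW f1).
(* The total added mass in the limit of large M; [ka < 1] is the hypothesis in the form xi (1 + 2 a)
   < 1. *)
pose ka := 2 * a * xi / (1 - xi).
have ka1 : ka < 1 by rewrite ltr_pdivrMr ?subr_gt0//; lra.
pose d := (1 - ka) / 4.
have d0 : 0 < d by rewrite divr_gt0// subr_gt0.
pose C := 2 * a / (1 - xi) + a + 1.
have C0 : 0 < C by rewrite !addr_gt0// divr_gt0 ?subr_gt0//; lra.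
(* The first bound on f^M keeps the sampled mass below 1 - 2 d; the second keeps the growth rate of
   2 B(n) below d ln z per unit of n. *)
pose e1 := Num.min ((1 - ka) / (4 * a)) (d * ln z * (1 - f) / (2 * C)).
have lnz : 0 < ln z by rewrite ln_gt0.
have e10 : 0 < e1.
  have ka1' : 0 < 1 - ka by rewrite subr_gt0.
  have f1' : 0 < 1 - f by rewrite subr_gt0.
  by rewrite lt_min !divr_gt0 ?mulr_gt0.
have f01' : 0 <= f < 1 by rewrite f0.
have [M M0 hM] : exists2 M, (0 < M)%N & f ^+ M < e1.
  by have [N1 hN1] := expr_lt_exists f01' e10; exists N1.+1 => //; apply: hN1.
have MR : 0 < M%:R :> R by rewrite ltr0n.
have /andP[fM1 fM2] : (f ^+ M <= (1 - ka) / (4 * a)) && (f ^+ M <= d * ln z * (1 - f) / (2 * C)).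
  by rewrite -le_min ltW.
have [w pw] := primitive_root_exists R M0.
have w1 : nc w = 1 := nc_unity_root M0 (prim_expr_order pw).
(* The sign is that of 1 + t w = 1 - (-t) w: the reciprocal zero is -t = s x. *)
pose x := - xi.
have nx : `|x| = xi by rewrite normrN gtr0_norm.
have xlt1 : `|x| < 1 by rewrite nx.
have nxM : `|x ^+ M| <= xi.
  by rewrite normrX nx -(prednK M0) exprS ler_piMr ?(ltW xi0)// exprn_ile1// ltW.
have xM0 : 0 < 1 - x ^+ M.
  by rewrite subr_gt0; apply: le_lt_trans (ler_norm _) _; apply: le_lt_trans xi1.
have xMge : 1 - xi <= 1 - x ^+ M.
  by rewrite lerD2l lerN2; apply: le_trans (ler_norm _) _.
pose p (j : 'I_M) := poisson (x%:C * w ^+ j).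
(* The maximum of a times the kernel is the smallest uniform density for which all weights [dj] are
   nonnegative; it equals [ka + a]. *)
pose D0 := a * ((1 + xi) / (1 - xi)).
pose dj (j : 'I_M) := (D0 - a * p j) / M%:R.
have dj0 j : 0 <= dj j.
  rewrite divr_ge0 ?(ltW MR)// subr_ge0 ler_wpM2l ?(ltW a0)//.
  have nu : nc (x%:C * w ^+ j) = xi by rewrite ncM ncX w1 expr1n mulr1 nc_real.
  by have := @poisson_le R (x%:C * w ^+ j); rewrite nu; apply.
have sum_dj : \sum_j dj j = D0 - a * ((1 + x ^+ M) / (1 - x ^+ M)).
  have sum_p : \sum_j p j = M%:R * ((1 + x ^+ M) / (1 - x ^+ M)).
    apply: (@complexI R); rewrite rmorph_sum /=.
    transitivity (\sum_(j < M) w ^+ (j * 0) * (p j)%:C).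
      by apply: eq_bigr => j _; rewrite muln0 expr0 mul1r.
    rewrite (poisson_dft M0 pw xlt1 M0); rewrite /= expr0 [RHS]rmorphM [in RHS]rmorph_nat; congr (_ * _).
    rewrite -(rmorph1 (real_complex R)) -rmorphB /=; congr (_%:C).
    by field; rewrite gt_eqF.
  rewrite /dj -mulr_suml sumrB sumr_const card_ord -mulr_sumr sum_p -mulr_natl.
  by field; rewrite !gt_eqF.
have sum_dj_le : \sum_j dj j <= 1 - 2 * d.
  have h : 1 - 2 * f ^+ M <= (1 + x ^+ M) / (1 - x ^+ M).
    rewrite ler_pdivlMr//.
    have hx : - f ^+ M <= x ^+ M.
      rewrite lerNl; apply: le_trans (ler_norm _) _; rewrite normrN normrX nx.
      rewrite lerXn2r ?nnegrE ?(ltW xi0)//.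
      by apply: (le_trans f2x); rewrite -[leRHS]expr1; apply: fle.
    have hf : 0 <= f ^+ M by rewrite exprn_ge0.
    have [hx0|hx0] := leP 0 (x ^+ M).
      by nra.
    have : f ^+ M <= 1 by rewrite exprn_ile1// ltW.
    by nra.
  rewrite sum_dj; apply: (@le_trans _ _ (D0 - a * (1 - 2 * f ^+ M))).
    by rewrite lerD2l lerN2 ler_wpM2l// ltW.
  have -> : D0 = ka + a by rewrite /D0 /ka; field; rewrite gt_eqF// subr_gt0.
  have : 2 * a * f ^+ M <= (1 - ka) / 2.
    apply: (@le_trans _ _ (2 * a * ((1 - ka) / (4 * a)))).
      by rewrite ler_wpM2l// mulr_ge0// ltW.
    by rewrite le_eqVlt; apply/orP; left; apply/eqP; field; rewrite gt_eqF.
  by rewrite /d; lra.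
pose S i := \sum_j (dj j)%:C * w ^+ (j * i).
have hS i : (0 < i < M)%N ->
    S i = (- a * ((x ^+ i + x ^+ (M - i)) / (1 - x ^+ M)))%:C.
  move=> /andP[i0 iM].
  have := poisson_dft M0 pw xlt1 iM; rewrite gtn_eqF// subr0 => hp.
  transitivity (\sum_(j < M) (D0 / M%:R)%:C * w ^+ (j * i) -
      (a / M%:R)%:C * \sum_(j < M) w ^+ (j * i) * (p j)%:C).
    rewrite mulr_sumr -sumrB; apply: eq_bigr => j _.
    have -> : dj j = D0 / M%:R - a / M%:R * p j by rewrite /dj; ring.
    rewrite rmorphB rmorphM /=; ring.
  rewrite hp -mulr_sumr (sum_unity_root _ pw) gtnNdvd// mulr0 sub0r.
  rewrite -(rmorph_nat (real_complex R)) -!rmorphM -rmorphN /=; congr (_%:C).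
  by field; rewrite !gt_eqF.
(* For i < M the terms a x^i cancel and only aliased powers remain, of which the worst is x^(M - i),
   and xi^(M - i) z^(-i) <= f^(2M). For i >= M nothing cancels, but z^(-i) <= f^(2i) is already
   small enough. *)
have hg i : (0 < i)%N -> nc ((a * x ^+ i)%:C + S i) * z^-1 ^+ i <= C * f ^+ M * f ^+ i.
  move=> i0; have zi : z^-1 ^+ i <= f ^+ (2 * i).
    by rewrite exprM lerXn2r// nnegrE ?exprn_ge0.
  have CF : 2 * a / (1 - xi) <= C /\ a + 1 <= C.
    have h : 0 < 2 * a / (1 - xi).
      by apply: divr_gt0; [exact: mulr_gt0|rewrite subr_gt0].
    by rewrite /C; move: (2 * a / (1 - xi)) h => r h; split; lra.
  have [iM|iM] := ltnP i M.
    rewrite hS ?i0// -rmorphD nc_real /=.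
    have -> : a * x ^+ i + - a * ((x ^+ i + x ^+ (M - i)) / (1 - x ^+ M)) =
        - (a * ((x ^+ (M + i) + x ^+ (M - i)) / (1 - x ^+ M))).
      by rewrite exprD; field; rewrite gt_eqF.
    rewrite normrN normrM (gtr0_norm a0) normrM normfV (gtr0_norm xM0).
    apply: (@le_trans _ _ (2 * a / (1 - xi) * (xi ^+ (M - i) * z^-1 ^+ i))).
      rewrite [leRHS]mulrA ler_wpM2r ?exprn_ge0//.
      have -> : 2 * a / (1 - xi) * xi ^+ (M - i) = a * ((2 * xi ^+ (M - i)) / (1 - xi)) by ring.
      rewrite ler_wpM2l ?(ltW a0)// ler_pM ?invr_ge0 ?(ltW xM0) ?normr_ge0//; last first.
        have xi1' : 0 < 1 - xi by rewrite subr_gt0.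
        by rewrite lef_pV2 ?posrE.
      apply: (le_trans (ler_normD _ _)); rewrite !normrX nx mulr_natl mulr2n.
      rewrite lerD2r ler_wiXn2l ?(ltW xi0) ?(ltW xi1)//.
      by rewrite (leq_trans (leq_subr _ _)) ?leq_addr.
    rewrite -[leRHS]mulrA ler_pM ?(proj1 CF)//.
    - apply: divr_ge0; first by rewrite mulr_ge0// ltW.
      by rewrite subr_ge0 ltW.
    - by rewrite mulr_ge0 ?exprn_ge0 ?(ltW xi0).
    apply: (@le_trans _ _ (f ^+ (2 * (M - i)) * f ^+ (2 * i))).
      rewrite ler_pM ?exprn_ge0 ?(ltW xi0)// exprM lerXn2r// nnegrE ?exprn_ge0//.
      exact: ltW.
    by rewrite -!exprD; apply: fle; clear -iM; lia.
  apply: (@le_trans _ _ ((a + 1) * f ^+ (2 * i))).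
    rewrite ler_pM ?nc_ge0 ?exprn_ge0//.
    apply: (le_trans (ncD _ _)); rewrite lerD//.
      rewrite nc_real normrM (gtr0_norm a0) ler_piMr ?(ltW a0)// normrX nx.
      by rewrite exprn_ile1// ltW.
    apply: (le_trans (nc_sum _ _ _)); apply: (@le_trans _ _ (\sum_j dj j)).
      by apply: ler_sum => j _; rewrite ncM ncX w1 expr1n mulr1 nc_real ger0_norm.
    by apply: (le_trans sum_dj_le); lra.
  rewrite -[leRHS]mulrA ler_pM ?(proj2 CF) ?exprn_ge0//; first lra.
  by rewrite -exprD; apply: fle; clear -iM; lia.
pose m n := Num.trunc (a * n%:R).
pose mj n (j : 'I_M) := Num.trunc (n%:R * dj j).
pose v (j : 'I_M) := s%:C * w ^+ j.
pose lst n := flatten [seq nseq (mj n j) (v j) | j <- enum 'I_M].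
pose full n := nseq (m n) (- t%:C) ++ lst n.
pose y := z ^+ 2.
have y1 : 1 < y by rewrite exprn_egt1.
have sy i : s ^+ i * y ^+ i = z^-1 ^+ i.
  by rewrite -exprMn /s /y exprVn; congr (_ ^+ _); field; rewrite gt_eqF.
have trunc_err (r : R) : 0 <= r -> `|(Num.trunc r)%:R - r| <= 1.
  move=> r0; have /andP[h1 h2] := truncn_itv r0.
  by move: h2; rewrite -natr1 distrC ger0_norm ?subr_ge0//; lra.
(* Rounding changes each of the M + 1 multiplicities by at most 1, whatever n is; this is the second
   summand. *)
have psum_bound n i : (0 < i)%N ->
    nc (psum (full n) i) * y ^+ i <= n%:R * (C * f ^+ M) * f ^+ i + M.+1%:R * f ^+ i.
  move=> i0.
  have -> : psum (full n) i = n%:R * (s ^+ i)%:C * ((a * x ^+ i)%:C + S i) +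
     (s ^+ i)%:C * ((((m n)%:R - a * n%:R) * x ^+ i)%:C +
        \sum_j ((mj n j)%:R - n%:R * dj j)%:C * w ^+ (j * i)).
    rewrite psum_cat psum_nseq psum_flatten.
    have -> : - t%:C = (s * x)%:C by rewrite /x mulrN sxi rmorphN.
    rewrite (eq_bigr (fun j : 'I_M => (s ^+ i)%:C * ((mj n j)%:R * w ^+ (j * i)))); last first.
      by move=> j _; rewrite /v exprMn -exprM -rmorphXn mulrCA.
    have -> : \sum_j ((mj n j)%:R - n%:R * dj j)%:C * w ^+ (j * i) =
       \sum_(j < M) (mj n j)%:R * w ^+ (j * i) - n%:R * S i.
      rewrite /S mulr_sumr -sumrB; apply: eq_bigr => j _.
      by rewrite rmorphB rmorphM !rmorph_nat mulrBl mulrA.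
    have gen (A X mm nn aC Sg Si : R[i]) : mm * (A * X) + A * Sg =
        nn * A * (aC * X + Si) + A * ((mm - aC * nn) * X + (Sg - nn * Si)) by ring.
    rewrite -mulr_sumr -rmorphXn exprMn !(rmorphM, rmorphB, rmorph_nat) /=.
    exact: gen.
  apply: (@le_trans _ _ (n%:R * (nc ((a * x ^+ i)%:C + S i) * z^-1 ^+ i) + M.+1%:R * z^-1 ^+ i)).
    rewrite -sy; apply: (@le_trans _ _ ((n%:R * s ^+ i * nc ((a * x ^+ i)%:C + S i) +
      s ^+ i * M.+1%:R) * y ^+ i)); last by rewrite le_eqVlt; apply/orP; left; apply/eqP; ring.
    rewrite ler_wpM2r ?exprn_ge0//; first by rewrite ltW// (lt_trans _ y1).
    apply: (le_trans (ncD _ _)); rewrite !ncM nc_natr !nc_real.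
    rewrite ger0_norm ?exprn_ge0 ?(ltW s0)// lerD2l ler_wpM2l ?exprn_ge0 ?(ltW s0)//.
    apply: (le_trans (ncD _ _)); rewrite nc_real -nat1r lerD//.
      rewrite normrM -[leRHS]mulr1 ler_pM//.
        by apply: trunc_err; rewrite mulr_ge0// ltW.
      by rewrite normrX nx exprn_ile1// ltW.
    apply: (le_trans (nc_sum _ _ _)); rewrite -[leRHS]mul1r -[M in leRHS]card_ord mulr_natr -sumr_const.
    apply: ler_sum => j _; rewrite ncM nc_real ncX w1 expr1n mulr1.
    by apply: trunc_err; rewrite mulr_ge0.
  rewrite lerD//.
    by rewrite -[leRHS]mulrA ler_wpM2l// hg.
  rewrite ler_wpM2l// lerXn2r ?nnegrE//.
  by apply: (le_trans f2z); rewrite -[leRHS]expr1; apply: fle.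
pose B n := n%:R * (C * f ^+ M / (1 - f)) + M.+1%:R / (1 - f).
have hB n J : \sum_(i < J) nc (psum (full n) i.+1) * y ^+ i.+1 <= B n.
  apply: (@le_trans _ _ (\sum_(i < J) (n%:R * (C * f ^+ M) + M.+1%:R) * f ^+ i.+1)).
    by apply: ler_sum => i _; rewrite mulrDl; exact: psum_bound.
  rewrite -mulr_sumr /B [in leRHS]mulrA -[leRHS]mulrDl ler_wpM2l ?geometric_sum_le//.
  by rewrite addr_ge0// !mulr_ge0 ?exprn_ge0// ltW.
pose D n := Num.trunc (d * n%:R).
have dn0 n : 0 <= d * n%:R by rewrite mulr_ge0// ltW.
exists d, (fun n => rootprod (lst n) * invtrunc (full n) (D n)); split => //.
  move=> n.
  have szl : (size (lst n))%:R <= (1 - 2 * d) * n%:R.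
    apply: (@le_trans _ _ (\sum_j n%:R * dj j)).
      rewrite size_flatten sumnE /shape -map_comp big_map big_enum /= natr_sum.
      apply: ler_sum => j _; rewrite size_nseq.
      by have /andP[] := truncn_itv (mulr_ge0 (ler0n R n) (dj0 j)).
    by rewrite -mulr_sumr mulrC ler_wpM2r.
  apply: (@le_trans _ _ ((size (lst n)).+1 + D n)%:R).
    rewrite ler_nat (leq_trans (size_polyMleq _ _))//.
    have h1 := size_rootprod (lst n); have h2 := size_poly (D n).+1 (invcoef (full n)).
    exact: pred_addn_le h1 h2.
  rewrite natrD -natr1.
  by have /andP[h _] := truncn_itv (dn0 n); move: h szl; rewrite -/(D n); lra.
move=> e e0.
pose K := z * expR (2 * (M.+1%:R / (1 - f))) / (y - 1).
have K0 : 0 < K by rewrite divr_gt0 ?subr_gt0// mulr_gt0// expR_gt0.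
have iz01 : 0 <= z^-1 < 1 by rewrite iz0.
have [N0 hN0] := natS_mul_expr_small iz01 (divr_gt0 e0 K0).
exists (Num.trunc (N0%:R / d)).+1 => n hn u u1.
have DN : (N0 <= D n)%N.
  rewrite truncn_ge_nat// mulrC -ler_pdivrMr// ltW//.
  by apply: (lt_le_trans (truncnS_gt _)); rewrite ler_nat.
have := rootprod_invtrunc_bound (D n) y1 (hB n) u1.
have -> : (rootprod (full n)).[u] = (1 + t%:C * u) ^+ m n * (rootprod (lst n)).[u].
  rewrite /full /rootprod big_cat /= hornerM; congr (_ * _).
  rewrite -/(rootprod _) rootprod_nseq horner_exp; congr (_ ^+ _).
  by rewrite !hornerE; ring.
move=> bnd; rewrite hornerM mulrA; apply: (le_lt_trans bnd).
(* Here n is at most (D n + 1) / d, so the choice of f^M makes the part of 2 B(n) that grows with n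
   at most (D n + 1) ln z. *)
have eB : expR (2 * B n) <= z ^+ (D n).+1 * expR (2 * (M.+1%:R / (1 - f))).
  rewrite /B mulrDr expRD ler_wpM2r ?expR_ge0//.
  rewrite -[z in leRHS](lnK z0) -expRM_natl ler_expR.
  apply: (@le_trans _ _ ((D n).+1%:R / d * (d * ln z))); last first.
    by rewrite le_eqVlt; apply/orP; left; apply/eqP; field; rewrite gt_eqF.
  have -> : 2 * (n%:R * (C * f ^+ M / (1 - f))) = n%:R * (2 * (C * f ^+ M / (1 - f))) by ring.
  rewrite ler_pM//.
  - by rewrite !mulr_ge0 ?exprn_ge0 ?invr_ge0 ?subr_ge0// ltW.
  - by rewrite ler_pdivlMr// mulrC ltW//; have /andP[] := truncn_itv (dn0 n).
  have -> : d * ln z = 2 * (C * (d * ln z * (1 - f) / (2 * C)) / (1 - f)).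
    by field; rewrite !gt_eqF// subr_gt0.
  by rewrite ler_wpM2l// ler_wpM2r ?invr_ge0 ?subr_ge0 ?(ltW f1)// ler_wpM2l// ltW.
apply: (@le_lt_trans _ _ (K * ((D n).+1%:R * z^-1 ^+ D n))); last first.
  by rewrite mulrC -ltr_pdivlMr// hN0.
have yD : 0 <= y^-1 ^+ D n / (y - 1).
  rewrite divr_ge0 ?subr_ge0 ?(ltW y1)// exprn_ge0// invr_ge0 ltW//.
  by apply: lt_trans y1.
apply: (@le_trans _ _ ((D n).+1%:R * (z ^+ (D n).+1 * expR (2 * (M.+1%:R / (1 - f)))) *
   (y^-1 ^+ D n / (y - 1)))).
  by rewrite ler_wpM2r// ler_wpM2l.
rewrite le_eqVlt; apply/orP; left; apply/eqP.
have -> : y^-1 ^+ D n = z^-1 ^+ D n * z^-1 ^+ D n.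
  by rewrite -exprMn /y expr2 invfM.
have zz : z ^+ D n * z^-1 ^+ D n = 1 by rewrite -exprMn divff ?expr1n// gt_eqF.
rewrite /K exprS.
transitivity ((z ^+ D n * z^-1 ^+ D n) * (z * expR (2 * (M.+1%:R / (1 - f))) / (y - 1) * ((D n).+1%:R * z^-1 ^+ D n))).
  by ring.
by rewrite zz mul1r.
Qed.

End disc_approximation.

(** * Complex integration over rectangles *)

Section complex_derivative.
Variable R : realType.
Implicit Types (f g : R[i] -> R[i]) (z d : R[i]).

(** Division-free, with h = 0 allowed, so that the rules for products and compositions need no case
    distinction. *)
Definition has_cderiv f z d := forall e : R, 0 < e ->
  exists2 r : R, 0 < r & forall h, nc h < r ->
    nc (f (z + h) - f z - d * h) <= e * nc h.

Definition ccont f z := forall e : R, 0 < e ->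
  exists2 r : R, 0 < r & forall h, nc h < r -> nc (f (z + h) - f z) < e.

Lemma has_cderivP (f : Cplx R -> Cplx R) (z : Cplx R) :
  derivable f z 1 <-> exists d, has_cderiv f z d.
Proof.
split=> [df|[d df]].
  exists ('D_1 f z) => e e0.
  have /cvg_ncP/(_ e e0) := df; rewrite /nbhs/= => /nbhs_ncP[r r0 hr].
  exists r => // h hr'.
  have [->|h0] := eqVneq h 0; first by rewrite addr0 mulr0 subrr subr0 nc0 mulr0.
  have := hr h; rewrite subr0 => /(_ hr' h0) /= hh.
  rewrite -ler_pdivrMr ?nc_gt0// -ncV -ncM.
  apply: le_trans (ltW hh); rewrite le_eqVlt; apply/orP; left; apply/eqP; congr nc.
  have -> : h *: (1 : Cplx R) + z = z + h.
    by rewrite addrC; congr (_ + _); exact: mulr1.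
  rewrite -[lim _]/('D_1 f z) -[_ *: _]/(h^-1 * (f (z + h) - f z)).
  by move: ('D_1 f z) => D; field.
apply/cvg_ex; exists d; apply/cvg_ncP => e e0.
have e20 : 0 < e / 2 by rewrite divr_gt0.
have [r r0 hr] := df (e / 2) e20.
rewrite /nbhs /=; apply/nbhs_ncP; exists r => // h; rewrite subr0 => hr' h0.
have := hr h hr' => hh.
apply: (@le_lt_trans _ _ (e / 2)); last by lra.
have -> : h^-1 *: ((f \o shift z) (h *: (1 : Cplx R)) - f z) - d =
   h^-1 * (f (z + h) - f z - d * h).
  have -> : (f \o shift z) (h *: (1 : Cplx R)) = f (z + h).
    by rewrite /= addrC; congr (f (_ + _)); exact: mulr1.
  rewrite -[X in X - d]/(h^-1 * _); field; exact: h0.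
by rewrite ncM ncV mulrC ler_pdivrMr// nc_gt0.
Qed.

Lemma has_cderiv_ccont f z d : has_cderiv f z d -> ccont f z.
Proof.
move=> df e e0; have [r r0 hr] := df 1 ltr01.
have K0 : 0 < 1 + nc d by rewrite ltr_pwDl// nc_ge0.
exists (Num.min r (e / (1 + nc d))); first by rewrite lt_min r0 divr_gt0.
move=> h; rewrite lt_min => /andP[h1 h2].
have -> : f (z + h) - f z = (f (z + h) - f z - d * h) + d * h by rewrite subrK.
apply: (le_lt_trans (ncD _ _)); rewrite ncM.
apply: (@le_lt_trans _ _ (1 * nc h + nc d * nc h)); first by rewrite lerD2r hr.
by rewrite -mulrDl mulrC -ltr_pdivlMr.
Qed.

Lemma has_cderiv_cst z k : has_cderiv (fun=> k) z 0.
Proof.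
move=> e e0; exists 1 => // h _; rewrite subrr sub0r ncN mul0r nc0.
by rewrite mulr_ge0 ?nc_ge0// ltW.
Qed.

Lemma has_cderiv_id z : has_cderiv id z 1.
Proof.
move=> e e0; exists 1 => // h _; rewrite mul1r [z + h]addrC addrK subrr nc0.
by rewrite mulr_ge0 ?nc_ge0// ltW.
Qed.

Lemma has_cderivD f g z d k : has_cderiv f z d -> has_cderiv g z k ->
  has_cderiv (fun x => f x + g x) z (d + k).
Proof.
move=> df dg e e0; have e20 : 0 < e / 2 by rewrite divr_gt0.
have [r r0 hr] := df _ e20; have [s s0 hs] := dg _ e20.
exists (Num.min r s); first by rewrite lt_min r0.
move=> h; rewrite lt_min => /andP[h1 h2].
have -> : f (z + h) + g (z + h) - (f z + g z) - (d + k) * h =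
  (f (z + h) - f z - d * h) + (g (z + h) - g z - k * h) by ring.
apply: (le_trans (ncD _ _)); apply: (le_trans (lerD (hr h h1) (hs h h2))).
by rewrite -mulrDl -splitr.
Qed.

Lemma has_cderiv_comp f g z d k : has_cderiv g z k -> has_cderiv f (g z) d ->
  has_cderiv (fun x => f (g x)) z (d * k).
Proof.
move=> dg df e e0.
pose K := 1 + nc k; pose D := 1 + nc d.
have K0 : 0 < K by rewrite ltr_pwDl// nc_ge0.
have D0 : 0 < D by rewrite ltr_pwDl// nc_ge0.
have [r r0 hr] := df (e / 2 / K) (divr_gt0 (divr_gt0 e0 (ltr0Sn _ _)) K0).
have [s s0 hs] := dg (e / 2 / D) (divr_gt0 (divr_gt0 e0 (ltr0Sn _ _)) D0).
have [s' s'0 hs'] := dg 1 ltr01.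
exists (Num.min (Num.min s s') (r / K)); first by rewrite !lt_min s0 s'0 divr_gt0.
move=> h; rewrite !lt_min => /andP[/andP[h1 h2] h3].
pose u := g (z + h) - g z.
have hu : nc u <= K * nc h.
  have -> : u = (g (z + h) - g z - k * h) + k * h by rewrite subrK.
  apply: (le_trans (ncD _ _)); rewrite ncM /K mulrDl mul1r lerD2r.
  by apply: (le_trans (hs' h h2)); rewrite mul1r.
have ur : nc u < r.
  by apply: (le_lt_trans hu); rewrite mulrC -ltr_pdivlMr.
have -> : g (z + h) = g z + u by rewrite /u addrCA subrr addr0.
have -> : f (g z + u) - f (g z) - d * k * h =
  (f (g z + u) - f (g z) - d * u) + d * (g (z + h) - g z - k * h).
  by rewrite /u; ring.
apply: (le_trans (ncD _ _)); rewrite ncM.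
apply: (@le_trans _ _ (e / 2 * nc h + e / 2 * nc h)); last by rewrite -mulrDl -splitr.
apply: lerD.
  apply: (le_trans (hr u ur)); apply: (@le_trans _ _ (e / 2 / K * (K * nc h))).
    by rewrite ler_wpM2l// !divr_ge0// ltW.
  by rewrite mulrA divfK// gt_eqF.
apply: (@le_trans _ _ (D * (e / 2 / D * nc h))).
  by rewrite ler_pM ?nc_ge0// ?hs// /D lerDr.
by rewrite mulrA [D * _]mulrC divfK// gt_eqF.
Qed.

Lemma has_cderivM f g z d k : has_cderiv f z d -> has_cderiv g z k ->
  has_cderiv (fun x => f x * g x) z (d * g z + f z * k).
Proof.
move=> df dg e e0.
have cf := has_cderiv_ccont df.
pose G := 1 + nc (g z); pose F := 1 + nc (f z); pose K := 1 + nc k.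
have G0 : 0 < G by rewrite ltr_pwDl// nc_ge0.
have F0 : 0 < F by rewrite ltr_pwDl// nc_ge0.
have K0 : 0 < K by rewrite ltr_pwDl// nc_ge0.
have e3 : 0 < e / 3 by rewrite divr_gt0.
have [r r0 hr] := df _ (divr_gt0 e3 G0).
have [s s0 hs] := dg _ (divr_gt0 e3 (addr_gt0 F0 K0)).
have [t t0 ht] := cf _ (divr_gt0 e3 K0).
have [v v0 hv] := cf _ K0.
exists (Num.min (Num.min r s) (Num.min t v)); first by rewrite !lt_min r0 s0 t0 v0.
move=> h; rewrite !lt_min => /andP[/andP[h1 h2] /andP[h3 h4]].
have -> : f (z + h) * g (z + h) - f z * g z - (d * g z + f z * k) * h =
  (f (z + h) - f z - d * h) * g z + (f z + (f (z + h) - f z)) * (g (z + h) - g z - k * h)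
   + (f (z + h) - f z) * (k * h) by ring.
apply: (le_trans (ncD _ _)).
apply: (@le_trans _ _ ((e / 3 * nc h + e / 3 * nc h) + e / 3 * nc h)); last first.
  by rewrite le_eqVlt; apply/orP; left; apply/eqP; field.
apply: lerD.
  apply: (le_trans (ncD _ _)); apply: lerD; rewrite ncM.
    apply: (@le_trans _ _ (e / 3 / G * nc h * G)).
      by rewrite ler_pM ?nc_ge0// ?hr// /G lerDr.
    by rewrite mulrAC divfK// gt_eqF.
  apply: (@le_trans _ _ ((F + K) * (e / 3 / (F + K) * nc h))).
    rewrite ler_pM ?nc_ge0// ?hs//; apply: (le_trans (ncD _ _)).
    by rewrite lerD// ?(ltW (hv _ h4))// /F lerDr.
  by rewrite mulrA [(F + K) * _]mulrC divfK// gt_eqF// addr_gt0.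
rewrite !ncM mulrA; apply: ler_wpM2r; first exact: nc_ge0.
apply: (@le_trans _ _ (e / 3 / K * K)); last by rewrite divfK// gt_eqF.
by rewrite ler_pM ?nc_ge0// ?(ltW (ht _ h3))// /K lerDr.
Qed.

End complex_derivative.

(** * Integrals of complex functions over real segments *)

Section complex_integral.
Variable R : realType.
Implicit Types (g : R -> R[i]) (a b c : R).
Local Notation mu := lebesgue_measure.

Definition cint g a b : R[i] :=
  (\int[mu]_(x in `[a, b]) complex.Re (g x)) +i*
  (\int[mu]_(x in `[a, b]) complex.Im (g x)).

Definition path_cont g a b :=
  forall x, a <= x <= b -> {for x, continuous (g : R -> Cplx R)}.

Lemma continuous_Re : continuous (@complex.Re R : Cplx R -> R).
Proof.
move=> z U /nbhs_ballP[e e0 he]; apply/nbhs_ncP; exists e => // y yz.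
apply: he; rewrite /ball /= distrC.
by apply: le_lt_trans yz; rewrite -(raddfB (@complex.Re R)) Re_le_nc.
Qed.

Lemma continuous_Im : continuous (@complex.Im R : Cplx R -> R).
Proof.
move=> z U /nbhs_ballP[e e0 he]; apply/nbhs_ncP; exists e => // y yz.
apply: he; rewrite /ball /= distrC.
by apply: le_lt_trans yz; rewrite -(raddfB (@complex.Im R)) Im_le_nc.
Qed.

Lemma continuous_itv_integrable (h : R -> R) a b :
  (forall x, a <= x <= b -> {for x, continuous h}) ->
  mu.-integrable `[a, b] (EFin \o h).
Proof.
move=> hc; apply: continuous_compact_integrable; first exact: segment_compact.
apply: continuous_subspace_itv => x; rewrite in_itv /=; exact: hc.
Qed.

Lemma path_cont_Re g a b : path_cont g a b ->
  forall x, a <= x <= b -> {for x, continuous (fun x => complex.Re (g x))}.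
Proof.
by move=> gc x xab; apply: (@continuous_comp R (Cplx R) R g (@complex.Re R) x); [exact: gc|exact: continuous_Re].
Qed.

Lemma path_cont_Im g a b : path_cont g a b ->
  forall x, a <= x <= b -> {for x, continuous (fun x => complex.Im (g x))}.
Proof.
by move=> gc x xab; apply: (@continuous_comp R (Cplx R) R g (@complex.Im R) x); [exact: gc|exact: continuous_Im].
Qed.

Lemma integrable_Re g a b : path_cont g a b ->
  mu.-integrable `[a, b] (EFin \o (fun x => complex.Re (g x))).
Proof. by move=> gc; apply: continuous_itv_integrable; exact: path_cont_Re. Qed.

Lemma integrable_Im g a b : path_cont g a b ->
  mu.-integrable `[a, b] (EFin \o (fun x => complex.Im (g x))).
Proof. by move=> gc; apply: continuous_itv_integrable; exact: path_cont_Im. Qed.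

Lemma eq_cint g h a b : (forall x, a <= x <= b -> g x = h x) -> cint g a b = cint h a b.
Proof.
move=> gh; rewrite /cint; congr (_ +i* _); apply: eq_Rintegral => x;
  by rewrite inE /= in_itv /= => /gh ->.
Qed.

Lemma path_contD g h a b : path_cont g a b -> path_cont h a b ->
  path_cont (fun x => g x + h x) a b.
Proof. by move=> gc hc x xab; apply: cvgD; [exact: gc|exact: hc]. Qed.

Lemma path_contM g h a b : path_cont g a b -> path_cont h a b ->
  path_cont (fun x => g x * h x) a b.
Proof. by move=> gc hc x xab; apply: cvgM; [exact: gc|exact: hc]. Qed.

Lemma path_cont_cst k a b : path_cont (fun=> k) a b.
Proof. by move=> x _; exact: cvg_cst. Qed.

Lemma path_cont_sum n (F : 'I_n -> R -> R[i]) a b :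
  (forall i, path_cont (F i) a b) -> path_cont (fun x => \sum_(i < n) F i x) a b.
Proof.
elim: n F => [|n IH] F Fc.
  rewrite (_ : (fun x => _) = fun=> 0); first exact: path_cont_cst.
  by apply/funext => x; rewrite big_ord0.
rewrite (_ : (fun x => _) = fun x => F ord0 x + \sum_(i < n) F (lift ord0 i) x).
  by apply: path_contD => //; apply: IH.
by apply/funext => x; rewrite big_ord_recl.
Qed.

Lemma cintD g h a b : path_cont g a b -> path_cont h a b ->
  cint (fun x => g x + h x) a b = cint g a b + cint h a b.
Proof.
move=> gc hc; rewrite /cint; apply/eqP; rewrite eq_complex /=; apply/andP; split; apply/eqP.
  under eq_Rintegral => x _ do rewrite (raddfD (@complex.Re R)).
  by apply: RintegralD => //; exact: integrable_Re.
under eq_Rintegral => x _ do rewrite (raddfD (@complex.Im R)).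
by apply: RintegralD => //; exact: integrable_Im.
Qed.

Lemma cintZ k g a b : path_cont g a b ->
  cint (fun x => k * g x) a b = k * cint g a b.
Proof.
move=> gc; have iR := integrable_Re gc; have iI := integrable_Im gc.
case: k => p q; rewrite /cint; apply/eqP; rewrite eq_complex /=; apply/andP; split; apply/eqP.
  transitivity (\int[mu]_(x in `[a, b]) (p * complex.Re (g x) - q * complex.Im (g x))).
    by apply: eq_Rintegral => x _; case: (g x).
  rewrite RintegralB//; last first.
  - exact: (integrableZl _ q iI).
  - exact: (integrableZl _ p iR).
  by rewrite !RintegralZl.
transitivity (\int[mu]_(x in `[a, b]) (p * complex.Im (g x) + q * complex.Re (g x))).
  by apply: eq_Rintegral => x _; case: (g x).
rewrite RintegralD//; last first.
- exact: (integrableZl _ q iR).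
- exact: (integrableZl _ p iI).
by rewrite !RintegralZl.
Qed.

Lemma cint_sum n (F : 'I_n -> R -> R[i]) a b :
  (forall i, path_cont (F i) a b) ->
  cint (fun x => \sum_(i < n) F i x) a b = \sum_(i < n) cint (F i) a b.
Proof.
elim: n F => [|n IH] F Fc.
  rewrite big_ord0 (@eq_cint _ (fun=> 0 * 0)); last by move=> x _; rewrite big_ord0 mulr0.
  by rewrite cintZ ?mul0r//; exact: path_cont_cst.
rewrite big_ord_recl -IH//; rewrite -cintD//; last exact: path_cont_sum.
by apply: eq_cint => x _; rewrite big_ord_recl.
Qed.

Lemma cint_split g a b c : path_cont g a b -> a <= c <= b ->
  cint g a b = cint g a c + cint g c b.
Proof.
move=> gc /andP[ac cb].
have split (h : R -> R) : mu.-integrable `[a, b] (EFin \o h) ->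
    \int[mu]_(x in `[a, b]) h x = \int[mu]_(x in `[a, c]) h x + \int[mu]_(x in `[c, b]) h x.
  move=> hi.
  have iob : mu.-integrable `]c, b] (EFin \o h).
    apply: integrableS hi => // x /=; rewrite !in_itv /= => /andP[cx ->].
    by rewrite andbT (le_trans ac)// ltW.
  have h1 : (BLeft a <= BRight c)%O by rewrite bnd_simp.
  have h2 : (BRight c <= BRight b)%O by rewrite bnd_simp.
  have := Rintegral_itvB hi h1 h2.
  by rewrite Rintegral_itv_obnd_cbnd// => <-; ring.
rewrite /cint; apply/eqP; rewrite eq_complex /=; apply/andP; split; apply/eqP; apply: split.
  exact: integrable_Re.
exact: integrable_Im.
Qed.

(** The factor 2 comes from bounding the real and imaginary parts separately; the later estimates
    only need some constant. *)
Lemma nc_cint_le g (h : R -> R) a b : path_cont g a b ->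
  (forall x, a <= x <= b -> {for x, continuous h}) ->
  (forall x, a <= x <= b -> nc (g x) <= h x) ->
  nc (cint g a b) <= 2 * \int[mu]_(x in `[a, b]) h x.
Proof.
move=> gc hc gh; apply: (le_trans (nc_le_ReIm _)).
have -> : 2 * \int[mu]_(x in `[a, b]) h x =
  \int[mu]_(x in `[a, b]) h x + \int[mu]_(x in `[a, b]) h x by ring.
have bound (u : R -> R) : (forall x, a <= x <= b -> {for x, continuous u}) ->
    (forall x, a <= x <= b -> `|u x| <= h x) ->
    `|\int[mu]_(x in `[a, b]) u x| <= \int[mu]_(x in `[a, b]) h x.
  move=> uc uh; have ui := continuous_itv_integrable uc.
  apply: (le_trans (le_normr_Rintegral _ ui)) => //.
  apply: le_Rintegral => //.
  - apply: continuous_itv_integrable => x xab.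
    by apply: (@continuous_comp _ _ _ u (fun y => `|y|)); [exact: uc|exact: norm_continuous].
  - exact: continuous_itv_integrable.
apply: lerD; apply: bound.
- exact: path_cont_Re gc.
- by move=> x xab; apply: le_trans (gh x xab); exact: Re_le_nc.
- exact: path_cont_Im gc.
- by move=> x xab; apply: le_trans (gh x xab); exact: Im_le_nc.
Qed.

Lemma Rintegral_cst_itv (k : R) a b : a <= b -> \int[mu]_(x in `[a, b]) k = k * (b - a).
Proof.
move=> ab; rewrite Rintegral_cst//= lebesgue_measure_itv /= lte_fin.
move: ab; rewrite le_eqVlt => /predU1P[->|->//].
by rewrite ltxx subrr.
Qed.

Lemma nc_cint_le_cst g (K : R) a b : a <= b -> path_cont g a b ->
  (forall x, a <= x <= b -> nc (g x) <= K) ->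
  nc (cint g a b) <= 2 * (K * (b - a)).
Proof.
move=> ab gc gK; rewrite -Rintegral_cst_itv//.
by apply: nc_cint_le => // x _; exact: cvg_cst.
Qed.

Lemma cint_real (h : R -> R) a b : cint (fun x => (h x)%:C) a b =
  (\int[mu]_(x in `[a, b]) h x)%:C.
Proof.
rewrite /cint /=; congr (_ +i* _).
have [ab|ba] := leP a b; first by rewrite Rintegral_cst_itv// mul0r.
by rewrite set_itv_ge ?Rintegral_set0// bnd_simp -ltNge.
Qed.

Lemma cint_cst k a b : a <= b -> cint (fun=> k) a b = k * (b - a)%:C.
Proof.
move=> ab; rewrite (@eq_cint _ (fun=> k * (1 : R)%:C)); last by rewrite mulr1.
rewrite cintZ ?cint_real ?Rintegral_cst_itv ?mul1r//; exact: path_cont_cst.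
Qed.

Lemma Rintegral_id_itv a b : a <= b ->
  \int[mu]_(x in `[a, b]) x = (b ^+ 2 - a ^+ 2) / 2.
Proof.
rewrite le_eqVlt => /predU1P[->|ab].
  by rewrite set_itv1 Rintegral_set1 subrr mul0r.
rewrite /Rintegral (@continuous_FTC2 R id (fun x => x ^+ 2 / 2))//.
- by rewrite -EFinB /= mulrBl.
- by apply: continuous_subspaceT => x; exact: cvg_id.
- have cF : continuous (fun x : R => x ^+ 2 / 2).
    move=> x; apply: cvgM; last exact: cvg_cst.
    by rewrite expr2; apply: cvgM; exact: cvg_id.
  split.
  + by move=> x _; apply: derivableM => //; exact: derivable_cst.
  + by apply: cvg_at_right_filter; exact: cF.
  + by apply: cvg_at_left_filter; exact: cF.
- move=> x _; rewrite derive1E deriveM// derive_cst scaler0 add0r.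
  rewrite exp_derive/= expr1 -[LHS]/(2^-1 * (2 * x * 1)).
  by field.
Qed.


End complex_integral.

(** * Goursat's theorem for rectangles *)

Section goursat.
Variable R : realType.

Definition rect_integral (f : R[i] -> R[i]) (a b c d : R) : R[i] :=
  cint (fun x => f (x +i* c)) a b - cint (fun x => f (x +i* d)) a b
  + 'i * (cint (fun y => f (b +i* y)) c d - cint (fun y => f (a +i* y)) c d).

Definition rect_cont (f : R[i] -> R[i]) (a b c d : R) :=
  forall x y, a <= x <= b -> c <= y <= d -> ccont f (x +i* y).

Lemma ccont_hline f (x y : R) : ccont f (x +i* y) ->
  {for x, continuous ((fun t => f (t +i* y)) : R -> Cplx R)}.
Proof.
move=> fc; apply/cvg_ncP => e e0; have [r r0 hr] := fc e e0.
apply/nbhs_ballP; exists r => // t; rewrite /ball /= => xt.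
have := hr ((t - x)%:C); rewrite nc_real distrC => /(_ xt).
have -> // : x +i* y + (t - x)%:C = t +i* y.
by apply/eqP; rewrite eq_complex /=; apply/andP; split; apply/eqP; ring.
Qed.

Lemma ccont_vline f (x y : R) : ccont f (x +i* y) ->
  {for y, continuous ((fun t => f (x +i* t)) : R -> Cplx R)}.
Proof.
move=> fc; apply/cvg_ncP => e e0; have [r r0 hr] := fc e e0.
apply/nbhs_ballP; exists r => // t; rewrite /ball /= => xt.
have := hr (0 +i* (t - y)).
have -> : nc (0 +i* (t - y)) = `|t - y|.
  by rewrite ncE /= expr0n add0r sqrtr_sqr.
rewrite distrC => /(_ xt).
have -> // : x +i* y + (0 +i* (t - y)) = x +i* t.
by apply/eqP; rewrite eq_complex /=; apply/andP; split; apply/eqP; ring.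
Qed.

Lemma rect_cont_h f a b c d y : rect_cont f a b c d -> c <= y <= d ->
  path_cont (fun t => f (t +i* y)) a b.
Proof. by move=> fc ycd x xab; apply: ccont_hline; exact: fc. Qed.

Lemma rect_cont_v f a b c d x : rect_cont f a b c d -> a <= x <= b ->
  path_cont (fun t => f (x +i* t)) c d.
Proof. by move=> fc xab y ycd; apply: ccont_vline; exact: fc. Qed.

Lemma rect_cont_sub f a b c d a' b' c' d' :
  a <= a' -> b' <= b -> c <= c' -> d' <= d ->
  rect_cont f a b c d -> rect_cont f a' b' c' d'.
Proof.
move=> h1 h2 h3 h4 fc x y /andP[h5 h6] /andP[h7 h8]; apply: fc.
  by rewrite (le_trans h1)// (le_trans h6).
by rewrite (le_trans h3)// (le_trans h8).
Qed.

Lemma rect_split_h f a b c d m : rect_cont f a b c d -> a <= m <= b -> c <= d ->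
  rect_integral f a b c d = rect_integral f a m c d + rect_integral f m b c d.
Proof.
move=> fc amb cd; rewrite /rect_integral.
have hc : c <= c <= d by rewrite lexx.
have hd : c <= d <= d by rewrite lexx andbT.
rewrite (cint_split (rect_cont_h fc hc) amb) (cint_split (rect_cont_h fc hd) amb).
by ring.
Qed.

Lemma rect_split_v f a b c d m : rect_cont f a b c d -> a <= b -> c <= m <= d ->
  rect_integral f a b c d = rect_integral f a b c m + rect_integral f a b m d.
Proof.
move=> fc ab cmd; rewrite /rect_integral.
have ha : a <= a <= b by rewrite lexx.
have hb : a <= b <= b by rewrite lexx andbT.
rewrite (cint_split (rect_cont_v fc ha) cmd) (cint_split (rect_cont_v fc hb) cmd).
by ring.
Qed.

Lemma rect_integralB f g a b c d : a <= b -> c <= d ->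
  rect_cont f a b c d -> rect_cont g a b c d ->
  rect_integral (fun z => f z + g z) a b c d =
  rect_integral f a b c d + rect_integral g a b c d.
Proof.
move=> ab cd fc gc; rewrite /rect_integral.
have ha : a <= a <= b by rewrite lexx.
have hb : a <= b <= b by rewrite lexx andbT.
have hc : c <= c <= d by rewrite lexx.
have hd : c <= d <= d by rewrite lexx andbT.
rewrite !cintD; try exact: rect_cont_h; try exact: rect_cont_v.
all: try (exact: (rect_cont_h fc)); try (exact: (rect_cont_h gc)).
all: try (exact: (rect_cont_v fc)); try (exact: (rect_cont_v gc)).
by ring.
Qed.

Lemma nc_rect_integral_le f a b c d (K : R) : a <= b -> c <= d ->
  rect_cont f a b c d ->
  (forall x y, a <= x <= b -> c <= y <= d -> nc (f (x +i* y)) <= K) ->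
  nc (rect_integral f a b c d) <= 4 * K * ((b - a) + (d - c)).
Proof.
move=> ab cd fc fK; rewrite /rect_integral.
have ha : a <= a <= b by rewrite lexx.
have hb : a <= b <= b by rewrite lexx andbT.
have hc : c <= c <= d by rewrite lexx.
have hd : c <= d <= d by rewrite lexx andbT.
have i1 : nc ('i : R[i]) = 1 by rewrite ncE /= expr0n add0r expr1n sqrtr1.
have Hh y : c <= y <= d -> nc (cint (fun x => f (x +i* y)) a b) <= 2 * (K * (b - a)).
  by move=> ycd; apply: nc_cint_le_cst => //; [exact: rect_cont_h fc ycd|move=> x xab; exact: fK].
have Hv x : a <= x <= b -> nc (cint (fun y => f (x +i* y)) c d) <= 2 * (K * (d - c)).
  by move=> xab; apply: nc_cint_le_cst => //; [exact: rect_cont_v fc xab|move=> y ycd; exact: fK].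
apply: (le_trans (ncD _ _)); rewrite ncM i1 mul1r.
have := lerD (ncB (cint (fun x => f (x +i* c)) a b) (cint (fun x => f (x +i* d)) a b))
  (ncB (cint (fun y => f (b +i* y)) c d) (cint (fun y => f (a +i* y)) c d)).
move=> /le_trans; apply.
have := Hh c hc; have := Hh d hd; have := Hv a ha; have := Hv b hb.
by lra.
Qed.

Lemma path_cont_real a b : path_cont (fun x : R => x%:C) a b.
Proof.
move=> x _; apply: (@ccont_hline id x 0) => e e0; exists e => // h he.
by rewrite addrAC subrr add0r.
Qed.

Lemma cint_affine (p q : R[i]) a b : a <= b ->
  cint (fun x : R => p + q * x%:C) a b = p * (b - a)%:C + q * ((b ^+ 2 - a ^+ 2) / 2)%:C.
Proof.
move=> ab.
have rc : path_cont (fun x : R => x%:C) a b by exact: path_cont_real.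
have qc : path_cont (fun x : R => q * x%:C) a b := path_contM (@path_cont_cst _ q a b) rc.
rewrite (@cintD R (fun=> p) (fun x => q * x%:C) a b (@path_cont_cst _ p a b) qc).
rewrite (cint_cst p ab) (@cintZ R q (fun x => x%:C) a b rc).
by rewrite (@cint_real R id a b) Rintegral_id_itv.
Qed.

(** Direct computation on the four sides; in Goursat's argument it removes the tangent map at the
    limit point. *)
Lemma rect_integral_affine (p q : R[i]) a b c d : a <= b -> c <= d ->
  rect_integral (fun z => p + q * z) a b c d = 0.
Proof.
move=> ab cd; rewrite /rect_integral.
have H y : cint (fun x => p + q * (x +i* y)) a b =
    (p + q * (0 +i* y)) * (b - a)%:C + q * ((b ^+ 2 - a ^+ 2) / 2)%:C.
  rewrite (@eq_cint _ _ (fun x => (p + q * (0 +i* y)) + q * x%:C)); last first.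
    move=> x _; rewrite -addrA -mulrDr; congr (_ + _ * _).
    by apply/eqP; rewrite eq_complex /= add0r addr0 !eqxx.
  exact: cint_affine.
have V x : cint (fun y => p + q * (x +i* y)) c d =
    (p + q * x%:C) * (d - c)%:C + q * 'i * ((d ^+ 2 - c ^+ 2) / 2)%:C.
  rewrite (@eq_cint _ _ (fun y => (p + q * x%:C) + (q * 'i) * y%:C)); last first.
    move=> y _; rewrite -addrA -mulrA -mulrDr; congr (_ + _ * _).
    by apply/eqP; rewrite eq_complex /=; apply/andP; split; apply/eqP; ring.
  exact: cint_affine.
rewrite !H !V; clear H V; case: p q => p1 p2 [q1 q2].
by apply/eqP; rewrite eq_complex /=; apply/andP; split; apply/eqP; field.
Qed.


Section bisection.
Variables (f : R[i] -> R[i]) (a c w v : R).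
Hypotheses (w0 : 0 <= w) (v0 : 0 <= v).
Hypothesis df : forall x y, a <= x <= a + w -> c <= y <= c + v ->
  exists d, has_cderiv f (x +i* y) d.

Let fc : rect_cont f a (a + w) c (c + v).
Proof.
by move=> x y xa yc; have [d hd] := df xa yc; exact: has_cderiv_ccont hd.
Qed.

Let J n (p : R * R) :=
  rect_integral f p.1 (p.1 + w / 2 ^+ n) p.2 (p.2 + v / 2 ^+ n).

Let inside n (p : R * R) := [/\ a <= p.1, p.1 + w / 2 ^+ n <= a + w,
  c <= p.2 & p.2 + v / 2 ^+ n <= c + v].

Let child n (p q : R * R) := [/\ p.1 <= q.1, q.1 + w / 2 ^+ n.+1 <= p.1 + w / 2 ^+ n,
  p.2 <= q.2 & q.2 + v / 2 ^+ n.+1 <= p.2 + v / 2 ^+ n].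

Let half (u : R) n : u / 2 ^+ n = u / 2 ^+ n.+1 + u / 2 ^+ n.+1.
Proof. by rewrite exprS; field; rewrite expf_neq0. Qed.

(** The four quarters have integrals adding up to that of the rectangle, so one of them carries at
    least a quarter of its modulus. *)
Let step n p : inside n p ->
  exists q, [/\ child n p q, inside n.+1 q & nc (J n p) <= 4 * nc (J n.+1 q)].
Proof.
case: p => x y hin.
have [ax xw cy yv] : [/\ a <= x, x + w / 2 ^+ n <= a + w, c <= y &
  y + v / 2 ^+ n <= c + v] := hin.
pose u := w / 2 ^+ n.+1; pose t := v / 2 ^+ n.+1.
have u0 : 0 <= u by rewrite divr_ge0// exprn_ge0.
have t0 : 0 <= t by rewrite divr_ge0// exprn_ge0.
have hw : w / 2 ^+ n = u + u := half w n.
have hv : v / 2 ^+ n = t + t := half v n.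
rewrite hw in xw; rewrite hv in yv.
pose I p q := rect_integral f p (p + u) q (q + t).
have split4 : J n (x, y) = I x y + I x (y + t) + (I (x + u) y + I (x + u) (y + t)).
  rewrite /J /= hw hv /I !addrA.
  have fc1 : rect_cont f x (x + u + u) y (y + t + t).
    by apply: rect_cont_sub fc; lra.
  have h1 : x <= x + u <= x + u + u by apply/andP; split; lra.
  have h2 : y <= y + t <= y + t + t by apply/andP; split; lra.
  rewrite (@rect_split_h f x _ y _ (x + u))//; last by lra.
  rewrite (@rect_split_v f x (x + u) y _ (y + t))//; first last.
  - by lra.
  - by apply: rect_cont_sub fc1; lra.
  rewrite (@rect_split_v f (x + u) (x + u + u) y _ (y + t))//; first last.
  - by lra.
  - by apply: rect_cont_sub fc1; lra.
  by rewrite !addrA.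
have [H|H] := pselect (exists q : R * R, (q.1 = x \/ q.1 = x + u) /\
    (q.2 = y \/ q.2 = y + t) /\ nc (J n (x, y)) <= 4 * nc (I q.1 q.2)).
  have [[q1 q2] [h1 [h2 h3]]] := H.
  rewrite [(q1, q2).1]/= in h1 h3; rewrite [(q1, q2).2]/= in h2 h3.
  have [g1 g2] : x <= q1 /\ q1 + u <= x + u + u by case: h1 => ->; split; lra.
  have [g3 g4] : y <= q2 /\ q2 + t <= y + t + t by case: h2 => ->; split; lra.
  exists (q1, q2); split; last exact: h3.
    by rewrite /child hw hv /= -/u -/t; split; lra.
  by rewrite /inside /= -/u -/t; split; lra.
exfalso.
have L p q : (p = x \/ p = x + u) -> (q = y \/ q = y + t) ->
    4 * nc (I p q) < nc (J n (x, y)).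
  by move=> hp hq; rewrite ltNge; apply/negP => h; apply: H; exists (p, q).
have h1 := L x y (or_introl erefl) (or_introl erefl).
have h2 := L x (y + t) (or_introl erefl) (or_intror erefl).
have h3 := L (x + u) y (or_intror erefl) (or_introl erefl).
have h4 := L (x + u) (y + t) (or_intror erefl) (or_intror erefl).
have := ncD (I x y + I x (y + t)) (I (x + u) y + I (x + u) (y + t)).
rewrite -split4.
have := ncD (I x y) (I x (y + t)); have := ncD (I (x + u) y) (I (x + u) (y + t)).
by lra.
Qed.

(** Repeated quartering leads to a point (x, y) common to all rectangles. Subtracting the tangent
    map there leaves an integrand of size e1 times the diameter, and the factor 4^n is cancelled by
    diameter times perimeter. *)
Lemma goursat_rect : rect_integral f a (a + w) c (c + v) = 0.
Proof.
pose nxt n p := if pselect (inside n p) is left h then sval (cid (step h)) else p.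
have nxtP n p : inside n p -> [/\ child n p (nxt n p), inside n.+1 (nxt n p) &
    nc (J n p) <= 4 * nc (J n.+1 (nxt n p))].
  by move=> h; rewrite /nxt; case: pselect => // h'; case: cid.
pose s := fix s n := if n is n'.+1 then nxt n' (s n') else (a, c).
have s_in n : inside n (s n).
  elim: n => [|n IH]; first by split; rewrite /= ?expr0 ?divr1.
  by have [] := nxtP n (s n) IH.
have s_child n : child n (s n) (s n.+1) by have [] := nxtP n (s n) (s_in n).
have s_J n : nc (rect_integral f a (a + w) c (c + v)) <= 4 ^+ n * nc (J n (s n)).
  elim: n => [|n IH]; first by rewrite /J !expr0 !divr1 mul1r.
  apply: (le_trans IH); rewrite exprSr -mulrA ler_wpM2l ?exprn_ge0//.
  by have [] := nxtP n (s n) (s_in n).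
have nest n k : [/\ (s n).1 <= (s (n + k)%N).1,
    (s (n + k)%N).1 + w / 2 ^+ (n + k) <= (s n).1 + w / 2 ^+ n,
    (s n).2 <= (s (n + k)%N).2 &
    (s (n + k)%N).2 + v / 2 ^+ (n + k) <= (s n).2 + v / 2 ^+ n].
  elim: k => [|k [h1 h2 h3 h4]]; first by rewrite addn0.
  rewrite addnS; have [g1 g2 g3 g4] := s_child (n + k)%N.
  split; [exact: le_trans g1|exact: le_trans h2|exact: le_trans g3|exact: le_trans h4].
have pw n : 0 <= w / 2 ^+ n by rewrite divr_ge0// exprn_ge0.
have pv n : 0 <= v / 2 ^+ n by rewrite divr_ge0// exprn_ge0.
have lim (g : nat -> R) (l : nat -> R) : (forall n k, g n <= g (n + k)%N) ->
    (forall n k, g (n + k)%N <= l n) -> exists x, forall n, g n <= x <= l n.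
  move=> gm gl.
  have gle m n : g m <= l n.
    have [mn|nm] := leqP m n.
      rewrite -(subnKC mn); apply: (le_trans (gm m (n - m)%N)).
      by rewrite -[X in _ <= l X]addn0; apply: le_trans (gl _ 0%N); rewrite addn0.
    by rewrite -(subnKC (ltnW nm)).
  exists (sup (range g)) => n; apply/andP; split.
    by apply: ub_le_sup; [exists (l 0%N) => _ [m _ <-]|exists n].
  by apply: ge_sup; [exists (g 0%N); exists 0%N|move=> _ [m _ <-]].
have [x hx] : exists x, forall n, (s n).1 <= x <= (s n).1 + w / 2 ^+ n.
  apply: lim => n k; have [h1 h2 _ _] := nest n k => //.
  by apply: le_trans h2; rewrite lerDl.
have [y hy] : exists y, forall n, (s n).2 <= y <= (s n).2 + v / 2 ^+ n.
  apply: lim => n k; have [_ _ h1 h2] := nest n k => //.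
  by apply: le_trans h2; rewrite lerDl.
have xa : a <= x <= a + w by have := hx 0%N; rewrite /= expr0 divr1.
have yc : c <= y <= c + v by have := hy 0%N; rewrite /= expr0 divr1.
have [d hd] := df xa yc.
apply/eqP; rewrite -nc_eq0 eq_le nc_ge0 andbT; apply/ler_addgt0Pr => e e0.
rewrite add0r.
pose S := w + v.
have S0 : 0 <= S by rewrite addr_ge0.
(* The final bound is 4 e1 S^2; the summand 1 keeps the denominator positive when the rectangle
   degenerates to a point. *)
pose e1 := e / (4 * (S * S + 1)).
have SS : 0 < 4 * (S * S + 1) by rewrite mulr_gt0// ltr_wpDl ?mulr_ge0.
have e10 : 0 < e1 by rewrite divr_gt0.
have [r r0 hr] := hd e1 e10.
have [n hn] : exists n, S / 2 ^+ n < r.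
  have h2 : 0 <= (2^-1 : R) < 1 by rewrite invr_ge0 ler0n invf_lt1 ?ltr1n.
  have [N hN] : exists N : nat, S / r < N%:R.
    by exists (Num.trunc (S / r)).+1; exact: truncnS_gt.
  exists N; rewrite ltr_pdivrMr ?exprn_gt0// mulrC -ltr_pdivrMr//.
  apply: (lt_le_trans hN); rewrite -natrX ler_nat ltnW//; exact: ltn_expl.
set p := s n; have hp : inside n p := s_in n.
have /andP[x1 x2] : p.1 <= x <= p.1 + w / 2 ^+ n := hx n.
have /andP[y1 y2] : p.2 <= y <= p.2 + v / 2 ^+ n := hy n.
case: hp => p1 p2 p3 p4.
pose g z := f z + (- (f (x +i* y) - d * (x +i* y)) + (- d) * z).
have rc : rect_cont f p.1 (p.1 + w / 2 ^+ n) p.2 (p.2 + v / 2 ^+ n).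
  exact: rect_cont_sub fc.
have ac : rect_cont (fun z => - (f (x +i* y) - d * (x +i* y)) + (- d) * z)
    p.1 (p.1 + w / 2 ^+ n) p.2 (p.2 + v / 2 ^+ n).
  move=> x' y' _ _; apply: has_cderiv_ccont; apply: has_cderivD.
    exact: has_cderiv_cst.
  by apply: has_cderivM; [exact: has_cderiv_cst|exact: has_cderiv_id].
have Jg : J n p = rect_integral g p.1 (p.1 + w / 2 ^+ n) p.2 (p.2 + v / 2 ^+ n).
  by rewrite rect_integralB ?lerDl// rect_integral_affine ?lerDl// addr0.
have gc : rect_cont g p.1 (p.1 + w / 2 ^+ n) p.2 (p.2 + v / 2 ^+ n).
  move=> x' y' hx' hy'.
  have [d' hd'] : exists d', has_cderiv f (x' +i* y') d'.
    apply: df; apply/andP; split; move: hx' hy' => /andP[? ?] /andP[? ?]; lra.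
  apply: has_cderiv_ccont; apply: has_cderivD; first exact: hd'.
  apply: has_cderivD; first exact: has_cderiv_cst.
  by apply: has_cderivM; [exact: has_cderiv_cst|exact: has_cderiv_id].
have bound x' y' : p.1 <= x' <= p.1 + w / 2 ^+ n -> p.2 <= y' <= p.2 + v / 2 ^+ n ->
    nc (g (x' +i* y')) <= e1 * (S / 2 ^+ n).
  move=> /andP[hx1 hx2] /andP[hy1 hy2].
  pose h : R[i] := (x' - x) +i* (y' - y).
  have hxy : x' +i* y' = x +i* y + h.
    by apply/eqP; rewrite eq_complex /=; apply/andP; split; apply/eqP; ring.
  have hle : nc h <= S / 2 ^+ n.
    apply: (le_trans (nc_le_ReIm _)); rewrite /= /S mulrDl.
    by apply: lerD; rewrite ler_norml; apply/andP; split; lra.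
  have -> : g (x' +i* y') = f (x +i* y + h) - f (x +i* y) - d * h.
    by rewrite /g hxy; ring.
  apply: (le_trans (hr h _)); first exact: le_lt_trans hle hn.
  by rewrite ler_wpM2l// ltW.
apply: (le_trans (s_J n)); rewrite -/p Jg.
apply: (@le_trans _ _ (4 ^+ n * (4 * (e1 * (S / 2 ^+ n)) * (S / 2 ^+ n)))).
  rewrite ler_wpM2l ?exprn_ge0//.
  apply: (le_trans (nc_rect_integral_le _ _ gc bound)); rewrite ?lerDl//.
  by rewrite le_eqVlt; apply/orP; left; apply/eqP; rewrite /S; ring.
have -> : 4 ^+ n * (4 * (e1 * (S / 2 ^+ n)) * (S / 2 ^+ n)) = e1 * (4 * (S * S)).
  have -> : (4 : R) ^+ n = 2 ^+ n * 2 ^+ n by rewrite -exprMn; congr (_ ^+ _); ring.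
  by field; rewrite expf_neq0.
rewrite /e1 mulrAC ler_pdivrMr//.
by rewrite ler_wpM2l ?(ltW e0)// ler_pM2l// lerDl.
Qed.

End bisection.

End goursat.

(** * Approximation of periodic functions on a strip *)

Section complex_exponential.
Variable R : realType.
Implicit Types (z w : R[i]) (x y : R).

Lemma is_derive_approx (f : R -> R) x d : is_derive x 1 f d ->
  forall e : R, 0 < e -> exists2 r : R, 0 < r & forall t, `|t| < r ->
    `|f (x + t) - f x - d * t| <= e * `|t|.
Proof.
move=> [df fd] e e0.
have /cvgrPdist_lt/(_ e e0) := df; rewrite /nbhs/= => /nbhs_ballP[r r0 hr].
exists r => // t tr.
have [->|t0] := eqVneq t 0; first by rewrite addr0 subrr mulr0 subr0 normr0 mulr0.
have := hr t; rewrite /ball /= sub0r normrN => /(_ tr t0) hh.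
rewrite -ler_pdivrMr ?normr_gt0// -normfV -normrM.
apply: le_trans (ltW hh); rewrite le_eqVlt; apply/orP; left; apply/eqP.
rewrite distrC; congr `|_|.
have -> : t *: (1 : R) + x = x + t.
  by rewrite addrC; congr (_ + _); exact: mulr1.
rewrite -[lim _]/('D_1 f x) fd -[_ *: _]/(t^-1 * (f (x + t) - f x)).
by field.
Qed.

Lemma cexpD z w : cexp (z + w) = cexp z * cexp w :> R[i].
Proof.
case: z w => a b [c d]; rewrite /cexp /= expRD cosD sinD.
by apply/eqP; rewrite eq_complex /=; apply/andP; split; apply/eqP; ring.
Qed.

Lemma cexpE x y : cexp (x +i* y) = (expR x)%:C * (cos y +i* sin y) :> R[i].
Proof. by []. Qed.

Lemma cexp0 : cexp (0 : R[i]) = 1.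
Proof. by rewrite /cexp /= expR0 cos0 sin0 mul1r. Qed.

Lemma nc_cexp z : nc (cexp z) = expR (complex.Re z).
Proof.
rewrite /cexp ncM nc_real (ger0_norm (expR_ge0 _)) ncE /= cos2Dsin2 sqrtr1.
by rewrite mulr1.
Qed.

Lemma cexp_neq0 z : cexp z != 0 :> R[i].
Proof. by rewrite -nc_eq0 nc_cexp gt_eqF// expR_gt0. Qed.

Lemma cexpN z : cexp (- z) = (cexp z)^-1 :> R[i].
Proof. by apply: (mulfI (cexp_neq0 z)); rewrite -cexpD subrr cexp0 divff// cexp_neq0. Qed.

Lemma cexp_natl n z : cexp (n%:R * z) = cexp z ^+ n :> R[i].
Proof.
elim: n => [|n IH]; first by rewrite mul0r cexp0.
by rewrite -natr1 mulrDl mul1r cexpD IH exprSr.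
Qed.

Lemma cexp_imag y : cexp (0 +i* y) = cos y +i* sin y :> R[i].
Proof. by rewrite /cexp /= expR0 mul1r. Qed.

Lemma cexp_2pi x y : cexp (x +i* (y + 2 * pi)) = cexp (x +i* y) :> R[i].
Proof.
have -> : y + 2 * pi = y + pi + pi by ring.
by rewrite /cexp /= !cosDpi !sinDpi !opprK.
Qed.

Lemma has_cderiv_opp z : has_cderiv (fun w : R[i] => - w) z (-1).
Proof.
move=> e e0; exists 1 => // h _.
have -> : - (z + h) - - z - -1 * h = 0 by ring.
by rewrite nc0 mulr_ge0 ?nc_ge0// ltW.
Qed.

(** The real expansions of exp, cos and sin at 0 are combined here once; the addition formula
    carries the derivative to every other point. *)
Lemma has_cderiv_cexp0 : has_cderiv (@cexp R) 0 1.
Proof.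
move=> e e0; rewrite /has_cderiv.
have e8 : 0 < Num.min (e / 8) 1 by rewrite lt_min divr_gt0 /=.
set k := Num.min (e / 8) 1 in e8.
have k1 : k <= 1 by rewrite ge_min lexx orbT.
have ke : 8 * k <= e.
  have : k <= e / 8 by rewrite ge_min lexx.
  by lra.
have [r1 r10 h1] := is_derive_approx (is_derive_expR 0) e8.
have [r2 r20 h2] := is_derive_approx (is_derive_cos 0) e8.
have [r3 r30 h3] := is_derive_approx (is_derive_sin 0) e8.
exists (Num.min (Num.min r1 r2) (Num.min r3 (k / 2))).
  by rewrite !lt_min r10 r20 r30 divr_gt0.
move=> h; rewrite !lt_min => /andP[/andP[hr1 hr2] /andP[hr3 hk]].
rewrite add0r cexp0 mul1r.
case: h hr1 hr2 hr3 hk => x y hr1 hr2 hr3 hk.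
have hx : `|x| <= nc (x +i* y) := Re_le_nc (x +i* y).
have hy : `|y| <= nc (x +i* y) := Im_le_nc (x +i* y).
have := h1 x (le_lt_trans hx hr1); rewrite expR0 mul1r add0r => ex.
have := h2 y (le_lt_trans hy hr2); rewrite cos0 sin0 oppr0 mul0r subr0 add0r => cy.
have := h3 y (le_lt_trans hy hr3); rewrite cos0 sin0 mul1r subr0 add0r => sy.
set n := nc (x +i* y) in hk hx hy *.
have n0 : 0 <= n := nc_ge0 _.
have ex1 : `|expR x - 1| <= 2 * n.
  have -> : expR x - 1 = (expR x - 1 - x) + x by rewrite subrK.
  apply: (le_trans (ler_normD _ _)).
  have : k * `|x| <= n by apply: (le_trans _ hx); rewrite ler_piMl.
  by lra.
have ex2 : `|expR x| <= 2.
  have -> : expR x = (expR x - 1) + 1 by rewrite subrK.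
  by apply: (le_trans (ler_normD _ _)); rewrite normr1; lra.
apply: (le_trans (nc_le_ReIm _)).
have -> : complex.Re (cexp (x +i* y) - 1 - x +i* y) =
    expR x * (cos y - 1) + (expR x - 1 - x) by rewrite /cexp /=; ring.
have -> : complex.Im (cexp (x +i* y) - 1 - x +i* y) =
    expR x * (sin y - y) + y * (expR x - 1) by rewrite /cexp /=; ring.
have kn : k * `|x| <= k * n by rewrite ler_wpM2l// ltW.
have kn' : k * `|y| <= k * n by rewrite ler_wpM2l// ltW.
have b1 : `|expR x * (cos y - 1) + (expR x - 1 - x)| <= 3 * (k * n).
  apply: (le_trans (ler_normD _ _)); rewrite normrM.
  have : `|expR x| * `|cos y - 1| <= 2 * (k * `|y|) by rewrite ler_pM.
  by lra.
have b2 : `|expR x * (sin y - y) + y * (expR x - 1)| <= 3 * (k * n).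
  apply: (le_trans (ler_normD _ _)); rewrite !normrM.
  have : `|expR x| * `|sin y - y| <= 2 * (k * `|y|) by rewrite ler_pM.
  have : `|y| * `|expR x - 1| <= k / 2 * (2 * n) by rewrite ler_pM// ltW// (le_lt_trans hy).
  by lra.
apply: (le_trans (lerD b1 b2)).
apply: (@le_trans _ _ (8 * k * n)); last by rewrite ler_wpM2r.
have : 0 <= k * n by rewrite mulr_ge0// ltW.
by lra.
Qed.

Lemma has_cderiv_cexp z : has_cderiv (@cexp R) z (cexp z).
Proof.
move=> e e0.
have K0 : 0 < nc (cexp z) by rewrite nc_cexp expR_gt0.
have [r r0 hr] := has_cderiv_cexp0 (divr_gt0 e0 K0).
exists r => // h /hr; rewrite add0r cexp0 mul1r => hh.
have -> : cexp (z + h) - cexp z - cexp z * h = cexp z * (cexp h - 1 - h).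
  by rewrite cexpD; ring.
rewrite ncM mulrC -ler_pdivlMr//.
by apply: (le_trans hh); rewrite mulrAC.
Qed.

#[local] Opaque cexp.

(** Separates the variables of the convolution kernel: with u = z - v, each term is a monomial in
    exp z and exp(-z) times a function of v alone. *)
Lemma cexp_kernel_factor (u v z k f : R[i]) l n : z = v + u ->
  k * (cexp u ^+ l * cexp (- u) ^+ n) * f =
  (k * (cexp z ^+ l * cexp (- z) ^+ n)) * (f * (cexp (- v) ^+ l * cexp v ^+ n)).
Proof.
move=> ->; rewrite opprD.
rewrite (cexpD v u).
rewrite (cexpD (- v) (- u)).
rewrite (exprMn _ (cexp v) (cexp u)) (exprMn _ (cexp (- v)) (cexp (- u))).
rewrite (cexpN v) (cexpN u).
have iv m : cexp v ^+ m * (cexp v)^-1 ^+ m = 1.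
  by rewrite -exprMn divff ?expr1n// cexp_neq0.
have ivl := iv l; have ivn := iv n.
move: (cexp u ^+ l) ((cexp u)^-1 ^+ n) ivl ivn => U U'.
move: (cexp v ^+ l) ((cexp v)^-1 ^+ l) (cexp v ^+ n) ((cexp v)^-1 ^+ n).
move=> V V' W W' VV WW.
transitivity (k * (U * U') * f * ((V * V') * (W * W'))); first by rewrite VV WW !mulr1.
by ring.
Qed.

Lemma cexp_kernel_split (u v p : R[i]) l n : u = p - v ->
  cexp u ^+ l * cexp (- u) ^+ n =
  cexp p ^+ l * cexp (- p) ^+ n * (cexp v ^+ n * cexp (- v) ^+ l).
Proof.
move=> ->; rewrite opprD opprK.
rewrite (cexpD p (- v)) (cexpD (- p) v).
rewrite (exprMn _ (cexp p)) (exprMn _ (cexp (- p))).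
move: (cexp p ^+ l) (cexp (- p) ^+ n) (cexp v ^+ n) (cexp (- v) ^+ l) => ? ? ? ?.
by ring.
Qed.

End complex_exponential.

(** * Means over vertical periods and convolution with a trigonometric kernel *)

Section circular_means.
Variable R : realType.

Lemma pi2_gt0 : 0 < 2 * pi :> R.
Proof. by rewrite mulr_gt0// pi_gt0. Qed.

(** Goursat on the rectangle between the two abscissas and of height 2 pi: the horizontal sides
    cancel by periodicity. *)
Lemma strip_mean (f : R[i] -> R[i]) (A : R) :
  (forall z, `|complex.Re z| < A -> exists d, has_cderiv f z d) ->
  (forall x y, f (x +i* (y + 2 * pi)) = f (x +i* y)) ->
  forall s t, `|s| < A -> `|t| < A ->
  cint (fun y => f (s +i* y)) 0 (2 * pi) = cint (fun y => f (t +i* y)) 0 (2 * pi).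
Proof.
move=> df per.
suff H s t : s <= t -> `|s| < A -> `|t| < A ->
  cint (fun y => f (s +i* y)) 0 (2 * pi) = cint (fun y => f (t +i* y)) 0 (2 * pi).
  move=> s t sA tA; have [st|ts] := leP s t; first exact: H.
  by apply/esym/H => //; exact: ltW.
move=> st sA tA.
have ts0 : 0 <= t - s by rewrite subr_ge0.
have h : forall x y, s <= x <= s + (t - s) -> 0 <= y <= 0 + 2 * pi ->
    exists d, has_cderiv f (x +i* y) d.
  move=> x y xst _; apply: df => /=; move: sA tA xst; rewrite !ltr_norml.
  by move=> /andP[? ?] /andP[? ?] /andP[? ?]; apply/andP; split; lra.
have := goursat_rect ts0 (ltW pi2_gt0) h.
have -> : s + (t - s) = t by ring.
rewrite /rect_integral add0r.
have -> : cint (fun x => f (x +i* 0)) s t = cint (fun x => f (x +i* (2 * pi))) s t.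
  by apply: eq_cint => x _; rewrite -[2 * pi]add0r per.
rewrite subrr add0r => /eqP; rewrite mulf_eq0 => /orP[|].
  by rewrite eq_complex /= oner_eq0 andbF.
by rewrite subr_eq0 => /eqP ->.
Qed.

(** For l != N the mean of exp((l - N) z) is the same on Re z = 0 and Re z = 1 by [strip_mean], yet
    the second is exp(l - N) times the first; hence it is 0, without any antiderivative. *)
Lemma cint_exp_mean (l N : nat) :
  cint (fun y : R => cexp (0 +i* y) ^+ l * cexp (- (0 +i* y)) ^+ N) 0 (2 * pi) =
  if l == N then (2 * pi)%:C else 0.
Proof.
case: eqVneq => [->|lN].
  rewrite (@eq_cint _ _ (fun=> 1)); first by rewrite cint_cst ?mul1r ?subr0// ltW// pi2_gt0.
  by move=> y _; rewrite -exprMn cexpN divff ?expr1n// cexp_neq0.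
pose f z : R[i] := cexp z ^+ l * cexp (- z) ^+ N.
have fE z : f z = cexp ((l%:R - N%:R) * z).
  by rewrite /f mulrBl cexpD cexp_natl -mulrN cexp_natl.
have df z : exists d, has_cderiv f z d.
  exists (cexp ((l%:R - N%:R) * z) * (0 * z + (l%:R - N%:R) * 1)).
  rewrite (_ : f = fun z => cexp ((l%:R - N%:R) * z)); last exact/funext.
  apply: (@has_cderiv_comp R (@cexp R) (fun z => (l%:R - N%:R) * z)).
    by apply: has_cderivM; [exact: has_cderiv_cst|exact: has_cderiv_id].
  exact: has_cderiv_cexp.
have per x y : f (x +i* (y + 2 * pi)) = f (x +i* y).
  by rewrite /f !cexpN cexp_2pi.
have mean := @strip_mean f 2 (fun z _ => df z) per 0 1.
have n0 : `|0 : R| < 2 by rewrite normr0.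
have n1 : `|1 : R| < 2 by rewrite normr1 ltr1n.
have e01 := mean n0 n1.
have fc x : path_cont (fun y => f (x +i* y)) 0 (2 * pi).
  move=> y _; apply: ccont_vline; have [d hd] := df (x +i* y).
  exact: has_cderiv_ccont hd.
have sh : cint (fun y => f (1 +i* y)) 0 (2 * pi) =
    cexp (l%:R - N%:R) * cint (fun y => f (0 +i* y)) 0 (2 * pi).
  rewrite -(cintZ _ (fc 0)); apply: eq_cint => y _; rewrite !fE -cexpD; congr cexp.
  rewrite -[X in _ = X + _]mulr1 -mulrDr; congr (_ * _).
  by apply/eqP; rewrite eq_complex /= add0r addr0 !eqxx.
have := etrans e01 sh; rewrite -/(cint (fun y => f (0 +i* y)) 0 (2 * pi)).
set m := cint _ _ _ => /eqP; rewrite -subr_eq0 -{1}[m]mul1r -mulrBl mulf_eq0.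
case/orP => [|/eqP//].
rewrite subr_eq0 eq_sym => /eqP/(congr1 (@nc R)); rewrite nc_cexp nc1.
rewrite -(rmorph_nat (real_complex R)) -(rmorph_nat (real_complex R) N) -rmorphB /=.
move=> h1; have /expR_inj/eqP := etrans h1 (esym (@expR0 R)).
rewrite subr_eq0 eqr_nat => /eqP e.
by exfalso; move/eqP: lN; apply.
Qed.

Lemma cint_lincomb n (k : 'I_n -> R[i]) (F : 'I_n -> R -> R[i]) a b :
  (forall i, path_cont (F i) a b) ->
  cint (fun y => \sum_(i < n) k i * F i y) a b = \sum_(i < n) k i * cint (F i) a b.
Proof.
move=> Fc; rewrite (@cint_sum _ _ (fun i y => k i * F i y)).
  by apply: eq_bigr => i _; rewrite cintZ.
by move=> i; apply: path_contM (Fc i); exact: path_cont_cst.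
Qed.

(** Compares the mean of (2 + 2 cos)^N, a central binomial coefficient, with its maximum 4^N: only a
    polynomial factor is lost. *)
Lemma central_binomial_ge N : (4 ^ N <= N.*2.+1 * 'C(N.*2, N))%N.
Proof.
elim: N => [|N IH] //.
have h1 : (N.+1 * 'C(N.*2.+2, N.+1) = N.*2.+2 * 'C(N.*2.+1, N))%N.
  by rewrite (mul_bin_diag N.*2.+2 N).
have h2 : (N.+1 * 'C(N.*2.+1, N) = N.*2.+1 * 'C(N.*2, N))%N.
  have := mul_bin_down N.*2.+1 N; rewrite [_.-1]/=.
  by have -> : (N.*2.+1 - N = N.+1)%N by lia.
rewrite doubleS expnS; nia.
Qed.

(** The kernel (2 + 2 cos)^N divided by its mean is an approximate identity. Convolution along the
    vertical line through z yields a Laurent polynomial in exp z, whose coefficients are the same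
    for all lines by [strip_mean]; this makes one polynomial valid on the whole strip. *)
Lemma strip_approx (f : R[i] -> R[i]) (A A' S : R) : 0 <= A' < A ->
  (forall z, `|complex.Re z| < A -> exists d, has_cderiv f z d) ->
  (forall x y, f (x +i* (y + 2 * pi)) = f (x +i* y)) ->
  (forall z, `|complex.Re z| <= A' -> nc (f z) <= S) ->
  (forall e : R, 0 < e -> exists2 r : R, 0 < r & forall s x y, `|s| <= A' ->
    nc (cexp (0 +i* x) - cexp (0 +i* y)) < r -> nc (f (s +i* x) - f (s +i* y)) <= e) ->
  forall e : R, 0 < e -> exists N (b : nat -> R[i]), forall z, `|complex.Re z| <= A' ->
    nc (\sum_(l < N.*2.+1) b l * (cexp z ^+ l * cexp (- z) ^+ N) - f z) <= e.
Proof.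
move=> /andP[A'0 A'A] df per fS unif e e0.
have S0 : 0 <= S by apply: le_trans (fS 0 _); rewrite ?nc_ge0//= normr0.
have [r r0 hr] := unif (e / 4) (divr_gt0 e0 (ltr0Sn _ _)).
(* Where exp(iy) is at distance at least r from exp(ip), 2 + 2 cos is at most 4 - r^2; the maximum
   with 0 covers r > 2. *)
pose Q := Num.max (0 : R) (4 - r ^+ 2).
have Q0 : 0 <= Q by rewrite le_max lexx.
have Q4 : 0 <= Q / 4 < 1.
  rewrite divr_ge0//= ltr_pdivrMr// mul1r gt_max ltr0n/= ltrBlDr ltrDl.
  by rewrite exprn_gt0.
have [N /(_ N (leqnn _)) hN] := natS_mul_expr_small Q4
   (divr_gt0 e0 (mulr_gt0 (ltr0Sn R 15) (ltr_wpDl S0 ltr01))).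
pose C : R := 'C(N.*2, N)%:R.
have C0 : 0 < C by rewrite ltr0n bin_gt0 -addnn leq_addr.
have C4 : 4 ^+ N <= (2 * N.+1%:R) * C.
  rewrite -natrX -!natrM ler_nat; apply: (leq_trans (central_binomial_ge N)).
  by rewrite leq_mul2r orbC -muln2 mulnC mulnS leqW.
have p0 := pi2_gt0.
pose T : R[i] := (2 * pi * C)%:C.
have T0 : T != 0.
  by rewrite -nc_eq0 nc_real gtr0_norm ?gt_eqF// mulr_gt0.
(* What remains of the l-th term once the powers of exp z are pulled out; it is differentiable on
   the strip and periodic, so its mean [c l] may be taken at abscissa 0. *)
pose Psi l z := f z * (cexp (- z) ^+ l * cexp z ^+ N).
pose c l := cint (fun y => Psi l (0 +i* y)) 0 (2 * pi).
exists N, (fun l => 'C(N.*2, l)%:R * c l / T) => -[s p] /= sA'.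
set z := s +i* p.
have sA : `|s| < A by apply: le_lt_trans A'A.
have dcexpX n w : exists d, has_cderiv (fun x => @cexp R x ^+ n) w d.
  elim: n => [|n [d hd]]; first by exists 0; exact: has_cderiv_cst.
  eexists; rewrite (_ : (fun x => _) = (fun x => cexp x * cexp x ^+ n)).
    by apply: has_cderivM; [exact: has_cderiv_cexp|exact: hd].
  by apply/funext => x; rewrite exprS.
have dcexpNX n w : exists d, has_cderiv (fun x => @cexp R (- x) ^+ n) w d.
  have [d hd] := dcexpX n (- w).
  exists (d * (-1)).
  exact: (@has_cderiv_comp R (fun x => cexp x ^+ n) (fun x => - x)) (has_cderiv_opp w) hd.
have dPsi l w : `|complex.Re w| < A -> exists d, has_cderiv (Psi l) w d.
  move=> wA; have [d1 h1] := df w wA; have [d2 h2] := dcexpNX l w.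
  have [d3 h3] := dcexpX N w.
  by eexists; apply: has_cderivM h1 (has_cderivM h2 h3).
have perPsi l x y : Psi l (x +i* (y + 2 * pi)) = Psi l (x +i* y).
  by rewrite /Psi !cexpN !cexp_2pi per.
have cE l : c l = cint (fun y => Psi l (s +i* y)) 0 (2 * pi).
  apply: (strip_mean (dPsi l) (perPsi l)) => //.
  by rewrite normr0 (le_lt_trans A'0).
have Psic l : path_cont (fun y => Psi l (s +i* y)) 0 (2 * pi).
  move=> y _; apply: ccont_vline; have [d hd] := dPsi l (s +i* y) sA.
  exact: has_cderiv_ccont hd.
pose u (y : R) : R[i] := 0 +i* (p - y).
pose Kc y : R[i] := \sum_(l < N.*2.+1) 'C(N.*2, l)%:R * (cexp (u y) ^+ l * cexp (- u y) ^+ N).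
pose K y : R := (2 + 2 * cos (p - y)) ^+ N.
have KcE y : Kc y = (K y)%:C.
  rewrite /Kc; under eq_bigr do rewrite mulrA.
  rewrite -mulr_suml.
  have -> : \sum_(l < N.*2.+1) 'C(N.*2, l)%:R * cexp (u y) ^+ l = (1 + cexp (u y)) ^+ N.*2.
    rewrite exprDn; apply: eq_bigr => l _.
    by rewrite expr1n mul1r mulr_natl.
  rewrite -muln2 mulnC exprM -exprMn /K rmorphXn /=; congr (_ ^+ _).
  have -> : (1 + cexp (u y)) ^+ 2 * cexp (- u y) = 2 + cexp (u y) + cexp (- u y).
    rewrite cexpN; have := cexp_neq0 (u y); move: (cexp _) => U U0.
    by field.
  have -> : - u y = 0 +i* (- (p - y)).
      by apply/eqP; rewrite eq_complex /= oppr0 !eqxx.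
    rewrite /u !cexp_imag cosN sinN.
  by apply/eqP; rewrite eq_complex /=; apply/andP; split; apply/eqP; ring.
have zE y : z = s +i* y + u y.
  by apply/eqP; rewrite eq_complex /= addr0 eqxx /=; apply/eqP; ring.
have term l y : 'C(N.*2, l)%:R * (cexp (u y) ^+ l * cexp (- u y) ^+ N) * f (s +i* y) =
   ('C(N.*2, l)%:R * (cexp z ^+ l * cexp (- z) ^+ N)) * Psi l (s +i* y).
  exact: cexp_kernel_factor (zE y).
have Kcc : path_cont Kc 0 (2 * pi).
  apply: path_cont_sum => l; apply: path_contM; first exact: path_cont_cst.
  pose g w : R[i] := cexp ((0 +i* p) + - w) ^+ l * cexp (- ((0 +i* p) + - w)) ^+ N.
  have -> : (fun y => cexp (u y) ^+ l * cexp (- u y) ^+ N) = (fun y : R => g (0 +i* y)).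
    apply/funext => y; rewrite /g; congr (cexp _ ^+ _ * cexp (- _) ^+ _);
      by apply/eqP; rewrite eq_complex /= subrr !eqxx.
  move=> y _; apply: (@ccont_vline R g 0 y).
  have dsub w : has_cderiv (fun w => (0 +i* p) + - w) w (0 + -1).
    by apply: has_cderivD; [exact: has_cderiv_cst|exact: has_cderiv_opp].
  have [d1 h1] := dcexpX l ((0 +i* p) + - (0 +i* y)).
  have [d2 h2] := dcexpNX N ((0 +i* p) + - (0 +i* y)).
  apply: has_cderiv_ccont; apply: has_cderivM.
    exact: (@has_cderiv_comp R (fun x => cexp x ^+ l)) (dsub _) h1.
  exact: (@has_cderiv_comp R (fun x => cexp (- x) ^+ N)) (dsub _) h2.
have fcs : path_cont (fun y => f (s +i* y)) 0 (2 * pi).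
  move=> y _; apply: ccont_vline; have [d hd] := df (s +i* y) sA.
  exact: has_cderiv_ccont hd.
have sumE : \sum_(l < N.*2.+1) ('C(N.*2, l)%:R * c l / T) * (cexp z ^+ l * cexp (- z) ^+ N) =
    cint (fun y => Kc y * f (s +i* y)) 0 (2 * pi) / T.
  have -> : cint (fun y => Kc y * f (s +i* y)) 0 (2 * pi) = \sum_(l < N.*2.+1)
     ('C(N.*2, l)%:R * (cexp z ^+ l * cexp (- z) ^+ N)) * c l.
    transitivity (cint (fun y => \sum_(l < N.*2.+1)
       ('C(N.*2, l)%:R * (cexp z ^+ l * cexp (- z) ^+ N)) * Psi l (s +i* y)) 0 (2 * pi)).
      apply: eq_cint => y _; rewrite /Kc mulr_suml.
      by apply: eq_bigr => l _; exact: term.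
    rewrite (cint_lincomb (fun l : 'I_(N.*2.+1) => 'C(N.*2, l)%:R * (cexp z ^+ l * cexp (- z) ^+ N))
      (fun l : 'I_(N.*2.+1) => Psic l)).
    by apply: eq_bigr => l _; rewrite -cE.
  rewrite mulr_suml; apply: eq_bigr => l _.
  by move: (c l) (T^-1) (cexp z ^+ l) (cexp (- z) ^+ N) => cl Ti U V; ring.
have Kmean : cint Kc 0 (2 * pi) = T.
  have part (l : nat) : path_cont (fun y : R => cexp (0 +i* y) ^+ N * cexp (- (0 +i* y)) ^+ l) 0 (2 * pi).
    move=> y _; apply: (@ccont_vline R (fun w => cexp w ^+ N * cexp (- w) ^+ l) 0 y).
    have [d1 h1] := dcexpX N (0 +i* y); have [d2 h2] := dcexpNX l (0 +i* y).
    by apply: has_cderiv_ccont; apply: has_cderivM; [exact: h1|exact: h2].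
  transitivity (cint (fun y : R => \sum_(l < N.*2.+1)
     ('C(N.*2, l)%:R * (cexp (0 +i* p) ^+ l * cexp (- (0 +i* p)) ^+ N)) *
     (cexp (0 +i* y) ^+ N * cexp (- (0 +i* y)) ^+ l)) 0 (2 * pi)).
    apply: eq_cint => y _; apply: eq_bigr => l _; rewrite -!mulrA; congr (_ * _).
    rewrite mulrA; apply: cexp_kernel_split.
    by apply/eqP; rewrite eq_complex /= subrr !eqxx.
  rewrite (cint_lincomb (fun l : 'I_(N.*2.+1) => 'C(N.*2, l)%:R *
     (cexp (0 +i* p) ^+ l * cexp (- (0 +i* p)) ^+ N)) (fun l : 'I_(N.*2.+1) => part l)).
  rewrite (eq_bigr (fun l : 'I_(N.*2.+1) => ('C(N.*2, l)%:R *
     (cexp (0 +i* p) ^+ l * cexp (- (0 +i* p)) ^+ N)) *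
     (if N == l then (2 * pi)%:C else 0))); last first.
    by move=> l _; rewrite cint_exp_mean.
  have NN : (N < N.*2.+1)%N by rewrite ltnS -addnn leq_addr.
  rewrite (bigD1 (Ordinal NN)) //= eqxx big1 ?addr0; last first.
    by move=> l; rewrite -val_eqE /= eq_sym => /negbTE ->; rewrite mulr0.
  rewrite -exprMn cexpN divff ?cexp_neq0// expr1n mulr1.
  by rewrite /T /C [RHS]rmorphM rmorph_nat mulrC.
have -> : \sum_(l < N.*2.+1) ('C(N.*2, l)%:R * c l / T) * (cexp z ^+ l * cexp (- z) ^+ N) - f z =
   cint (fun y => Kc y * (f (s +i* y) - f z)) 0 (2 * pi) / T.
  rewrite sumE.
  have -> : cint (fun y => Kc y * (f (s +i* y) - f z)) 0 (2 * pi) =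
      cint (fun y => Kc y * f (s +i* y)) 0 (2 * pi) + (- f z) * cint Kc 0 (2 * pi).
    rewrite -(cintZ _ Kcc) -cintD; last first.
    - exact: (path_contM (@path_cont_cst R (- f z) _ _) Kcc).
    - exact: (path_contM Kcc fcs).
    apply: eq_cint => y _; move: (Kc y) (f (s +i* y)) (f z) => k1 k2 k3; ring.
  rewrite Kmean; move: (cint _ _ _) (f z) => I fz.
  by rewrite [RHS]mulrDl mulNr [in RHS]mulNr (mulfK T0).
have PC : 0 < 2 * pi * C by rewrite mulr_gt0.
have ncT : nc T = 2 * pi * C by rewrite nc_real gtr0_norm.
rewrite (ncM _ T^-1) ncV ncT ler_pdivrMr//.
(* The first summand covers points near p by uniform continuity, the second those far away by the
   bound Q^N on the kernel. *)
pose h y : R := e / 4 * complex.Re (Kc y) + 2 * S * Q ^+ N.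
have hc y : 0 <= y <= 2 * pi -> {for y, continuous h}.
  move=> yI; apply: cvgD; last exact: cvg_cst.
  apply: cvgM; first exact: cvg_cst.
  exact: (path_cont_Re Kcc).
have Kge0 y : 0 <= K y.
  by rewrite exprn_ge0//; have := cos_geN1 (p - y); lra.
have pw y : 0 <= y <= 2 * pi -> nc (Kc y * (f (s +i* y) - f z)) <= h y.
  move=> _; rewrite ncM /h KcE nc_real (ger0_norm (Kge0 y)) /=.
  have [near|far] := ltP (nc (cexp (0 +i* y) - cexp (0 +i* p))) r.
    have := hr s y p sA' near; rewrite -/z => fe.
    apply: (@le_trans _ _ (e / 4 * K y)); first by rewrite mulrC ler_wpM2r.
    by rewrite lerDl !mulr_ge0 ?exprn_ge0.
  have KQ : K y <= Q ^+ N.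
    have b0 : 0 <= 2 + 2 * cos (p - y) by have := cos_geN1 (p - y); lra.
    rewrite /K lerXn2r ?nnegrE//.
    rewrite le_max; apply/orP; right.
    have : r ^+ 2 <= 2 - 2 * cos (p - y).
      have -> : 2 - 2 * cos (p - y) = nc (cexp (0 +i* y) - cexp (0 +i* p)) ^+ 2.
        rewrite sqr_nc !cexp_imag /= cosB.
        have := cos2Dsin2 y; have := cos2Dsin2 p.
        by move: (cos y) (sin y) (cos p) (sin p) => a b a' b' h1 h2; nra.
      by rewrite lerXn2r ?nnegrE ?nc_ge0// ltW.
    by lra.
  have f2 : nc (f (s +i* y) - f z) <= 2 * S.
    apply: (le_trans (ncB _ _)); have := fS (s +i* y) sA'; have := fS z sA'.
    by lra.
  apply: (@le_trans _ _ (2 * S * Q ^+ N)).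
    by rewrite [leRHS]mulrC ler_pM ?nc_ge0.
  by rewrite lerDr !mulr_ge0 ?divr_ge0// ltW.
have dc : path_cont (fun y => Kc y * (f (s +i* y) - f z)) 0 (2 * pi).
  exact: (path_contM Kcc (path_contD fcs (@path_cont_cst R (- f z) _ _))).
apply: (le_trans (nc_cint_le dc hc pw)).
have intK : \int[lebesgue_measure]_(y in `[0, 2 * pi]) complex.Re (Kc y) = 2 * pi * C.
  by have := congr1 (@complex.Re R) Kmean.
have KRi := integrable_Re Kcc.
rewrite RintegralD//; last first.
- by apply: continuous_itv_integrable => y _; exact: cvg_cst.
- exact: (integrableZl _ (e / 4) KRi).
rewrite RintegralZl// intK Rintegral_cst_itv ?(ltW p0)// subr0.
have key : 4 * S * Q ^+ N <= e / 2 * C.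
  have Q1 : Q ^+ N = 4 ^+ N * (Q / 4) ^+ N by rewrite -exprMn; congr (_ ^+ _); field.
  apply: (@le_trans _ _ (4 * S * ((2 * N.+1%:R * C) * (Q / 4) ^+ N))).
    by rewrite Q1 ler_wpM2l ?mulr_ge0// ler_wpM2r// exprn_ge0//; case/andP: Q4.
  have -> : 4 * S * ((2 * N.+1%:R * C) * (Q / 4) ^+ N) = 8 * S * (N.+1%:R * (Q / 4) ^+ N) * C by ring.
  rewrite ler_wpM2r ?(ltW C0)//.
  apply: (@le_trans _ _ (8 * S * (e / (16 * (S + 1))))).
    by rewrite ler_wpM2l ?mulr_ge0// ltW.
  rewrite mulrA ler_pdivrMr; last by rewrite mulr_gt0// ltr_wpDl.
  have : S * e <= (S + 1) * e by rewrite ler_wpM2r ?(ltW e0)// lerDl.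
  by lra.
have -> : e * (2 * pi * C) = 2 * (e / 4 * (2 * pi * C)) + (e / 2 * C) * (2 * pi) by field.
rewrite mulrDr lerD2l; apply: (@le_trans _ _ ((4 * S * Q ^+ N) * (2 * pi))); last first.
  by rewrite ler_wpM2r ?(ltW p0).
by rewrite le_eqVlt; apply/orP; left; apply/eqP; ring.
Qed.

End circular_means.

(** * Compactness, logarithm and ellipses *)

Section complex_compactness.
Variable R : realType.

Lemma cvg_complex (T : Type) (F : set_system T) (FF : Filter F) (u v : T -> R) (x y : R) :
  u @ F --> x -> v @ F --> y -> (fun t => u t +i* v t : Cplx R) @ F --> (x +i* y : Cplx R).
Proof.
move=> /cvgrPdist_lt ux /cvgrPdist_lt vy; apply/cvg_ncP => e e0.
have e2 : 0 < e / 2 by rewrite divr_gt0.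
near=> t.
apply: (le_lt_trans (nc_le_ReIm _)); rewrite /= [e]splitr distrC [`|_ - y|]distrC.
by apply: ltrD; near: t; [exact: ux|exact: vy].
Unshelve. all: by end_near. Qed.

Lemma compact_square (M : R) :
  compact ([set z | `|complex.Re z| <= M /\ `|complex.Im z| <= M] : set (Cplx R)).
Proof.
pose f (p : R * R) : Cplx R := p.1 +i* p.2.
have -> : [set z | `|complex.Re z| <= M /\ `|complex.Im z| <= M] =
    f @` (`[- M, M] `*` `[- M, M]).
  apply/seteqP; split=> [[a b] /= [h1 h2]|_ [[a b] /= [h1 h2] <-]].
    by exists (a, b) => //=; rewrite !in_itv /= -!ler_norml.
  by rewrite /f /= !ler_norml; move: h1 h2; rewrite !in_itv.
apply: continuous_compact; last first.
  by apply: compact_setX; exact: segment_compact.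
apply: continuous_subspaceT => -[a b].
by apply: cvg_complex; [exact: cvg_fst|exact: cvg_snd].
Qed.

Lemma closed_bounded_compact (K : set (Cplx R)) (M : R) :
  closed K -> (forall z, K z -> nc z <= M) -> compact K.
Proof.
move=> cK KM; apply: (subclosed_compact cK (@compact_square M)) => z Kz.
by split; apply: le_trans (KM z Kz); [exact: Re_le_nc|exact: Im_le_nc].
Qed.

(** Only x has to lie in K, because [ccont] refers to full neighbourhoods of the points of K. *)
Lemma compact_unif_cont (K : set (Cplx R)) (f : R[i] -> R[i]) :
  compact K -> (forall z, K z -> ccont f z) -> forall e : R, 0 < e ->
  exists2 r : R, 0 < r & forall x y, K x -> nc (y - x) < r -> nc (f y - f x) < e.
Proof.
move=> /compact_near_coveringP cK fc e e0.
pose P (r : R) (x : Cplx R) := forall y, nc (y - x) < r -> nc (f y - f x) < e.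
have hn : \forall r \near 0^'+, K `<=` P r.
  apply: cK => x Kx.
  have [r r0 hr] := fc x Kx (e / 2) (divr_gt0 e0 (ltr0Sn _ _)).
  have r2 : 0 < r / 2 by rewrite divr_gt0.
  exists ([set x' | nc (x' - x) < r / 2], [set s | s < r / 2]).
    split; first by apply/nbhs_ncP; exists (r / 2).
    exact: nbhs_right_lt.
  move=> [x' s] [/= xx' sr] y yx'.
  have h1 : nc (x' - x) < r by apply: (lt_trans xx'); lra.
  have h2 : nc (y - x) < r.
    by have := nc_dist_triangle y x x'; lra.
  have := hr (x' - x) h1; have := hr (y - x) h2.
  rewrite ![x + (_ - x)]addrCA !subrr !addr0 => g1 g2.
  have := nc_dist_triangle (f y) (f x') (f x); rewrite [nc (f x - _)]ncBC; lra.
have [r [r0 hr]] : exists r : R, 0 < r /\ (K `<=` P r).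
  near ((0 : R)^'+) => r; exists r; split; first by [].
  by near: r.
by exists r => // x y Kx; exact: hr.
Unshelve. all: by end_near. Qed.

Lemma compact_nc_bounded (K : set (Cplx R)) (f : R[i] -> R[i]) :
  compact K -> (forall z, K z -> ccont f z) -> exists S : R, forall z, K z -> nc (f z) <= S.
Proof.
move=> /compact_near_coveringP cK fc.
pose P (n : nat) (x : Cplx R) := nc (f x) <= n%:R.
have : \forall n \near \oo, K `<=` P n.
  apply: cK => x Kx.
  have [r r0 hr] := fc x Kx 1 ltr01.
  exists ([set x' | nc (x' - x) < r], [set n | nc (f x) + 1 <= n%:R]).
    split; first by apply/nbhs_ncP; exists r.
    exact: nbhs_infty_ger.
  move=> [x' n] [/= xx' nn]; rewrite /P; apply: le_trans nn.
  have := hr (x' - x) xx'; rewrite [x + (_ - x)]addrCA subrr addr0 => g.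
  by have := lerB_nc (f x') (f x); lra.
by move=> [n _ hn]; exists n%:R => z Kz; exact: (hn n (leqnn n) z Kz).
Qed.

Lemma continuous_nc_sub (p : R[i]) : continuous ((fun z => nc (z - p)) : Cplx R -> R).
Proof.
move=> z U /nbhs_ballP[e e0 he]; apply/nbhs_ncP; exists e => // y yz.
apply: he; rewrite /ball /=; apply: le_lt_trans yz; rewrite ler_norml; apply/andP; split.
  have := lerB_nc (y - p) (z - p); have -> : y - p - (z - p) = y - z by ring.
  by lra.
have := lerB_nc (z - p) (y - p); have -> : z - p - (y - p) = z - y by ring.
by rewrite (ncBC z y).
Qed.

End complex_compactness.

(** * Principal logarithm and real powers on the right half-plane *)

Section complex_logarithm.
Variable R : realType.
Implicit Types z w : R[i].

Lemma ReD z w : complex.Re (z + w) = complex.Re z + complex.Re w.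
Proof. by case: z; case: w. Qed.

Lemma cexp_clog z : z != 0 -> cexp (clog z) = z :> R[i].
Proof.
move=> z0; have n0 : 0 < nc z by rewrite nc_gt0.
have zre : -1 <= complex.Re z / nc z <= 1.
  by rewrite -ler_norml normrM normfV (gtr0_norm n0) ler_pdivrMr// mul1r Re_le_nc.
rewrite /clog cexpE -[complex.Re `|z|]/(nc z).
rewrite lnK ?posrE//.
have c1 : cos (carg z) = complex.Re z / nc z.
  rewrite /carg; rewrite -[complex.Re `|z|]/(nc z).
  by case: ifP => _; rewrite ?cosN acosK// in_itv.
have s1 : sin (carg z) = complex.Im z / nc z.
  have sa : sin (acos (complex.Re z / nc z)) = `|complex.Im z| / nc z.
    rewrite sin_acos//.
    have -> : 1 - (complex.Re z / nc z) ^+ 2 = (complex.Im z / nc z) ^+ 2.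
      rewrite !expr_div_n; have := sqr_nc z => h.
      have n2 : nc z ^+ 2 != 0 by rewrite expf_neq0// gt_eqF.
      by apply: (mulIf n2); rewrite mulrBl !divfK// mul1r h; ring.
    by rewrite sqrtr_sqr normrM normfV (gtr0_norm n0).
  rewrite /carg; rewrite -[complex.Re `|z|]/(nc z).
  case: ifPn => [h|]; first by rewrite sa ger0_norm.
  by rewrite -ltNge => h; rewrite sinN sa ltr0_norm// mulNr opprK.
rewrite c1 s1; case: z z0 n0 {zre c1 s1} => a b z0 n0.
rewrite [complex.Re _]/= [complex.Im _]/=.
move: (nc _) n0 => N n0.
by apply/eqP; rewrite eq_complex /=; apply/andP; split; apply/eqP; field; rewrite gt_eqF.
Qed.

Lemma Re_clog z : complex.Re (clog z) = ln (nc z).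
Proof. by []. Qed.

(** The definition of [carg] switches sign across the real axis; the arctangent form shows that
    nothing jumps there. *)
Lemma carg_atan z : 0 < complex.Re z -> carg z = atan (complex.Im z / complex.Re z).
Proof.
move=> x0; have n0 : 0 < nc z.
  by rewrite nc_gt0; apply: contraTneq x0 => ->; rewrite ltxx.
rewrite /carg; rewrite -[complex.Re `|z|]/(nc z).
set t := atan _.
have ct : cos t = complex.Re z / nc z.
  rewrite cos_atan ncE.
  have -> : 1 + (complex.Im z / complex.Re z) ^+ 2 =
     (complex.Re z ^+ 2 + complex.Im z ^+ 2) / complex.Re z ^+ 2.
    by rewrite expr_div_n; field; rewrite gt_eqF.
  by rewrite sqrtrM ?addr_ge0 ?sqr_ge0// sqrtrV ?sqr_ge0// sqrtr_sqr gtr0_norm// invfM invrK mulrC.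
have h1 := atan_gtNpi2 (complex.Im z / complex.Re z).
have h2 := atan_ltpi2 (complex.Im z / complex.Re z).
have pp := pi_gt0 R.
case: ifPn => [y0|]; rewrite -ct.
  rewrite cosK// in_itv /=.
  have -> : 0 <= t by rewrite -atan0 le_atan// divr_ge0// ltW.
  by rewrite /=; apply: (le_trans (ltW h2)); lra.
rewrite -ltNge => y0.
rewrite -cosN cosK ?opprK// in_itv /= oppr_ge0.
have -> : t <= 0 by rewrite -atan0 le_atan// pmulr_lle0 ?invr_gt0// ltW.
by rewrite /= lerNl; apply: le_trans (ltW h1); lra.
Qed.

Lemma continuous_clog z : 0 < complex.Re z -> ccont (@clog R) z.
Proof.
move=> x0 e e0.
have n0 : 0 < nc z.
  by rewrite nc_gt0; apply: contraTneq x0 => ->; rewrite ltxx.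
have cre : (fun y : Cplx R => complex.Re (clog y)) @ (z : Cplx R) --> ln (nc z).
  have cn : (fun y : Cplx R => nc y) @ (z : Cplx R) --> nc z.
    have := @continuous_nc_sub R 0 z.
    have -> : (fun y : Cplx R => nc (y - 0)) = (fun y : Cplx R => nc y).
      by apply/funext => y; rewrite subr0.
    by [].
  exact: (cvg_comp _ _ cn (continuous_ln n0)).
have cim : (fun y : Cplx R => atan (complex.Im y / complex.Re y)) @ (z : Cplx R) -->
    atan (complex.Im z / complex.Re z).
  have cq : (fun y : Cplx R => complex.Im y / complex.Re y) @ (z : Cplx R) -->
      complex.Im z / complex.Re z.
    have ci : (fun y : Cplx R => complex.Im y) @ (z : Cplx R) --> complex.Im z.
      exact: continuous_Im.
    have cr : (fun y : Cplx R => complex.Re y) @ (z : Cplx R) --> complex.Re z.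
      exact: continuous_Re.
    have rn0 : complex.Re z != 0 by rewrite gt_eqF.
    exact: (cvgM ci (cvgV rn0 cr)).
  exact: (cvg_comp _ _ cq (@continuous_atan R _)).
have := cvg_complex (nbhs_filter (z : Cplx R)) cre cim => /cvg_ncP/(_ e e0)/nbhs_ncP[r r0 hr].
exists (Num.min r (complex.Re z)); first by rewrite lt_min r0.
move=> h; rewrite lt_min => /andP[h1 h2].
have zh : 0 < complex.Re (z + h).
  have := Re_le_nc h; rewrite ler_norml => /andP[h3 _].
  by move: h2 h3; rewrite ReD; lra.
have := hr (z + h); rewrite [z + h - z]addrAC subrr add0r => /(_ h1).
by rewrite -(carg_atan zh) -(carg_atan x0).
Qed.

(** Inverse function argument: k = clog(z + h) - clog z is small by continuity and satisfies exp k =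
    1 + h/z, so the expansion of exp at 0 compares k with h/z. The bound d <= 1/2 gives |k| <= 2
    |h/z|. *)
Lemma has_cderiv_clog z : 0 < complex.Re z -> has_cderiv (@clog R) z z^-1.
Proof.
move=> x0 e e0.
have z0 : z != 0 by apply: contraTneq x0 => ->; rewrite ltxx.
have n0 : 0 < nc z by rewrite nc_gt0.
pose d := Num.min 2^-1 (e * nc z / 2).
have d0 : 0 < d by rewrite lt_min invr_gt0 ltr0n !mulr_gt0// invr_gt0.
have d2 : d <= 2^-1 by rewrite ge_min lexx.
have d3 : d <= e * nc z / 2 by rewrite ge_min lexx orbT.
have [r r0 hr] := has_cderiv_cexp0 d0.
have [s s0 hs] := continuous_clog x0 r0.
exists (Num.min s (complex.Re z)); first by rewrite lt_min s0.
move=> h; rewrite lt_min => /andP[h1 h2].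
pose k := clog (z + h) - clog z.
have kr : nc k < r := hs h h1.
have zh : z + h != 0.
  have : 0 < complex.Re (z + h).
    have := Re_le_nc h; rewrite ler_norml => /andP[h3 _].
    by move: h2 h3; rewrite ReD; lra.
  by move=> p; apply: contraTneq p => ->; rewrite ltxx.
have ek : cexp k = 1 + h / z.
  rewrite /k cexpD cexpN !cexp_clog//; field; exact: z0.
have := hr k kr; rewrite add0r cexp0 mul1r ek [1 + _ - 1]addrAC subrr add0r => H.
have kle : nc k <= 2 * nc (h / z).
  have := lerB_nc k (h / z); rewrite ncBC => H2.
  have : d * nc k <= 2^-1 * nc k by rewrite ler_wpM2r// nc_ge0.
  by lra.
have -> : clog (z + h) - clog z - z^-1 * h = k - h / z by rewrite /k; ring.
rewrite ncBC; apply: (le_trans H).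
apply: (@le_trans _ _ (d * (2 * nc (h / z)))); first by rewrite ler_wpM2l// ltW.
rewrite ncM ncV; apply: (@le_trans _ _ ((e * nc z / 2) * (2 * (nc h / nc z)))).
  by rewrite ler_wpM2r// mulr_ge0// divr_ge0// nc_ge0.
by rewrite le_eqVlt; apply/orP; left; apply/eqP; field; rewrite gt_eqF.
Qed.

Lemma cpowD z (a b : R) : cpow z (a + b) = cpow z a * cpow z b.
Proof. by rewrite /cpow rmorphD mulrDl cexpD. Qed.

Lemma cpow_nat z n : z != 0 -> cpow z (n%:R : R) = z ^+ n.
Proof. by move=> z0; rewrite /cpow rmorph_nat cexp_natl cexp_clog. Qed.

Lemma nc_cpow z (a : R) : nc (cpow z a) = expR (a * ln (nc z)).
Proof.
rewrite /cpow nc_cexp; congr expR.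
have -> : complex.Re (a%:C * clog z) = a * complex.Re (clog z).
  by case: (clog z) => p q /=; rewrite mul0r subr0.
by rewrite Re_clog.
Qed.

Lemma has_cderiv_cpow z (a : R) : 0 < complex.Re z ->
  exists d, has_cderiv (fun w => cpow w a) z d.
Proof.
move=> x0; eexists.
apply: (@has_cderiv_comp R (@cexp R) (fun w => a%:C * clog w)).
  by apply: has_cderivM; [exact: has_cderiv_cst|exact: has_cderiv_clog].
exact: has_cderiv_cexp.
Qed.

End complex_logarithm.

(** * Convex sets and ellipses *)

Section convex_sets.
Variable R : realType.

Definition cconvex (G : set (Cplx R)) := forall (z w : R[i]) (s : R), G z -> G w ->
  0 <= s <= 1 -> G ((1 - s)%:C * z + s%:C * w).

Lemma continuous_real_complex : continuous ((fun t : R => t%:C) : R -> Cplx R).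
Proof. by move=> t; apply: cvg_complex; [exact: cvg_id|exact: cvg_cst]. Qed.

Lemma cconvex_connected (G : set (Cplx R)) : cconvex G -> connected G.
Proof.
move=> cG.
have [[a Ga]|] := pselect (G !=set0); last first.
  by move=> /set0P/negP; rewrite negbK => /eqP ->; exact: connected0.
pose seg (z : Cplx R) : set (Cplx R) :=
  (fun s : R => ((1 - s)%:C * a + s%:C * z : Cplx R)) @` `[0, 1].
have -> : G = \bigcup_(z in G) seg z.
  apply/seteqP; split=> [z Gz|z [w Gw] [s /=]].
    exists z => //; exists 1 => /=; first by rewrite in_itv /= ler01 lexx.
    by rewrite subrr mul0r add0r mul1r.
  by rewrite in_itv /= => s01 <-; exact: cG.
apply: bigcup_connected.
  exists a => z Gz; exists 0 => /=; first by rewrite in_itv /= ler01 lexx.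
  by rewrite subr0 mul1r mul0r addr0.
move=> z Gz; apply: connected_continuous_connected; first exact: segment_connected.
apply: continuous_subspaceT => s.
have cr : (fun t : R => t%:C : Cplx R) @ s --> (s%:C : Cplx R) := @continuous_real_complex s.
have cr1 : (fun t : R => (1 - t)%:C : Cplx R) @ s --> ((1 - s)%:C : Cplx R).
  apply: (cvg_comp (fun t : R => 1 - t) (fun t : R => t%:C : Cplx R)); last exact: continuous_real_complex.
  by apply: cvgB; [exact: cvg_cst|exact: cvg_id].
have ck (k : Cplx R) : (fun _ : R => k) @ s --> k by exact: cvg_cst.
exact: (cvgD (cvgM cr1 (ck a)) (cvgM cr (ck z))).
Qed.

(** Straight-line contraction to the base point [g 0]; the endpoints stay fixed because
    [g 0 = g 1]. *)
Lemma cconvex_simply_connected (G : set (Cplx R)) : cconvex G -> simply_connected G.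
Proof.
move=> cG g gc gG g01.
have z01 : (0 : R) \in `[0, 1] by rewrite in_itv /= lexx ler01.
exists (fun p => (1 - p.2)%:C * g p.1 + p.2%:C * g 0); split.
- apply/subspace_continuousP => -[t s] [/= tI sI].
  have g1 : (fun p : R * R => g p.1) @ within (`[0, 1] `*` `[0, 1]) (nbhs (t, s)) --> g t.
    have /subspace_continuousP/(_ t tI) gt := gc.
    move=> U gU; have gU' : nbhs t (fun x => `[0, 1]%classic x -> U (g x)) := gt U gU.
    exists ((fun x => `[0, 1]%classic x -> U (g x)), setT).
      by split=> //; exact: filterT.
    by move=> [t' s'] [/= h _] [h1 h2]; exact: h.
  have s1 (h : R -> Cplx R) : {for s, continuous h} ->
      (fun p : R * R => h p.2) @ within (`[0, 1] `*` `[0, 1]) (nbhs (t, s)) --> h s.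
    move=> hc; apply: cvg_within_filter.
    exact: (cvg_comp _ _ (@cvg_snd _ _ (nbhs t) (nbhs s) _) hc).
  have c1 : {for s, continuous ((fun x : R => (1 - x)%:C) : R -> Cplx R)}.
    apply: (cvg_comp (fun t : R => 1 - t) (fun t : R => t%:C : Cplx R)); last exact: continuous_real_complex.
    by apply: cvgB; [exact: cvg_cst|exact: cvg_id].
  have c2 : {for s, continuous ((fun x : R => x%:C) : R -> Cplx R)}.
    exact: continuous_real_complex.
  have ck : (fun p : R * R => g 0) @ within (`[0, 1] `*` `[0, 1]) (nbhs (t, s)) --> g 0.
    exact: cvg_cst.
  exact: (cvgD (cvgM (s1 _ c1) g1) (cvgM (s1 _ c2) ck)).
- move=> t s tI; rewrite in_itv /= => sI; apply: cG => //; first exact: gG.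
  exact: gG.
- by move=> t tI /=; rewrite subr0 mul1r mul0r addr0.
- by move=> t tI /=; rewrite subrr mul0r add0r mul1r.
- move=> s sI /=; rewrite -g01 -mulrDl -rmorphD /= subrK mul1r; split=> //.
Qed.

Lemma bounded_set_nc (G : set (Cplx R)) (M : R) :
  (forall z, G z -> nc z <= M) -> bounded_set G.
Proof.
move=> GM; exists M%:C; split.
  by rewrite realE !lecE /= eqxx /= le_total.
move=> x Mx z Gz; apply: le_trans (ltW Mx).
by rewrite norm_nc lecR; exact: GM.
Qed.

Definition ellipse (p q : R[i]) (L : R) : set (Cplx R) :=
  [set z | nc (z - p) + nc (z - q) < L].

Lemma ellipse_convex p q L : cconvex (ellipse p q L).
Proof.
move=> z w s; rewrite /ellipse /= => hz hw /andP[s0 s1].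
have s1' : 0 <= 1 - s by rewrite subr_ge0.
have H u : nc ((1 - s)%:C * z + s%:C * w - u) <= (1 - s) * nc (z - u) + s * nc (w - u).
  have -> : (1 - s)%:C * z + s%:C * w - u = (1 - s)%:C * (z - u) + s%:C * (w - u).
    by rewrite rmorphB /= rmorph1; ring.
  by apply: (le_trans (ncD _ _)); rewrite !ncM !nc_real !ger0_norm.
have := lerD (H p) (H q) => /le_lt_trans; apply.
have [->|sn0] := eqVneq s 0; first by rewrite subr0 !mul1r !mul0r !addr0.
have sp : 0 < s by rewrite lt_def sn0.
have h1 : s * (nc (w - p) + nc (w - q)) < s * L by rewrite ltr_pM2l.
have h2 : (1 - s) * (nc (z - p) + nc (z - q)) <= (1 - s) * L by rewrite ler_wpM2l// ltW.
by lra.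
Qed.

Lemma ellipse_open p q L : open (ellipse p q L).
Proof.
rewrite openE => z; rewrite /ellipse /= => hz; apply/nbhs_ncP.
exists ((L - (nc (z - p) + nc (z - q))) / 2); first by rewrite divr_gt0// subr_gt0.
move=> y yz; have := nc_dist_triangle y p z; have := nc_dist_triangle y q z.
by move=> h1 h2 /=; lra.
Qed.

Lemma closed_ellipse_compact p q L :
  compact ([set z | nc (z - p) + nc (z - q) <= L] : set (Cplx R)).
Proof.
apply: (@closed_bounded_compact R _ (L + nc p)); last first.
  move=> z /= h; have := lerB_nc z p; have := nc_ge0 (z - q); lra.
rewrite -[X in closed X]/((fun z => nc (z - p) + nc (z - q)) @^-1` [set x | x <= L]).
apply: preimage_closed; last exact: closed_le.
move=> z _; exact: (cvgD (@continuous_nc_sub R p z) (@continuous_nc_sub R q z)).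
Qed.

End convex_sets.

(** * The Joukowski map and symmetric Laurent polynomials *)

Section joukowski.
Variables (R : realType) (rho c : R).
Hypotheses (rho0 : 0 < rho) (rho1 : rho < 1) (c0 : 0 < c).

Definition jouk (w : R[i]) : R[i] := c%:C * (1 + rho%:C * w) * (1 + rho%:C / w).

Lemma joukV w : jouk w^-1 = jouk w.
Proof. by rewrite /jouk invrK mulrAC. Qed.

Lemma jouk_focus1 w : w != 0 ->
  jouk w - (c * (1 - rho) ^+ 2)%:C = (c * rho)%:C * (w + 1) ^+ 2 / w.
Proof.
move=> w0; rewrite /jouk !(rmorphM, rmorphXn, rmorphB, rmorph1) /=.
by field; exact: w0.
Qed.

Lemma jouk_focus2 w : w != 0 ->
  jouk w - (c * (1 + rho) ^+ 2)%:C = (c * rho)%:C * (w - 1) ^+ 2 / w.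
Proof.
move=> w0; rewrite /jouk !(rmorphM, rmorphXn, rmorphD, rmorph1) /=.
by field; exact: w0.
Qed.

(** The differences to the two foci are multiples of (w + 1)^2 / w and (w - 1)^2 / w, and the
    parallelogram law adds their moduli. *)
Lemma jouk_ellipse w : w != 0 ->
  nc (jouk w - (c * (1 - rho) ^+ 2)%:C) + nc (jouk w - (c * (1 + rho) ^+ 2)%:C) =
  2 * (c * rho) * (nc w + (nc w)^-1).
Proof.
move=> w0; rewrite jouk_focus1// jouk_focus2// !ncM !ncV nc_real -!expr2.
have n0 : 0 < nc w by rewrite nc_gt0.
rewrite gtr0_norm ?mulr_gt0//.
have par : nc (w + 1) ^+ 2 + nc (w - 1) ^+ 2 = 2 * (nc w ^+ 2 + 1).
  by rewrite !sqr_nc; case: (w) => a b /=; ring.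
rewrite -mulrDl -mulrDr par; field; rewrite gt_eqF//.
Qed.

(** With b = (w + 1/w) / 2 the equation is quadratic, and its roots b + s and b - s with s^2 = b^2 -
    1 are inverse to each other. *)
Lemma jouk_surj z : exists2 w, w != 0 & jouk w = z.
Proof.
pose b : R[i] := (z - (c * (1 + rho ^+ 2))%:C) / (2 * (c * rho)%:C).
pose s := sqrtC (b ^+ 2 - 1).
have s2 : s ^+ 2 = b ^+ 2 - 1 by rewrite sqrtCK.
have cr : (c * rho)%:C != 0 :> R[i].
  by rewrite -nc_eq0 nc_real normr_eq0 mulf_neq0 ?gt_eqF.
have prod1 : (b + s) * (b - s) = 1.
  have -> : (b + s) * (b - s) = b ^+ 2 - s ^+ 2 by ring.
  by rewrite s2 opprB addrC subrK.
have w0 : b + s != 0.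
  by apply: contraTneq (oner_neq0 R[i]) => h; rewrite -prod1 h mul0r eqxx.
exists (b + s) => //.
have iv : (b + s)^-1 = b - s by apply: (mulfI w0); rewrite prod1 divff.
rewrite /jouk iv.
have -> : c%:C * (1 + rho%:C * (b + s)) * (1 + rho%:C * (b - s)) =
   c%:C * (1 + rho%:C ^+ 2 * ((b + s) * (b - s)) + 2 * (rho%:C * b)) by ring.
rewrite prod1 mulr1.
have -> : c%:C * (1 + rho%:C ^+ 2 + 2 * (rho%:C * b)) =
   (c * (1 + rho ^+ 2))%:C + 2 * (c * rho)%:C * b.
  by rewrite !(rmorphM, rmorphD, rmorphXn, rmorph1) /=; ring.
have n2 : 2 * (c * rho)%:C != 0 :> R[i] by rewrite mulf_neq0// pnatr_eq0.
by rewrite /b [X in _ + X]mulrC (divfK n2) addrC subrK.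
Qed.

(** Twice the Chebyshev polynomials, in the variable [jouk w] instead of (w + 1/w) / 2; hence the
    value 2 at k = 0. *)
Fixpoint tpoly (k : nat) : {poly R[i]} :=
  let t1 := (c * rho)%:C^-1 *: ('X - ((c * (1 + rho ^+ 2))%:C)%:P) in
  if k is k'.+1 then if k' is k''.+1 then t1 * tpoly k' - tpoly k'' else t1
  else 2%:P.

Lemma tpoly_rec k : tpoly k.+2 =
  ((c * rho)%:C^-1 *: ('X - ((c * (1 + rho ^+ 2))%:C)%:P)) * tpoly k.+1 - tpoly k.
Proof. by []. Qed.

Lemma size_tpoly k : (size (tpoly k) <= k.+1)%N.
Proof.
have s1 : (size ((c * rho)%:C^-1 *: ('X - ((c * (1 + rho ^+ 2))%:C)%:P) : {poly R[i]}) <= 2)%N.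
  by rewrite (leq_trans (size_scale_leq _ _))// size_XsubC.
suff : (size (tpoly k) <= k.+1)%N /\ (size (tpoly k.+1) <= k.+2)%N by case.
elim: k => [|k [h1 h2]]; first by split=> //; exact: size_polyC_leq1.
split=> //; rewrite tpoly_rec (leq_trans (size_polyD _ _))// geq_max size_polyN.
rewrite (leq_trans h1) ?andbT; last by rewrite leqW.
apply: (leq_trans (size_polyMleq _ _)).
by move: s1 h2; move: (size _) (size _) => p q; lia.
Qed.

Lemma tpoly_jouk k w : w != 0 -> (tpoly k).[jouk w] = w ^+ k + w^-1 ^+ k.
Proof.
move=> w0.
have cr : (c * rho)%:C != 0 :> R[i].
  by rewrite -nc_eq0 nc_real normr_eq0 mulf_neq0 ?gt_eqF.
have t1 : ((c * rho)%:C^-1 *: ('X - ((c * (1 + rho ^+ 2))%:C)%:P) : {poly R[i]}).[jouk w]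
    = w + w^-1.
  rewrite !hornerE /= /jouk; apply: (mulfI cr); rewrite mulrA divff// mul1r.
  by rewrite !(rmorphM, rmorphD, rmorphXn, rmorph1) /=; field; exact: w0.
suff : (tpoly k).[jouk w] = w ^+ k + w^-1 ^+ k /\
  (tpoly k.+1).[jouk w] = w ^+ k.+1 + w^-1 ^+ k.+1 by case.
elim: k => [|k [h1 h2]].
  split; last by rewrite /= t1 !expr1.
  by rewrite /= hornerC !expr0; ring.
split=> //; rewrite tpoly_rec hornerD hornerN hornerM t1 h1 h2.
rewrite !exprS; move: (w ^+ k) (w^-1 ^+ k) => A B.
by field; exact: w0.
Qed.

(** The index is |i - j|, written with truncated subtractions. *)
Lemma tpoly_expr w (i j : nat) : w != 0 -> (tpoly (i - j + (j - i))%N).[jouk w] =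
  w ^+ i * w^-1 ^+ j + w ^+ j * w^-1 ^+ i.
Proof.
move=> w0.
have iv m : w ^+ m * w^-1 ^+ m = 1 by rewrite -exprMn divff ?expr1n.
rewrite tpoly_jouk//; have [ij|/ltnW ji] := leqP i j.
  have -> : (i - j = 0)%N by apply/eqP; rewrite subn_eq0.
  rewrite add0n -{3 4}(subnKC ij) !exprD.
  rewrite mulrA [w ^+ i * w^-1 ^+ i]iv mul1r.
  by rewrite mulrAC iv mul1r addrC.
have -> : (j - i = 0)%N by apply/eqP; rewrite subn_eq0.
rewrite addn0 -{3 4}(subnKC ji) !exprD.
rewrite mulrAC iv mul1r; congr (_ + _).
by rewrite mulrA iv mul1r.
Qed.

(** The coefficient of w^(i - j) in q(w) q(1/w) is paired with that of w^(j - i), whence the halves.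
    Only |i - j| enters, so the product costs the degree of q and not twice that degree. *)
Lemma symmetric_product_poly (q : {poly R[i]}) :
  exists2 Q : {poly R[i]}, (size Q <= size q)%N &
  forall w, w != 0 -> Q.[jouk w] = q.[w] * q.[w^-1].
Proof.
pose Q := \sum_(i < size q) \sum_(j < size q)
  (q`_i * q`_j / 2) *: tpoly (i - j + (j - i))%N.
exists Q.
  rewrite /Q; apply: (leq_trans (size_sum _ _ _)); apply/bigmax_leqP => i _.
  apply: (leq_trans (size_sum _ _ _)); apply/bigmax_leqP => j _.
  apply: (leq_trans (size_scale_leq _ _)); apply: (leq_trans (size_tpoly _)).
  have := ltn_ord i; have := ltn_ord j.
  by case: i j => a ? [b ?] /=; lia.
move=> w w0.
transitivity (\sum_(i < size q) \sum_(j < size q)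
   (q`_i * w ^+ i * (q`_j * w^-1 ^+ j) / 2 + q`_j * w ^+ j * (q`_i * w^-1 ^+ i) / 2)).
  rewrite /Q horner_sum; apply: eq_bigr => i _; rewrite horner_sum; apply: eq_bigr => j _.
  rewrite hornerZ tpoly_expr //; move: (w ^+ i) (w ^+ j) (w^-1 ^+ i) (w^-1 ^+ j) => A B C D; ring.
under eq_bigr do rewrite big_split /=.
rewrite big_split /= [X in _ + X]exchange_big /=.
have E : \sum_(i < size q) \sum_(j < size q) q`_i * w ^+ i * (q`_j * w^-1 ^+ j) / 2 =
    q.[w] * q.[w^-1] / 2.
  rewrite [q.[w]]horner_coef [q.[w^-1]]horner_coef !mulr_suml.
  by apply: eq_bigr => i _; rewrite mulr_sumr mulr_suml.
by rewrite E -mulr2n -[LHS]mulr_natr divfK// pnatr_eq0.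
Qed.

End joukowski.

Lemma unif_ncP (R : realType) (A : set (Cplx R)) (F : nat -> Cplx R -> Cplx R)
    (f : Cplx R -> Cplx R) :
  {uniform A, F @ \oo --> f} <->
  forall e : R, 0 < e ->
  exists N, forall n, (N <= n)%N -> forall z, A z -> nc (F n z - f z) < e.
Proof.
split=> [h e e0|h].
  have /h : nbhs (f : {uniform` A -> Cplx R}) [set g | forall z, A z -> nc (g z - f z) < e].
    apply/uniform_nbhs; exists [set p : Cplx R * Cplx R | nc (p.2 - p.1) < e]; split => //.
    rewrite -entourage_ballE; exists e%:C; first by rewrite /= ltcR.
    by move=> [x y] /=; rewrite -ball_normE /ball_ /= distrC norm_nc ltcR.
  by move=> [N _ hN]; exists N => n Nn; exact: (hN n Nn).
move=> P /uniform_nbhs[E []]; rewrite -entourage_ballE => -[e /= e0 eE] EP.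
have er : e = (complex.Re e)%:C.
  by move: e0; rewrite ltcE /= => /andP[/eqP h' _]; case: (e) h' => a b /= ->.
have e0' : 0 < complex.Re e by move: e0; rewrite ltcE /= => /andP[].
have [N hN] := h _ e0'.
exists N => // n Nn; apply: EP => z Az; apply: eE => /=.
by rewrite -ball_normE /ball_ /= distrC norm_nc er ltcR; exact: hN.
Qed.

(** * Existence of pairs of approximation *)

Section runge_ellipse.
Variables (R : realType) (rho c : R).
Hypotheses (rho0 : 0 < rho) (c0 : 0 < c).

Lemma addV_diff (u t : R) : 0 < u -> 0 < t ->
  t + t^-1 - (u + u^-1) = u^-1 * ((t - u) * (u - t^-1)).
Proof. by move=> u0 t0; field; rewrite !gt_eqF. Qed.

Lemma addV_lt (u t : R) : 0 < u -> 1 <= t ->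
  (u + u^-1 < t + t^-1) = (t^-1 < u < t).
Proof.
move=> u0 t1; have t0 : 0 < t by lra.
have tV : t^-1 <= 1 by rewrite invf_le1.
rewrite -subr_gt0 addV_diff // pmulr_rgt0 ?invr_gt0 //.
apply/idP/idP => [h|/andP[h1 h2]]; last by rewrite mulr_gt0 ?subr_gt0.
by apply/andP; split; rewrite ltNge; apply/negP => h'; nra.
Qed.

Lemma addV_le (u t : R) : 0 < u -> 1 <= t ->
  (u + u^-1 <= t + t^-1) = (t^-1 <= u <= t).
Proof.
move=> u0 t1; have t0 : 0 < t by lra.
have tV : t^-1 <= 1 by rewrite invf_le1.
rewrite -subr_ge0 addV_diff // pmulr_rge0 ?invr_gt0 //.
apply/idP/idP => [h|/andP[h1 h2]]; last by rewrite mulr_ge0 ?subr_ge0.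
by apply/andP; split; rewrite leNgt; apply/negP => h'; nra.
Qed.

Let p : R := c * (1 - rho) ^+ 2.
Let q : R := c * (1 + rho) ^+ 2.

Definition ell t : R := 2 * (c * rho) * (t + t^-1).

Definition fsum (z : R[i]) : R := nc (z - p%:C) + nc (z - q%:C).

(** A point with nonpositive real part is at distance at least p and q from the foci p and q. *)
Lemma fsum_Re z : fsum z < p + q -> 0 < complex.Re z.
Proof.
apply: contraTT; rewrite -!leNgt => h; rewrite /fsum.
have h1 := Re_le_nc (z - p%:C); have h2 := Re_le_nc (z - q%:C).
have E (a : R) : complex.Re (z - a%:C) = complex.Re z - a by case: (z).
move: h1 h2; rewrite !E !ler_norml => /andP[+ _] /andP[+ _]; lra.
Qed.

Lemma ell_le s t : 1 <= s -> s <= t -> ell s <= ell t.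
Proof.
move=> s1 st; have t1 := le_trans s1 st; have s0 : 0 < s by lra.
have cr0 : 0 <= 2 * (c * rho) by rewrite !mulr_ge0 // ltW.
have tV : t^-1 <= 1 by rewrite invf_le1 //; lra.
by rewrite ler_wpM2l // addV_le // st andbT; lra.
Qed.

Lemma ell_lt s t : 1 <= s -> s < t -> ell s < ell t.
Proof.
move=> s1 st; have t1 := lt_le_trans (le_lt_trans s1 st) (lexx t); have s0 : 0 < s by lra.
have cr0 : 0 < 2 * (c * rho) by rewrite !mulr_gt0.
have tV : t^-1 < 1 by rewrite invf_lt1 //; lra.
by rewrite ltr_pM2l // addV_lt // ?st ?andbT; lra.
Qed.

(** The level p + q is that of the ellipse through 0, which corresponds to |w| = 1/rho because
    [jouk] vanishes at w = -1/rho. *)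
Lemma ell_lt_sum t : 1 <= t -> rho * t < 1 -> rho < 1 -> ell t < p + q.
Proof.
move=> t1 rt r1.
have -> : p + q = ell rho^-1 by rewrite /p /q /ell; field; rewrite gt_eqF.
by rewrite ell_lt // -[rho^-1]mul1r ltr_pdivlMr // mulrC.
Qed.

Lemma fsum_jouk w : w != 0 -> fsum (jouk rho c w) = ell (nc w).
Proof. exact: jouk_ellipse. Qed.

Lemma nc_joukB w w' : w != 0 -> w' != 0 -> nc w' = nc w ->
  nc (jouk rho c w - jouk rho c w') = c * rho * nc (1 - (w * w')^-1) * nc (w - w').
Proof.
move=> w0 w0' ww.
have -> : jouk rho c w - jouk rho c w' = (c * rho)%:C * (1 - (w * w')^-1) * (w - w').
  by rewrite /jouk rmorphM /=; field; rewrite w0 w0'.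
by rewrite !ncM nc_real gtr0_norm // mulr_gt0.
Qed.

Lemma cexp_polar (a u : R) : cexp (a +i* u) = (expR a)%:C * cexp (0 +i* u).
Proof. by rewrite !cexpE expR0 mul1r. Qed.

Lemma nc_mean_le (u v : R[i]) e : nc u <= e -> nc v <= e -> nc ((1 / 2)%:C * (u + v)) <= e.
Proof.
move=> hu hv; rewrite ncM nc_real gtr0_norm //; have := ncD u v; lra.
Qed.

(** Runge's theorem for ellipses with explicit polynomials: f(J(exp z)) is approximated on a strip
    by a Laurent polynomial in exp z, and averaging over w and 1/w, allowed by J(w) = J(1/w), turns
    each w^(l - N) into a [tpoly]. *)
Lemma runge (t s : R) f : 1 < s -> s < t ->
  (forall z, fsum z < ell t -> exists d, has_cderiv f z d) ->
  forall e, 0 < e -> exists p : {poly R[i]},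
  forall z, fsum z <= ell s -> nc (p.[z] - f z) <= e.
Proof.
move=> s1 st df e e0.
have s0 : 0 < s by lra.
have t0 : 0 < t by lra.
have s1' := ltW s1; have t1' : 1 <= t by lra.
pose g (z : R[i]) := f (jouk rho c (cexp z)).
have cexpn0 (z : R[i]) : cexp z != 0 by exact: cexp_neq0.
have insS z : `|complex.Re z| <= ln s -> fsum (jouk rho c (cexp z)) <= ell s.
  move=> h; rewrite fsum_jouk // nc_cexp.
  rewrite ler_pM2l ?mulr_gt0 // addV_le ?expR_gt0 //.
  move: h; rewrite ler_norml => /andP[h1 h2].
  by rewrite -{1}(lnK (x := s)) ?posrE // -expRN !ler_expR h1 -ler_ln ?posrE ?expR_gt0 // expRK.
have insT z : `|complex.Re z| < ln t -> fsum (jouk rho c (cexp z)) < ell t.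
  move=> h; rewrite fsum_jouk // nc_cexp.
  rewrite ltr_pM2l ?mulr_gt0 // addV_lt ?expR_gt0 //.
  move: h; rewrite ltr_norml => /andP[h1 h2].
  by rewrite -{1}(lnK (x := t)) ?posrE // -expRN !ltr_expR h1 -ltr_ln ?posrE ?expR_gt0 // expRK.
have cK := @closed_ellipse_compact R (p%:C) (q%:C) (ell s).
have fK z : (nc (z - p%:C) + nc (z - q%:C) <= ell s) -> ccont f z.
  move=> h; have [d dz] := df z (le_lt_trans h (ell_lt (ltW s1) st)).
  exact: has_cderiv_ccont dz.
have [S hS] := compact_nc_bounded cK fK.
have A1 : 0 <= ln s < ln t by rewrite ln_ge0 ?ltW //= ltr_ln ?posrE //; lra.
have dg z : `|complex.Re z| < ln t -> exists d, has_cderiv g z d.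
  move=> h; have [d dz] := df _ (insT z h).
  have E : jouk rho c \o @cexp R = (fun z => (c%:C * (1 + rho%:C * cexp z)) * (1 + rho%:C * cexp (- z))).
    by apply/funext => w /=; rewrite /jouk cexpN.
  have hk : exists k, has_cderiv (fun z => jouk rho c (cexp z)) z k.
    have -> : (fun z => jouk rho c (cexp z)) = jouk rho c \o @cexp R by [].
    rewrite E; eexists.
    have h1 := has_cderivM (has_cderiv_cst z rho%:C) (has_cderiv_cexp z).
    have h2 := has_cderivM (has_cderiv_cst z rho%:C)
      (has_cderiv_comp (has_cderiv_opp z) (has_cderiv_cexp (- z))).
    have h3 := has_cderivM (has_cderiv_cst z c%:C) (has_cderivD (has_cderiv_cst z 1) h1).
    exact: (has_cderivM h3 (has_cderivD (has_cderiv_cst z 1) h2)).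
  case: hk => k hk.
  exists (d * k).
  exact: (@has_cderiv_comp R f (fun z => jouk rho c (cexp z))).
have per x y : g (x +i* (y + 2 * pi)) = g (x +i* y) by rewrite /g cexp_2pi.
have bd z : `|complex.Re z| <= ln s -> nc (g z) <= S by move=> h; apply: hS; exact: insS.
have un : forall e : R, 0 < e -> exists2 r : R, 0 < r & forall a x y, `|a| <= ln s ->
    nc (cexp (0 +i* x) - cexp (0 +i* y)) < r -> nc (g (a +i* x) - g (a +i* y)) <= e.
  move=> e1 e10; have [r r0 hr] := compact_unif_cont cK fK e10.
  (* A Lipschitz constant for u -> J(exp(a + iu)) as a function of exp(iu), uniform in |a| <= ln
     s. *)
  pose M := c * rho * (1 + s ^+ 2) * s.
  have M0 : 0 < M by rewrite !mulr_gt0 // addr_gt0 ?exprn_gt0.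
  exists (r / M); first exact: divr_gt0.
  move=> a x y ha hxy; apply/ltW/hr; first exact: (insS (a +i* y)).
  have nE u : nc (cexp (a +i* u)) = expR a by rewrite nc_cexp.
  move: (ha); rewrite ler_norml => /andP[h1 h2].
  have a1 : expR a <= s by rewrite -ler_ln ?posrE ?expR_gt0 // expRK.
  have a2 : expR (- a) <= s by rewrite -ler_ln ?posrE ?expR_gt0 // expRK; lra.
  rewrite nc_joukB // ?nE //.
  have -> : cexp (a +i* x) - cexp (a +i* y) = (expR a)%:C * (cexp (0 +i* x) - cexp (0 +i* y)).
    by rewrite mulrBr -!cexp_polar.
  rewrite ncM nc_real gtr0_norm ?expR_gt0 //.
  have h3 : nc (1 - (cexp (a +i* x) * cexp (a +i* y))^-1) <= 1 + s ^+ 2.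
    rewrite (le_trans (ncD _ _)) // nc1 lerD2l ncN ncV ncM !nE invfM -!expRN expr2.
    by rewrite ler_pM ?expR_ge0.
  have X0 := nc_ge0 (1 - (cexp (a +i* x) * cexp (a +i* y))^-1).
  have D0 := nc_ge0 (cexp (0 +i* x) - cexp (0 +i* y)).
  move: hxy; rewrite ltr_pdivlMr //; apply: le_lt_trans.
  rewrite [leRHS]mulrC; have ea0 := expR_ge0 a.
  have aux (X D E : R) : 0 <= X -> 0 <= D -> 0 <= E -> X <= 1 + s ^+ 2 -> E <= s ->
      c * rho * X * (E * D) <= M * D.
    move=> X0' D0' E0 hX hE; rewrite /M [X in _ <= X]mulrAC -!mulrA !(ler_pM2l c0, ler_pM2l rho0).
    by rewrite ler_pM ?mulr_ge0 // mulrC ler_wpM2l.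
  exact: aux.
have [N [b hb]] := strip_approx A1 dg per bd un e0.
exists (\sum_(l < N.*2.+1) (b l / 2) *: tpoly rho c (l - N + (N - l))%N) => z hz.
have [w w0 wz] := jouk_surj rho0 c0 z.
have lw : `|ln (nc w)| <= ln s.
  have n0 : 0 < nc w by rewrite nc_gt0.
  move: hz; rewrite -wz fsum_jouk // ler_pM2l ?mulr_gt0 // addV_le //.
  move=> /andP[h1 h2]; rewrite ler_norml -lnV ?posrE // !ler_ln ?posrE ?invr_gt0 //.
  by rewrite h1 h2.
have rw : complex.Re (clog w) = ln (nc w) := Re_clog w.
have ew : cexp (clog w) = w := cexp_clog w0.
have ew' : cexp (- clog w) = w^-1 by rewrite cexpN ew.
have h1 : nc (\sum_(l < N.*2.+1) b l * (w ^+ l * w^-1 ^+ N) - f z) <= e.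
  have := hb (clog w); rewrite rw /g ew ew' wz; exact.
have h2 : nc (\sum_(l < N.*2.+1) b l * (w^-1 ^+ l * w ^+ N) - f z) <= e.
  have := hb (- clog w); rewrite /g opprK ew ew' (joukV rho c w) wz; apply.
  have -> : complex.Re (- clog w) = - complex.Re (clog w) by case: (clog w).
  by rewrite normrN rw.
have -> : (\sum_(l < N.*2.+1) (b l / 2) *: tpoly rho c (l - N + (N - l))%N).[z] - f z
   = (1/2)%:C * ((\sum_(l < N.*2.+1) b l * (w ^+ l * w^-1 ^+ N) - f z) +
     (\sum_(l < N.*2.+1) b l * (w^-1 ^+ l * w ^+ N) - f z)).
  have -> (x y u : R[i]) : (1/2)%:C * (x - u + (y - u)) = (1/2)%:C * (x + y) - u.
    by rewrite fmorph_div /= rmorph1 rmorph_nat; field.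
  congr (_ - _); rewrite -big_split mulr_sumr horner_sum; apply: eq_bigr => l _ /=.
  rewrite hornerZ -wz tpoly_expr //.
  rewrite fmorph_div /= rmorph1 rmorph_nat.
  by move: (w ^+ l) (w ^+ N) (w^-1 ^+ l) (w^-1 ^+ N) => x y u v; field.
exact: nc_mean_le.
Qed.

(** Replacing w by w/t moves |w| <= t to the unit disc and rho to rho t. If 1/t <= |w| <= t, then
    w/t and 1/(w t) both lie in that disc, and z^m = c^m (1 + rho w)^m (1 + rho/w)^m splits into two
    factors handled by the same polynomial. *)
Lemma weight_one (alpha t : R) : 0 < alpha -> 1 <= t -> rho * t * (1 + 2 * alpha) < 1 ->
  exists (d : R) (Q : nat -> {poly R[i]}), [/\ 0 < d,
    forall n, (size (Q n))%:R <= (1 - d) * n%:R + 1 &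
    forall e : R, 0 < e -> exists N, forall n, (N <= n)%N -> forall z, fsum z <= ell t ->
      nc (z ^+ Num.trunc (alpha * n%:R) * (Q n).[z] - 1) < e].
Proof.
move=> a0 t1 rt; have t0 : 0 < t by lra.
have tn0 : t%:C != 0 by rewrite -nc_eq0 nc_real normr_eq0 gt_eqF.
have cn0 : c%:C != 0 by rewrite -nc_eq0 nc_real normr_eq0 gt_eqF.
have rho1 : rho < 1.
  by clear -rho0 a0 t1 rt; have := mulr_ge0 (ltW rho0) (ltW a0); nra.
have [d [q0 [d0 sq hq]]] := disc_approx a0 (mulr_gt0 rho0 t0) rt.
have /choice[Q hQ] : forall n, exists Q : {poly R[i]},
    (size Q <= size (q0 n \Po (t%:C^-1 *: 'X)))%N /\
    forall w, w != 0 -> Q.[jouk rho c w] =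
      (q0 n \Po (t%:C^-1 *: 'X)).[w] * (q0 n \Po (t%:C^-1 *: 'X)).[w^-1].
  move=> n; have [Q h1 h2] := symmetric_product_poly rho0 rho1 c0 (q0 n \Po (t%:C^-1 *: 'X)).
  by exists Q.
pose m n := Num.trunc (alpha * n%:R).
have sX : size (t%:C^-1 *: 'X : {poly R[i]}) = 2%N.
  by rewrite size_scale ?size_polyX // invr_eq0.
exists d, (fun n => (c%:C ^- m n) *: Q n); split => // [n|e e0].
  rewrite (le_trans _ (sq n)) // ler_nat (leq_trans (size_scale_leq _ _)) //.
  by have [+ _] := hQ n; rewrite size_comp_poly2.
(* AB - 1 = (A - 1) + (B - 1) + (A - 1)(B - 1), which is below 3 e1 when e1 <= 1. *)
have [e1 [e10 e11 e13]] : exists e1 : R, [/\ 0 < e1, e1 <= 1 & 3 * e1 <= e].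
  exists (Num.min 1 (e / 3)); split; first by rewrite lt_min ltr01 divr_gt0.
    by rewrite ge_min lexx.
  by rewrite mulrC -ler_pdivlMr // ge_min lexx orbT.
have [N hN] := hq _ e10; exists N => n Nn z hz.
have [w w0 wz] := jouk_surj rho0 c0 z.
move: hz; rewrite -wz fsum_jouk // ler_pM2l ?mulr_gt0 // addV_le // ?nc_gt0 //.
move=> /andP[h1 h2].
have hA := hN n Nn (w / t%:C); have hB := hN n Nn (w^-1 / t%:C).
have [sQ vQ] := hQ n.
rewrite hornerZ vQ // !horner_comp !hornerZ !hornerX.
pose A := (1 + (rho * t)%:C * (w / t%:C)) ^+ m n * (q0 n).[w / t%:C].
pose B := (1 + (rho * t)%:C * (w^-1 / t%:C)) ^+ m n * (q0 n).[w^-1 / t%:C].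
have hA' : nc (A - 1) < e1.
  by apply: hA; rewrite ncM ncV nc_real gtr0_norm // ler_pdivrMr // mul1r.
have hB' : nc (B - 1) < e1.
  apply: hB; rewrite ncM !ncV nc_real gtr0_norm // ler_pdivrMr // mul1r.
  by rewrite invf_ple ?posrE // nc_gt0.
have E (x : R[i]) : 1 + (rho * t)%:C * (x / t%:C) = 1 + rho%:C * x.
  by rewrite rmorphM /=; field.
have -> : jouk rho c w ^+ m n * (c%:C ^- m n * ((q0 n).[t%:C^-1 * w] * (q0 n).[t%:C^-1 * w^-1])) - 1
    = (A - 1) + (B - 1) + (A - 1) * (B - 1).
  rewrite /A /B !E /jouk !exprMn -!(mulrC t%:C^-1).
  have cm : c%:C ^+ m n != 0 by rewrite expf_neq0.
  move: (q0 n).[_] (q0 n).[_] ((1 + rho%:C * w) ^+ m n) ((1 + rho%:C / w) ^+ m n)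
    (c%:C ^+ m n) cm => X Y U V C C0.
  by field.
apply: (le_lt_trans (ncD _ _)).
apply: (@le_lt_trans _ _ (nc (A - 1) + nc (B - 1) + nc (A - 1) * nc (B - 1))).
  by rewrite ncM lerD2r ncD.
have := nc_ge0 (A - 1); have := nc_ge0 (B - 1).
move: (nc (A - 1)) (nc (B - 1)) hA' hB' => x y; clear -e10 e11 e13; nra.
Qed.
End runge_ellipse.

(** * Weighted approximation on the whole ellipse *)

Section approximation.
Variables (R : realType) (rho c : R).
Hypotheses (rho0 : 0 < rho) (rho1 : rho < 1) (c0 : 0 < c).
Local Notation ell := (ell rho c).
Local Notation fsum := (fsum rho c).

Lemma fsum_ell_Re (t : R) z : 1 <= t -> rho * t < 1 -> fsum z < ell t -> 0 < complex.Re z.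
Proof.
by move=> t1 rt h; apply: (fsum_Re (rho := rho) (c := c)); apply: lt_trans h (ell_lt_sum _ _ _ _ _).
Qed.

(** The degree bound S must not depend on phi. Polynomials are chosen for the exponents i/L of a
    finite grid only, and z^(phi - i/L) is uniformly close to 1 because the logarithm is bounded on
    the closed ellipse. *)
Lemma approx_exponents (t s : R) f e : 1 < s -> s < t -> rho * t < 1 ->
  (forall z, fsum z < ell t -> exists d, has_cderiv f z d) -> 0 < e ->
  exists S, forall phi : R, 0 <= phi <= 1 -> exists2 p : {poly R[i]}, (size p <= S)%N &
    forall z, fsum z <= ell s -> nc (cpow z phi * p.[z] - f z) <= e.
Proof.
move=> s1 st rt df e0.
have s1' := ltW s1; have t1 : 1 <= t by lra.
have inT z : fsum z <= ell s -> fsum z < ell t.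
  by move=> h; apply: le_lt_trans h (ell_lt _ _ _ _).
have Re0 z : fsum z < ell t -> 0 < complex.Re z by exact: fsum_ell_Re.
have cK := @closed_ellipse_compact R (c * (1 - rho) ^+ 2)%:C (c * (1 + rho) ^+ 2)%:C (ell s).
have [F hF] : exists F : R, forall z, fsum z <= ell s -> nc (f z) <= F.
  apply: (compact_nc_bounded cK) => z hz; have [d dz] := df z (inT z hz).
  exact: has_cderiv_ccont dz.
have [La hLa] : exists La : R, forall z, fsum z <= ell s -> nc (clog z) <= La.
  apply: (compact_nc_bounded cK) => z hz; exact/continuous_clog/Re0/inT.
have F1 : 0 < `|F| + 1 by rewrite ltr_wpDl.
have L1 : 0 < `|La| + 1 by rewrite ltr_wpDl.
set B := expR (`|La|).
have B0 : 0 < B by rewrite expR_gt0.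
have cB z phi : 0 <= phi <= 1 -> fsum z <= ell s -> nc (cpow z phi) <= B.
  move=> /andP[p0 p1] hz; rewrite nc_cpow /B ler_expR -Re_clog.
  apply: (le_trans (ler_norm _)); rewrite normrM (ger0_norm p0).
  have h1 := Re_le_nc (clog z); have h2 := hLa z hz; have h3 := ler_norm La.
  apply: (@le_trans _ _ (1 * `|complex.Re (clog z)|)); first exact: ler_wpM2r.
  by rewrite mul1r (le_trans h1) // (le_trans h2).
have e20 : 0 < e / 2 / (`|F| + 1) by rewrite !divr_gt0.
have [r r0 hr] := has_cderiv_ccont (has_cderiv_cexp 0) e20.
pose L := (Num.trunc ((`|La| + 1) / r)).+1.
have Lr : (`|La| + 1) / L%:R < r.
  rewrite ltr_pdivrMr // mulrC -ltr_pdivrMr //.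
  by have /andP[] := truncn_itv (ltW (divr_gt0 L1 r0)).
have L0 : (0 : R) < L%:R by [].
have cp i : exists p : {poly R[i]}, forall z, fsum z <= ell s ->
    nc (p.[z] - f z * cpow z (- (i%:R / L%:R))) <= e / 2 / B.
  apply: (runge rho0 c0 s1 st) => [z hz|]; last by rewrite !divr_gt0.
  have [d dz] := df z hz; have [k kz] := has_cderiv_cpow (- (i%:R / L%:R)) (Re0 z hz).
  by eexists; exact: (has_cderivM dz kz).
have [p hp] := choice cp.
exists (\max_(i < L.+1) size (p i)) => phi phi01.
have /andP[p0 p1] := phi01.
pose i := Num.trunc (phi * L%:R).
have phL : 0 <= phi * L%:R by rewrite mulr_ge0 // ltW.
have /andP[i1 i2] := truncn_itv phL; rewrite -/i in i1 i2.
have iL : (i < L.+1)%N.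
  by rewrite ltnS -(ler_nat R) (le_trans i1) // ler_piMl // ltW.
exists (p i); first exact: (leq_bigmax (Ordinal iL)).
move=> z hz.
have -> : cpow z phi * (p i).[z] - f z =
   cpow z phi * ((p i).[z] - f z * cpow z (- (i%:R / L%:R))) +
   f z * (cpow z (phi - i%:R / L%:R) - 1).
  by rewrite cpowD; move: (cpow _ _) (cpow _ _) => X Y; ring.
have hd : nc (cpow z (phi - i%:R / L%:R) - 1) < e / 2 / (`|F| + 1).
  have := hr ((phi - i%:R / L%:R)%:C * clog z); rewrite add0r cexp0; apply.
  rewrite ncM nc_real ger0_norm; last by rewrite subr_ge0 ler_pdivrMr.
  apply: le_lt_trans Lr; rewrite mulrC; apply: ler_pM; rewrite ?nc_ge0 //.
  - by rewrite subr_ge0 ler_pdivrMr.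
  - by rewrite (le_trans (hLa z hz)) // (le_trans (ler_norm _)) // lerDl.
  - by rewrite lerBlDl -[X in _ + X]mul1r -mulrDl ler_pdivlMr // -(natrD _ _ 1) addn1 ltW.
apply: (le_trans (ncD _ _)); rewrite (ncM (cpow z phi)) (ncM (f z)).
have h1 : nc (cpow z phi) * nc ((p i).[z] - f z * cpow z (- (i%:R / L%:R))) <= e / 2.
  have -> : e / 2 = B * (e / 2 / B) by field; rewrite gt_eqF.
  by apply: ler_pM; rewrite ?nc_ge0 ?cB ?hp.
have h2 : nc (f z) * nc (cpow z (phi - i%:R / L%:R) - 1) <= e / 2.
  have -> : e / 2 = (`|F| + 1) * (e / 2 / (`|F| + 1)) by field; rewrite gt_eqF.
  apply: ler_pM; rewrite ?nc_ge0 ?(ltW hd) //.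
  by rewrite (le_trans (hF z hz)) // (le_trans (ler_norm _)) // lerDl.
by rewrite [leRHS]splitr; exact: lerD.
Qed.

Lemma fsum_segment x : c * (1 - rho) ^+ 2 <= x <= c * (1 + rho) ^+ 2 -> fsum x%:C = ell 1.
Proof.
move=> /andP[x1 x2]; rewrite /fsum.
have E (a : R) : nc (x%:C - a%:C) = `|x - a| by rewrite -rmorphB nc_real.
rewrite !E ger0_norm ?subr_ge0 //.
by rewrite ler0_norm ?subr_le0 // /ell invr1; ring.
Qed.

(** The levels of a fixed sequence of inner ellipses are cofinal below [ell t]: [ell] is Lipschitz
    on [1, t] with constant 2 c rho. *)
Lemma ell_interpolate (t x : R) : 1 < t -> x < ell t -> exists k : nat,
  x < ell (1 + (t - 1) * (1 - k.+2%:R^-1)).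
Proof.
move=> t1 xt.
have cr : 0 < 2 * (c * rho) by rewrite !mulr_gt0.
have t0 : 0 < t by lra.
have d0 : 0 < ell t - x by rewrite subr_gt0.
exists (Num.trunc (2 * (c * rho) * (t - 1) / (ell t - x))).
set k := Num.trunc _.
have kb : 2 * (c * rho) * (t - 1) / (ell t - x) < k.+2%:R.
  have : 2 * (c * rho) * (t - 1) / (ell t - x) < k.+1%:R.
    by apply: real_truncnS_gt; rewrite num_real.
  by move=> /lt_trans; apply; rewrite ltr_nat.
have kV : 0 < (k.+2%:R : R)^-1 by rewrite invr_gt0.
have kV1 : (k.+2%:R : R)^-1 < 1 by rewrite invf_lt1 // ltr1n.
set s := 1 + _.
have s1 : 1 < s by rewrite ltrDl mulr_gt0 ?subr_gt0.
have ts : t - s = (t - 1) / k.+2%:R by rewrite /s; ring.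
have st : s < t by rewrite -subr_gt0 ts mulr_gt0 ?subr_gt0.
have s0 : 0 < s by lra.
have h : ell t - ell s <= 2 * (c * rho) * (t - s).
  rewrite /ell -mulrBr ler_pM2l //.
  have : t^-1 <= s^-1 by rewrite lef_pV2 ?posrE // ltW.
  lra.
have : 2 * (c * rho) * (t - s) < ell t - x.
  by rewrite ts (mulrA (2 * (c * rho))) ltr_pdivrMr // [ltRHS]mulrC -ltr_pdivrMr.
lra.
Qed.

(** Diagonal choice: at stage n the factor [p n] is taken for the largest k <= n whose degree bound
    [S k] fits into the d n degrees left by [Q n]. Every fixed k fits eventually, so both the
    ellipse and the precision improve with n. *)
Lemma weighted_approx (alpha t : R) f : 0 < alpha -> 1 < t -> rho * t * (1 + 2 * alpha) < 1 ->
  (forall z, fsum z < ell t -> exists d, has_cderiv f z d) ->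
  exists P : nat -> {poly R[i]}, (forall n, (size (P n) <= n.+1)%N) /\
    forall s, s < ell t -> forall e : R, 0 < e -> exists N, forall n, (N <= n)%N ->
    forall z, fsum z <= s -> nc (cpow z (alpha * n%:R) * (P n).[z] - f z) < e.
Proof.
move=> a0 t1 rta df.
have t0 : 0 < t by lra.
have rt : rho * t < 1.
  by have h := mulr_gt0 (mulr_gt0 rho0 t0) a0; clear -h rta; lra.
pose s k : R := 1 + (t - 1) * (1 - k.+2%:R^-1).
have kV k : 0 < (k.+2%:R : R)^-1 < 1 by rewrite invr_gt0 ltr0n /= invf_lt1 // ltr1n.
have s1 k : 1 < s k by have /andP[k0 k1] := kV k; rewrite ltrDl mulr_gt0 ?subr_gt0.
have st k : s k < t.
  have -> : s k = t - (t - 1) / k.+2%:R by rewrite /s; ring.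
  by have /andP[k0 k1] := kV k; rewrite gtrBl mulr_gt0 ?subr_gt0.
have smono k l : (k <= l)%N -> s k <= s l.
  move=> kl; rewrite lerD2l ler_pM2l ?subr_gt0 // lerD2l lerN2.
  by rewrite lef_pV2 ?posrE // ler_nat.
have ek k : 0 < (k.+1%:R : R)^-1 by rewrite invr_gt0.
have [S hS] := choice (fun k => approx_exponents (s1 k) (st k) rt df (ek k)).
have [d [Q [d0 sQ hQ]]] := weight_one rho0 c0 a0 (ltW t1) rta.
pose m n := Num.trunc (alpha * n%:R).
pose phi n : R := alpha * n%:R - (m n)%:R.
have phi01 n : 0 <= phi n <= 1.
  have an0 : 0 <= alpha * n%:R by rewrite mulr_ge0 // ltW.
  have /andP[h1 h2] := truncn_itv an0; rewrite subr_ge0 h1 /= lerBlDl.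
  by rewrite -(natrD _ _ 1) addn1 ltW.
have hp n : exists p : {poly R[i]}, (size (Q n * p)%R <= n.+1)%N /\
  forall k, (k <= n)%N -> (S k)%:R <= d * n%:R -> forall z, fsum z <= ell (s k) ->
    nc (cpow z (phi n) * p.[z] - f z) <= k.+1%:R^-1.
  pose good k := (k <= n)%N && ((S k)%:R <= d * n%:R).
  have [/existsP[k0 gk0]|ngood] := boolP [exists k : 'I_n.+1, good k]; last first.
    (* As long as no k fits, the requirement is void and the zero polynomial will do. *)
    exists 0; rewrite mulr0 size_poly0; split=> // k kn Sk; exfalso.
    move: ngood => /existsP; apply; exists (inord k); by rewrite /good inordK // kn.
  have gb k : good k -> (k <= n)%N by case/andP.
  have ex0 : exists k, good k by exists k0.
  have [K /andP[Kn SK] Kmax] := ex_maxnP ex0 gb.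
  have [p sp vp] := hS K (phi n) (phi01 n).
  exists p; split.
    apply: (leq_trans (size_polyMleq _ _)).
    suff : (size (Q n) + size p <= n.+1)%N by case: (_ + _)%N => //= x /ltnW.
    rewrite -(ler_nat R) natrD -addn1 natrD.
    have h1 := sQ n; have h2 : (size p)%:R <= (S K)%:R :> R by rewrite ler_nat.
    by clear -h1 h2 SK; lra.
  move=> k kn Sk z hz; have kK : (k <= K)%N by apply: Kmax; rewrite /good kn.
  apply: (le_trans (vp z _)); first by apply: (le_trans hz);
    apply: ell_le => //; [exact: ltW|exact: smono].
  by rewrite lef_pV2 ?posrE // ler_nat.
have [p hp'] := choice hp.
exists (fun n => Q n * p n); split=> [n|x xt e e0]; first by have [] := hp' n.
have [k0 xk0] := ell_interpolate t1 xt.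
(* One index k serves both demands: its ellipse contains the level x, and its precision is at most
   e/2. *)
have [k [kk0 ke]] : exists k, (k0 <= k)%N /\ (k.+1%:R : R)^-1 <= e / 2.
  exists (maxn k0 (Num.trunc (2 / e))); split; first exact: leq_maxl.
  rewrite invf_ple ?posrE ?divr_gt0 // invf_div.
  apply: (@le_trans _ _ (Num.trunc (2 / e)).+1%:R); last by rewrite ler_nat ltnS leq_maxr.
  by apply/ltW/real_truncnS_gt; rewrite num_real.
have xk z : fsum z <= x -> fsum z <= ell (s k).
  move=> h; apply: (le_trans h); apply: (le_trans (ltW xk0)).
  exact: (ell_le rho0 c0 (ltW (s1 k0)) (smono _ _ kk0)).
have cK := @closed_ellipse_compact R (c * (1 - rho) ^+ 2)%:C (c * (1 + rho) ^+ 2)%:C x.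
have [F hF] : exists F : R, forall z, fsum z <= x -> nc (f z) <= F.
  apply: (compact_nc_bounded cK) => z hz; have [D dz] := df z (le_lt_trans hz xt).
  exact: has_cderiv_ccont dz.
have G0 : 0 < `|F| + 1 by rewrite ltr_wpDl.
have [N1 hN1] := hQ (e / 2 / (`|F| + 1 + 1)) ltac:(by rewrite !divr_gt0 // addr_gt0).
have [N2 hN2] : exists N2 : nat, (S k)%:R / d <= N2%:R.
  exists (Num.trunc ((S k)%:R / d)).+1.
  by apply/ltW/real_truncnS_gt; rewrite num_real.
exists (maxn N1 (maxn N2 k)) => n; rewrite !geq_max => /and3P[n1 n2 n3] z hz.
have zt := le_lt_trans hz xt.
have z0 : z != 0.
  have := fsum_ell_Re (ltW t1) rt zt.
  by apply: contraTneq => ->; rewrite ltxx.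
have -> : alpha * n%:R = (m n)%:R + phi n by rewrite /phi addrC subrK.
rewrite cpowD cpow_nat // hornerM.
have hv : nc (cpow z (phi n) * (p n).[z] - f z) <= k.+1%:R^-1.
  have [_ h] := hp' n; apply: h => //; last exact: xk.
  rewrite mulrC -ler_pdivrMr // (le_trans hN2) // ler_nat //.
have hw := hN1 n n1 z (ltW zt).
set w := z ^+ m n * (Q n).[z] in hw.
set v := cpow z (phi n) * (p n).[z] in hv.
have -> : z ^+ m n * cpow z (phi n) * ((Q n).[z] * (p n).[z]) - f z =
   (w - 1) * v + (v - f z).
  by rewrite /w /v; move: (cpow _ _) => X; ring.
have nv : nc v <= `|F| + 1 + 1.
  have -> : v = (v - f z) + f z by rewrite subrK.
  apply: (le_trans (ncD _ _)); rewrite addrC lerD //.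
    by rewrite (le_trans (hF z hz)) // (le_trans (ler_norm _)) // lerDl.
  by rewrite (le_trans hv) // invf_le1 // ler1n.
apply: (le_lt_trans (ncD _ _)); rewrite [ltRHS]splitr.
apply: ltr_leD; last exact: le_trans hv ke.
rewrite (ncM (w - 1)); have F2 : 0 < `|F| + 1 + 1 by rewrite addr_gt0.
apply: (@le_lt_trans _ _ (nc (w - 1) * (`|F| + 1 + 1))); first by rewrite ler_wpM2l ?nc_ge0.
by rewrite -ltr_pdivlMr.
Qed.

Lemma segment_approximation_pair alpha : 0 < alpha -> rho * (1 + 2 * alpha) < 1 ->
  has_approximation_pair
    [set x%:C | x in `[c * (1 - rho) ^+ 2, c * (1 + rho) ^+ 2]] alpha.
Proof.
move=> a0 ra.
pose u := rho * (1 + 2 * alpha).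
have u0 : 0 < u by rewrite mulr_gt0 // addr_gt0 // mulr_gt0.
have [t t1 rta] : exists2 t, 1 < t & rho * t * (1 + 2 * alpha) < 1.
  (* The midpoint of 1 and 1/u, where u = rho (1 + 2 alpha) < 1, since the condition on t is t u <
     1. *)
  exists ((1 + u^-1) / 2).
    have : 1 < u^-1 by rewrite invf_gt1.
    lra.
  have -> : rho * ((1 + u^-1) / 2) * (1 + 2 * alpha) = (u + u^-1 * u) / 2 by rewrite /u; ring.
  by rewrite mulVf ?gt_eqF // ltr_pdivrMr // mul1r; clear -ra; rewrite /u; lra.
have t0 : 0 < t by lra.
have rt : rho * t < 1.
  by have h := mulr_gt0 (mulr_gt0 rho0 t0) a0; clear -h rta; lra.
pose p := (c * (1 - rho) ^+ 2)%:C : R[i]; pose q := (c * (1 + rho) ^+ 2)%:C : R[i].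
have GE z : ellipse p q (ell t) z = (fsum z < ell t) by [].
have pq : c * (1 - rho) ^+ 2 <= c * (1 + rho) ^+ 2.
  have E : (1 + rho) ^+ 2 - (1 - rho) ^+ 2 = 4 * rho by ring.
  by rewrite ler_pM2l // -subr_ge0 E mulr_ge0 // ltW.
have segG x : x \in `[c * (1 - rho) ^+ 2, c * (1 + rho) ^+ 2] -> ellipse p q (ell t) x%:C.
  by rewrite in_itv /= GE => h; rewrite fsum_segment // ell_lt.
exists (ellipse p q (ell t)); split.
- by move=> _ [x hx <-]; exact: segG.
- exact/cconvex_simply_connected/ellipse_convex.
- split => //.
  + split.
    * by exists p; apply: segG; rewrite in_itv /= lexx pq.
    * exact: ellipse_open.
    * exact/cconvex_connected/ellipse_convex.
  + apply: (@bounded_set_nc R _ (ell t + nc p)) => z; rewrite GE /fsum => h.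
    by have := lerB_nc z p; have := nc_ge0 (z - q); move: h; rewrite -/p -/q; lra.
  + move=> z Gz [x /= ]; rewrite in_itv /= => x0 xz.
    have := fsum_ell_Re (ltW t1) rt Gz; rewrite -xz /=; lra.
  + move=> f hf.
    have df z : fsum z < ell t -> exists d, has_cderiv f z d.
      by move=> h; apply/has_cderivP/hf.
    have [P [sP hP]] := weighted_approx a0 t1 rta df.
    exists P; split=> // z Gz.
    have zt : fsum z < ell t := Gz.
    pose s := (fsum z + ell t) / 2.
    exists (ellipse p q s).
      by apply: open_nbhs_nbhs; split; [exact: ellipse_open|rewrite /ellipse /= -/(fsum z) /s; lra].
    apply/unif_ncP => e e0; have [|N hN] := hP s _ e e0; first by rewrite /s; lra.
    by exists N => n Nn w [/ltW ws _]; exact: hN.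
Qed.

End approximation.

(** * Non-existence of pairs of approximation *)

Section log_inequalities.
Variable R : realType.

Lemma le_of_derive_ge0 (f df : R -> R) (x : R) : 1 <= x ->
  (forall y : R, 1 <= y -> is_derive y 1 f (df y)) -> (forall y : R, 1 <= y -> 0 <= df y) ->
  f 1 <= f x.
Proof.
move=> x1 hf df0.
have [||c] := @MVT_segment R f df 1 x x1.
- by move=> y; rewrite in_itv /= => /andP[y1 _]; exact/hf/ltW.
- apply: derivable_within_continuous => y; rewrite in_itv /= => /andP[y1 _].
  by have [] := hf y y1.
rewrite in_itv /= => /andP[c1 _] h.
by rewrite -subr_ge0 h mulr_ge0 ?df0 // subr_ge0.
Qed.

(** The difference has derivative (1 - 1/y)^2 / 2. Both sides agree to second order at 1, as the
    critical alpha demands. *)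
Lemma ln_le_half_subV (u : R) : 1 <= u -> ln u <= (u - u^-1) / 2.
Proof.
move=> u1; rewrite -subr_ge0.
pose f (x : R) := 2^-1 * (x - x^-1) - ln x.
have h : f 1 <= f u.
  apply: (@le_of_derive_ge0 f (fun y => 2^-1 * (1 + y ^- 2) - y^-1)) => // y y1.
    have y0 : 0 < y by lra.
    have hy : y != 0 by rewrite gt_eqF.
    have dV : is_derive y 1 (fun x : R => x^-1) (- y ^- 2).
      have := @is_deriveV R id y 1 1 hy (is_derive_id _ _).
      by rewrite /GRing.scale /= mulr1.
    have := is_deriveB (is_deriveZ 2^-1 (is_deriveB (is_derive_id y 1) dV)) (is_derive1_ln y0).
    by rewrite /GRing.scale /= opprK.
  have -> : 2^-1 * (1 + y ^- 2) - y^-1 = 2^-1 * (1 - y^-1) ^+ 2.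
    by field; rewrite gt_eqF //; lra.
  by rewrite mulr_ge0 ?sqr_ge0.
by move: h; rewrite /f invr1 subrr mulr0 ln1 subr0 mulrC.
Qed.

(** The difference has derivative ((y - 1) / (y + 1))^2 / y; the left side is the first Padé
    approximant of ln at 1, again exact to second order. *)
Lemma le_ln_cayley (A : R) : 1 <= A -> 2 * (A - 1) / (A + 1) <= ln A.
Proof.
move=> u1; rewrite -subr_ge0.
pose f (x : R) := ln x - (2 - 4 * (x + 1)^-1).
have h : f 1 <= f A.
  apply: (@le_of_derive_ge0 f (fun y => y^-1 - (0 - 4 * (- (y + 1) ^- 2)))) => // y y1.
    have y0 : 0 < y by lra.
    have hy : y + 1 != 0 by rewrite gt_eqF // addr_gt0.
    have d1 : is_derive y 1 (fun x : R => x + 1) 1.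
      by have := is_deriveD (is_derive_id y 1) (is_derive_cst (1 : R) y (1 : R)); rewrite addr0.
    have dV : is_derive y 1 (fun x : R => (x + 1)^-1) (- (y + 1) ^- 2).
      have := @is_deriveV R (fun x => x + 1) y 1 1 hy d1.
      by rewrite /GRing.scale /= mulr1.
    exact: (is_deriveB (is_derive1_ln y0) (is_deriveB (is_derive_cst (2 : R) y (1 : R)) (is_deriveZ 4 dV))).
  have -> : y^-1 - (0 - 4 * (- (y + 1) ^- 2)) = y^-1 * ((y - 1) / (y + 1)) ^+ 2.
    by field; rewrite !gt_eqF //; lra.
  by rewrite mulr_ge0 ?sqr_ge0 // invr_ge0; lra.
have e1 : f 1 = 0 by rewrite /f ln1; field.
move: h; rewrite e1 /f.
have -> // : 2 - 4 * (A + 1)^-1 = 2 * (A - 1) / (A + 1).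
by field; rewrite gt_eqF //; lra.
Qed.

(** After both logarithm bounds a common factor 1/s - s cancels, and what remains is 2 - rho (s +
    1/s) < 4 alpha rho. This follows from 2 <= 2 rho + 4 alpha rho and s + 1/s > 2; the latter keeps
    it strict at the critical alpha. *)
Lemma kappa_lt0 (rho alpha s : R) : 0 < rho -> rho < 1 -> 0 < alpha -> 1 <= rho * (1 + 2 * alpha) ->
  rho < s -> s < 1 ->
  - ln s + alpha * (ln (1 - rho / s) - ln (1 - rho * s)) < 0.
Proof.
move=> r0 r1 a0 ra rs s1; have s0 : 0 < s by lra.
have rs1 : 0 < 1 - rho / s by rewrite subr_gt0 ltr_pdivrMr // mul1r.
have rs2 : 0 < 1 - rho * s by rewrite subr_gt0; nra.
pose A := (1 - rho * s) / (1 - rho / s).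
have sV : 1 < s^-1 by rewrite invf_gt1.
have u1 : 2 < s + s^-1.
  have -> : s + s^-1 = 2 + (1 - s) ^+ 2 / s by field; rewrite gt_eqF.
  by rewrite ltrDl divr_gt0 // exprn_gt0 // subr_gt0.
have D0 : 0 < 2 - rho * (s + s^-1) by move: rs1 rs2; rewrite mulrDr; lra.
have d : 0 < s^-1 - s by lra.
have A1 : 1 <= A.
  by rewrite ler_pdivlMr // mul1r lerD2l lerN2 ler_pM2l //; lra.
have lA := le_ln_cayley A1.
have E : 2 * (A - 1) / (A + 1) = 2 * rho * (s^-1 - s) / (2 - rho * (s + s^-1)).
  rewrite /A; field.
  have n1 : s != 0 by rewrite gt_eqF.
  have n2 : s - rho != 0 by rewrite gt_eqF // subr_gt0.
  have n3 : 2 * s - rho * (s * s + 1) != 0.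
    have -> : 2 * s - rho * (s * s + 1) = s * (2 - rho * (s + s^-1)) by field.
    by rewrite gt_eqF // mulr_gt0.
  by rewrite n1 n2 n3.
have lnA : ln A = ln (1 - rho * s) - ln (1 - rho / s) by rewrite ln_div ?posrE.
have lnV' := ln_le_half_subV (ltW sV); rewrite invrK lnV ?posrE // in lnV'.
have key : (s^-1 - s) / 2 < alpha * (2 * rho * (s^-1 - s) / (2 - rho * (s + s^-1))).
  rewrite mulrA ltr_pdivlMr //.
  have D4 : 2 - rho * (s + s^-1) < 4 * (alpha * rho).
    by have := mulr_gt0 r0 (_ : 0 < s + s^-1 - 2); rewrite subr_gt0 u1 => /(_ isT); clear -ra; nra.
  have := mulr_gt0 d (_ : 0 < 4 * (alpha * rho) - (2 - rho * (s + s^-1))).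
  rewrite subr_gt0 D4 => /(_ isT); clear; lra.
have : alpha * (2 * rho * (s^-1 - s) / (2 - rho * (s + s^-1))) <= alpha * ln A.
  by rewrite ler_pM2l // -E.
rewrite lnA; move: lnV' key; clear; lra.
Qed.
End log_inequalities.

(** * A Bernstein-Walsh estimate with weight *)

Section walsh.
Variables (R : realType) (rho c : R).
Hypotheses (rho0 : 0 < rho) (rho1 : rho < 1) (c0 : 0 < c).

Lemma sum_expr_le (s : R) n : 0 <= s -> s < 1 -> \sum_(i < n) s ^+ i <= (1 - s)^-1.
Proof.
move=> s0 s1; have d0 : 0 < 1 - s by rewrite subr_gt0.
rewrite -[leRHS]mul1r ler_pdivlMr // mulrC.
have -> : (1 - s) * \sum_(i < n) s ^+ i = 1 - s ^+ n by rewrite -opprB mulNr -subrX1 opprB.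
by rewrite gerBl exprn_ge0.
Qed.

Lemma jouk_unit (w : R[i]) : nc w = 1 ->
  jouk rho c w = (c * nc (1 + rho%:C * w) ^+ 2)%:C.
Proof.
move=> w1; have w0 : w != 0 by rewrite -nc_eq0 w1 oner_eq0.
have iv : w^-1 = w^*%C.
  by apply: (mulfI w0); rewrite divff // mulc_conjc w1 expr1n.
have cj : (1 + rho%:C * w)^*%C = 1 + rho%:C / w.
  by rewrite iv; case: (w) => a b; apply/eqP; rewrite eq_complex /=; apply/andP; split; apply/eqP; ring.
by rewrite rmorphM /= -mulc_conjc cj mulrA.
Qed.

(** For P of degree at most n, this is w^n P(J(w)) (1 + rho w)^m with the pole at 0 cleared by w
    J(w) = c (1 + rho w) (w + rho). *)
Definition jouk_lift (P : {poly R[i]}) n m : {poly R[i]} :=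
  (\sum_(k < n.+1) P`_k *: ('X ^+ (n - k) * (c%:C *: ((1 + rho%:C *: 'X) * ('X + rho%:C%:P))) ^+ k))
  * (1 + rho%:C *: 'X) ^+ m.

Lemma jouk_liftE (P : {poly R[i]}) n m (w : R[i]) : (size P <= n.+1)%N -> w != 0 ->
  (jouk_lift P n m).[w] = w ^+ n * P.[jouk rho c w] * (1 + rho%:C * w) ^+ m.
Proof.
move=> sP w0; rewrite /jouk_lift hornerM horner_exp; congr (_ * _); last by rewrite !hornerE.
rewrite (horner_coef_wide _ sP) horner_sum mulr_sumr; apply: eq_bigr => k _.
have kn : (k <= n)%N by rewrite -ltnS.
have eb : (c%:C *: ((1 + rho%:C *: 'X) * ('X + rho%:C%:P)) : {poly R[i]}).[w] = w * jouk rho c w.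
  by rewrite hornerZ hornerM !hornerD hornerZ !hornerX !hornerC /jouk; field.
rewrite hornerZ hornerM !horner_exp hornerX eb exprMn.
have -> : w ^+ n = w ^+ (n - k) * w ^+ k by rewrite -exprD subnK.
by move: (w ^+ _) (w ^+ _) (jouk _ _ _ ^+ _) => X Y Z; ring.
Qed.

Lemma jouk_real (s : R) : jouk rho c (- s%:C) = (c * (1 - rho * s) * (1 - rho / s))%:C.
Proof.
by rewrite /jouk !rmorphM !rmorphB !rmorph1 !rmorphM fmorphV /= invrN !mulrN.
Qed.

(** On |w| = 1 the weight |J(w)|^al is c^al |1 + rho w|^(2 al), so the factor (1 + rho w)^m imitates
    it by a polynomial. The bound on the circle passes to the coefficients and from there to w = -s
    by a geometric series; the weight at J(-s) contains 1 - rho s only to the power al, whence the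
    gain. *)
Lemma walsh_bound (P : {poly R[i]}) n (al C : R) : (size P <= n.+1)%N -> 0 <= al ->
  (forall x, c * (1 - rho) ^+ 2 <= x <= c * (1 + rho) ^+ 2 ->
     expR (al * ln x) * nc P.[x%:C] <= C) ->
  forall s, rho < s -> s < 1 ->
  expR (al * ln (c * (1 - rho * s) * (1 - rho / s))) * nc P.[jouk rho c (- s%:C)] <=
  C / ((1 - rho) * (1 - s)) * expR (- n%:R * ln s + al * (ln (1 - rho / s) - ln (1 - rho * s))).
Proof.
move=> sP al0 hC s rs s1; have s0 : 0 < s := lt_trans rho0 rs.
have r1 : 0 < 1 - rho by rewrite subr_gt0.
have rs1 : 0 < 1 - rho / s by rewrite subr_gt0 ltr_pdivrMr // mul1r.
have rs2 : 0 < 1 - rho * s by rewrite subr_gt0; nra.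
pose m := Num.trunc (2 * al).
have /andP[m1 m2] := truncn_itv (mulr_ge0 (ler0n _ 2) al0); rewrite -/m in m1 m2.
pose F := jouk_lift P n m.
have C0 : 0 <= C.
  apply: le_trans (hC (c * (1 - rho) ^+ 2) _); first by rewrite mulr_ge0 ?expR_ge0 ?nc_ge0.
  rewrite lexx ler_pM2l //=; have E : (1 + rho) ^+ 2 - (1 - rho) ^+ 2 = 4 * rho by ring.
  by rewrite -subr_ge0 E mulr_ge0 // ltW.
(* The factor 1 / (1 - rho) absorbs the rounding of 2 al to m, since |1 + rho w| >= 1 - rho and 0 <=
   2 al - m < 1. *)
pose M := C * expR (- al * ln c) / (1 - rho).
have M0 : 0 <= M by rewrite !mulr_ge0 ?expR_ge0 ?invr_ge0 // ltW.
have hM w : nc w = 1 -> nc F.[w] <= M.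
  move=> w1; have w0 : w != 0 by rewrite -nc_eq0 w1 oner_eq0.
  rewrite jouk_liftE // !ncM !ncX w1 expr1n mul1r jouk_unit //.
  set a := nc (1 + rho%:C * w).
  have a1 : 1 - rho <= a.
    have := lerB_nc 1 (- (rho%:C * w)); rewrite opprK nc1 ncN ncM nc_real w1 gtr0_norm // mulr1; exact.
  have a2 : a <= 1 + rho.
    by have := ncD 1 (rho%:C * w); rewrite nc1 ncM nc_real w1 gtr0_norm // mulr1.
  have a0 : 0 < a by lra.
  have hx : c * (1 - rho) ^+ 2 <= c * a ^+ 2 <= c * (1 + rho) ^+ 2.
    by rewrite !ler_pM2l // !ler_sqr ?nnegrE ?a1 ?a2 //; lra.
  have := hC _ hx; rewrite mulrC -ler_pdivlMr ?expR_gt0 // -expRN => hP.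
  have lx : ln (c * a ^+ 2) = ln c + 2 * ln a.
    by rewrite lnM ?posrE ?exprn_gt0 // lnXn // mulr_natl.
  have am : a ^+ m = expR (m%:R * ln a) by rewrite expRM_natl lnK.
  apply: (@le_trans _ _ (C * expR (- (al * ln (c * a ^+ 2))) * a ^+ m)).
    by rewrite ler_wpM2r // exprn_ge0 // ltW.
  rewrite am lx /M -[leLHS]mulrA -[leRHS]mulrA -expRD ler_wpM2l //.
  have -> : (1 - rho)^-1 = expR (- ln (1 - rho)) by rewrite expRN lnK.
  rewrite -expRD ler_expR.
  have l1 : ln (1 - rho) <= ln a by rewrite ler_ln.
  have l2 : ln (1 - rho) <= 0 by rewrite ln_le0 // gerBl ltW.
  by clear -l1 l2 m1 m2; nra.
have nF : nc F.[- s%:C] <= M / (1 - s).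
  rewrite horner_coef; apply: (le_trans (nc_sum _ _ _)).
  apply: (@le_trans _ _ (M * \sum_(i < size F) s ^+ i)).
    rewrite mulr_sumr; apply: ler_sum => i _.
    rewrite ncM ncX ncN nc_real gtr0_norm // ler_wpM2r ?exprn_ge0 ?(ltW s0) //.
    exact: nc_coef_le.
  by rewrite ler_wpM2l // sum_expr_le // ltW.
have sn0 : - s%:C != 0 :> R[i] by rewrite oppr_eq0 -nc_eq0 nc_real normr_eq0 gt_eqF.
move: nF; rewrite jouk_liftE // !ncM !ncX ncN nc_real gtr0_norm //.
have -> : nc (1 + rho%:C * - s%:C) = 1 - rho * s.
  by rewrite mulrN -rmorphM -(rmorph1 (real_complex R)) -rmorphB nc_real gtr0_norm.
have -> : s ^+ n = expR (n%:R * ln s) by rewrite expRM_natl lnK.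
have -> : (1 - rho * s) ^+ m = expR (m%:R * ln (1 - rho * s)) by rewrite expRM_natl lnK.
have -> : ln (c * (1 - rho * s) * (1 - rho / s)) = ln c + ln (1 - rho * s) + ln (1 - rho / s).
  by rewrite !lnM ?posrE ?mulr_gt0.
set N := nc _; set u := ln (1 - rho * s); set v := ln (1 - rho / s) => h.
have u0 : u <= 0 by rewrite ln_le0 // gerBl mulr_ge0 // ltW.
have N0 : 0 <= N by exact: nc_ge0.
have -> : expR (al * (ln c + u + v)) * N =
  expR (n%:R * ln s) * N * expR (m%:R * u) * expR (al * (ln c + u + v) - n%:R * ln s - m%:R * u).
  rewrite mulrAC -!mulrA [in RHS](mulrCA N) [in RHS]mulrCA -!expRD [RHS]mulrCA -expRD mulrC.
  by congr (_ * expR _); ring.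
apply: (le_trans (ler_wpM2r (expR_ge0 _) h)).
have -> : M / (1 - s) = C / ((1 - rho) * (1 - s)) * expR (- al * ln c).
  by rewrite /M; field; rewrite !gt_eqF // subr_gt0.
rewrite -[leLHS]mulrA -expRD ler_wpM2l ?divr_ge0 ?mulr_ge0 ?subr_ge0 ?(ltW s1) ?(ltW rho1) //.
(* At w = -s the rounding goes in the favourable direction, because ln(1 - rho s) <= 0. *)
have h2 : 0 <= (2 * al - m%:R) * - u by rewrite mulr_ge0 ?subr_ge0 ?oppr_ge0.
rewrite ler_expR; clear -h2; lra.
Qed.

(** The constant 1 is already out of reach: G is open, so it contains points J(-s) just left of the
    segment, where the weighted polynomials are forced to tend to 0. *)
Lemma segment_no_approximation_pair alpha : 1 <= rho * (1 + 2 * alpha) ->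
  ~ has_approximation_pair
    [set x%:C | x in `[c * (1 - rho) ^+ 2, c * (1 + rho) ^+ 2]] alpha.
Proof.
move=> ra [G [KG _ [[_ oG _] _ _ a0 hG]]].
set p := c * (1 - rho) ^+ 2 in KG *; set q := c * (1 + rho) ^+ 2 in KG *.
have [|P [sP cP]] := hG (fun=> 1); first by move=> z _; exact: derivable_cst.
have loc z : G z -> exists2 U : set (Cplx R), nbhs z U & forall e : R, 0 < e ->
    exists N, forall n, (N <= n)%N -> forall y, U y -> G y ->
    nc (cpow y (alpha * n%:R) * (P n).[y] - 1) < e.
  move=> Gz; have [U nU /unif_ncP hU] := cP z Gz; exists U => // e e0.
  by have [N hN] := hU e e0; exists N => n Nn y Uy Gy; apply: hN.
have pq : p <= q.
  have E : (1 + rho) ^+ 2 - (1 - rho) ^+ 2 = 4 * rho by ring.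
  by rewrite ler_pM2l // -subr_ge0 E mulr_ge0 // ltW.
(* Compactness of the segment turns local uniform convergence into one bound valid on all of it. *)
have [N0 hN0] : exists N0, forall n, (N0 <= n)%N -> forall x, p <= x <= q ->
    nc (cpow x%:C (alpha * n%:R) * (P n).[x%:C]) <= 2.
  have cK : compact ((fun x : R => x%:C : Cplx R) @` `[p, q]).
    apply: continuous_compact; last exact: segment_compact.
    by apply: continuous_subspaceT; exact: continuous_real_complex.
  move: cK => /compact_near_coveringP cK.
  pose Q (n : nat) (y : Cplx R) := G y -> nc (cpow y (alpha * n%:R) * (P n).[y] - 1) < 1.
  have : \forall n \near \oo, ((fun x : R => x%:C : Cplx R) @` `[p, q]) `<=` Q n.
    apply: cK => z [x hx <-].
    have [U nU hU] := loc _ (KG _ (ex_intro2 _ _ x hx erefl)).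
    have [N hN] := hU 1 ltr01.
    exists (U, [set n | (N <= n)%N]).
      by split=> //; exists N.
    by move=> [y n] [/= Uy Nn] Gy; apply: hN.
  move=> [N _ hN]; exists N => n Nn x hx.
  have hx' : `[p, q]%classic x by rewrite /= in_itv.
  have := hN n Nn x%:C (ex_intro2 _ _ x hx' erefl) (KG _ (ex_intro2 _ _ x hx' erefl)).
  set v := _ * _ => hv; have -> : v = (v - 1) + 1 by rewrite subrK.
  by apply: (le_trans (ncD _ _)); rewrite nc1; lra.
have Gp : G p%:C by apply: KG; exists p => //; rewrite /= in_itv /= lexx pq.
have /nbhs_ncP[r r0 hr] : nbhs (p%:C : Cplx R) G by apply: open_nbhs_nbhs.
(* The three terms ensure s > rho, 1/s <= 2, and 1 - s small enough that |J(-s) - p| = c rho (1 -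
   s)^2 / s stays below r. *)
pose s := Num.max (Num.max ((1 + rho) / 2) 2^-1) (1 - r / (4 * (c * rho))).
have cr : 0 < c * rho by rewrite mulr_gt0.
have s1 : s < 1.
  rewrite /s !gt_max; apply/andP; split; first by apply/andP; split; move: rho1; lra.
  by rewrite gtrBl divr_gt0 // mulr_gt0.
have rs : rho < s by rewrite !lt_max; apply/orP; left; apply/orP; left; move: rho1; lra.
have s2 : 2^-1 <= s by rewrite !le_max lexx orbT.
have sr : 1 - s <= r / (4 * (c * rho)).
  have : 1 - r / (4 * (c * rho)) <= s by rewrite !le_max lexx orbT.
  lra.
have s0 : 0 < s := lt_trans rho0 rs.
pose x := c * (1 - rho * s) * (1 - rho / s).
have x0 : 0 < x.
  rewrite !mulr_gt0 // subr_gt0 ?ltr_pdivrMr // ?mul1r //.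
  by rewrite (le_lt_trans _ rho1) // ger_pMr // ltW.
have xj : jouk rho c (- s%:C) = x%:C by exact: jouk_real.
have Gx : G x%:C.
  apply: hr; rewrite -xj jouk_focus1 ?ncM ?ncV ?ncN ?nc_real; last first.
    by rewrite oppr_eq0 -nc_eq0 nc_real normr_eq0 gt_eqF.
  have -> : - s%:C + 1 = (1 - s)%:C by rewrite rmorphB rmorph1 addrC.
  rewrite nc_real !gtr0_norm ?subr_gt0 //.
  have sV : s^-1 <= 2 by rewrite invf_ple ?posrE.
  have d0 : 0 < 1 - s by rewrite subr_gt0.
  have h : c * rho * (1 - s) <= r / 4.
    have -> : r / 4 = c * rho * (r / (4 * (c * rho))) by field; rewrite !gt_eqF.
    by rewrite ler_pM2l.
  have h1 : (1 - s) * (1 - s) <= 1 - s by rewrite ger_pMr // gerBl ltW.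
  have h2 : c * rho * ((1 - s) * (1 - s)) <= r / 4.
    by apply: le_trans h; rewrite ler_pM2l.
  apply: (@le_lt_trans _ _ (r / 4 * 2)); last by lra.
  by apply: ler_pM; rewrite ?invr_ge0 ?mulr_ge0 // ltW.
have [U nU hU] := loc _ Gx.
have [N1 hN1] := hU 2^-1 ltac:(by rewrite invr_gt0).
have Ux : U x%:C by have [r1 r10] := (nbhs_ncP _ _).1 nU; apply; rewrite subrr nc0.
pose kap := - ln s + alpha * (ln (1 - rho / s) - ln (1 - rho * s)).
have kap0 : kap < 0 by exact: kappa_lt0.
have q01 : 0 <= expR kap < 1 by rewrite expR_ge0 /= -[ltRHS]expR0 ltr_expR.
(* With this bound on kappa^n the estimate 2 / ((1 - rho) (1 - s)) kappa^n is below 1/2, whereas the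
   weighted value must be within 1/2 of 1. *)
have de0 : 0 < (1 - rho) * (1 - s) / 4 by rewrite divr_gt0 // mulr_gt0 // subr_gt0.
have [N2 hN2] := natS_mul_expr_small q01 de0.
pose n := maxn N0 (maxn N1 N2).
have n0 : (N0 <= n)%N by rewrite leq_maxl.
have n1 : (N1 <= n)%N by rewrite /n maxnCA leq_maxl.
have n2 : (N2 <= n)%N by rewrite /n !leq_max leqnn !orbT.
have al0 : 0 <= alpha * n%:R by rewrite mulr_ge0 // ltW.
have ncE' y : 0 < y -> nc (cpow y%:C (alpha * n%:R) * (P n).[y%:C]) =
    expR (alpha * n%:R * ln y) * nc (P n).[y%:C].
  by move=> y0; rewrite (ncM (cpow _ _)) nc_cpow nc_real gtr0_norm.
have hw : expR (alpha * n%:R * ln x) * nc (P n).[x%:C] <=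
    2 / ((1 - rho) * (1 - s)) * expR kap ^+ n.
  have := @walsh_bound (P n) n (alpha * n%:R) 2 (sP n) al0 _ s rs s1.
  rewrite xj -/x; set E := - n%:R * ln s + _.
  have -> : expR kap ^+ n = expR E.
    by rewrite -expRM_natl; congr expR; rewrite /kap /E; ring.
  apply=> y hy; rewrite -ncE'; first exact: hN0.
  move/andP: hy => [+ _]; apply: lt_le_trans; rewrite mulr_gt0 // exprn_gt0 // subr_gt0 //.
have := hN1 n n1 _ Ux Gx; set v := _ * _ => hv.
have nv : 2^-1 < nc v by have := lerB_nc 1 v; rewrite nc1 ncBC; lra.
move: nv; rewrite /v ncE' // => nv.
have := hN2 n n2.
have h3 : expR kap ^+ n <= n.+1%:R * expR kap ^+ n.
  by rewrite ler_peMl ?exprn_ge0 ?expR_ge0 // ler1n.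
move=> /(le_lt_trans h3); have := lt_le_trans nv hw.
have D0 : 0 < (1 - rho) * (1 - s) by rewrite mulr_gt0 // subr_gt0.
rewrite mulrAC ltr_pdivlMr //; lra.
Qed.

End walsh.

Theorem proposition4p3 (R : realType) (x0 : R) (hx0 : 1 < x0) :
  is_alphaK [set t%:C | t in `[1, x0]] (1 / (Num.sqrt x0 - 1))%:E.
Proof.
have x00 : 0 <= x0 by lra.
have r1 : 1 < Num.sqrt x0 by rewrite -sqrtr1 ltr_sqrt //; lra.
have r2 : Num.sqrt x0 ^+ 2 = x0 by rewrite sqr_sqrtr.
move: (Num.sqrt x0) r1 r2 => r r1 r2.
(* The solution of c (1 - rho)^2 = 1 and c (1 + rho)^2 = r^2 = x0 with 0 < rho < 1, so that the foci
   are the endpoints of the segment. *)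
pose rho := (r - 1) / (r + 1); pose c := ((r + 1) / 2) ^+ 2.
have rp : 0 < r + 1 by lra.
have rm : 0 < r - 1 by lra.
have rho0 : 0 < rho by rewrite divr_gt0.
have rho1 : rho < 1 by rewrite ltr_pdivrMr // mul1r; lra.
have c0 : 0 < c by rewrite exprn_gt0 // divr_gt0.
have -> : [set t%:C | t in `[1, x0]] =
    [set x%:C | x in `[c * (1 - rho) ^+ 2, c * (1 + rho) ^+ 2]] :> set (Cplx R).
  have -> : c * (1 - rho) ^+ 2 = 1 by rewrite /c /rho; field; rewrite gt_eqF.
  by have -> : c * (1 + rho) ^+ 2 = x0 by rewrite -r2 /c /rho; field; rewrite gt_eqF.
have crit alpha : (rho * (1 + 2 * alpha) < 1) = (alpha < 1 / (r - 1)).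
  rewrite ltr_pdivlMr // /rho mulrAC ltr_pdivrMr // mul1r.
  by apply/idP/idP; nra.
split.
- by rewrite lte_fin divr_gt0.
- by move=> alpha a0; rewrite lte_fin -crit => ha; exact: segment_approximation_pair.
- move=> alpha; rewrite lee_fin leNgt -crit -leNgt => ha.
  exact: segment_no_approximation_pair.
Qed.
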